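(* Let $\mathtt{d}$ be the density of a probability distribution that is supported in a finite interval $[a,b]$ with $a>0$. Assume that $\mathtt{d}$ is twice continuously differentiable on $(a,b)$, and that $\mathtt{d}(a)\mathtt{d}(b)\ne 0$. For any constant $c>0$, the function $f(k):=\widehat{\mathtt{d}}(k)-1$ has only finitely many zeros in the strip $\Pi_c:=\{k\in\mathbb{C}:-c<\operatorname{Im} k<0\}$. Suppose that $f$ does not vanish on the line $\{k\in\mathbb{C}:\operatorname{Im} k=-c\}$. Then $$F_{\mathtt{d}}(x)=\frac{1}{x}\bigg(1+\sum_k m(k)e^{-ikx}+E(c,x)e^{-cx}\bigg)\qquad(x>0),$$ where the sum is taken over those zeros $k$ of $f$ that lie in $\Pi_c$, $m(k)$ is the multiplicity of any such zero, and $$E(c,x):=\frac{1}{2\pi i}\int_{\mathbb{R}}\left(\frac{\widehat{\mathtt{d}}'(u-ic)}{1-\widehat{\mathtt{d}}(u-ic)}-\widehat{\mathtt{d}}'(u-ic)\right)e^{-iux}\,du.$$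
   Context: For $n\in\mathbb{N}$, $\mathtt{d}^{*n}:=\mathtt{d}*\cdots*\mathtt{d}$ ($n$ times) is the $n$-fold convolution of $\mathtt{d}$ with itself. Put $F_{\mathtt{d}}(x):=\sum_{n=1}^\infty \frac{\mathtt{d}^{*n}(x)}{n}$ for $x>0$; since $\mathtt{d}^{*n}(x)=0$ whenever $x<na$, for every $x>0$ the series has only finitely many nonzero terms. The Fourier transform of $\mathtt{d}$ is the entire function $\widehat{\mathtt{d}}(k):=\int_a^b\mathtt{d}(x)e^{ikx}\,dx$ ($k\in\mathbb{C}$), and $\widehat{\mathtt{d}}'$ denotes its derivative.
   Formalization: For x in [a,b] the formula as displayed fails (the term −d̂′ removes the n=1 term), so there it is proved with d(x) added to the right-hand side; it is verbatim for other x>0. The values d(a), d(b) are read as one-sided boundary values, i.e. d is continuous on [a,b]. *)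

(* Defs.v *)
From HB Require Import structures.
From mathcomp Require Import all_boot all_order all_algebra.
From mathcomp Require Import all_classical all_reals all_analysis.
From mathcomp.real_closed Require Import complex.

Set Implicit Arguments.
Unset Strict Implicit.
Unset Printing Implicit Defensive.

Import Order.TTheory GRing.Theory Num.Theory numFieldNormedType.Exports.

Local Open Scope complex_scope.
Local Open Scope classical_set_scope.
Local Open Scope ring_scope.

(* R[i] carries no topology in the libraries; seen as a numFieldType it
   inherits the one of its norm, so that [derive1] and [derive1n] on functions
   CC R -> CC R are the complex derivatives. *)
Definition CC (R : realType) : numFieldType := R[i].

Definition CofR (R : realType) (x : R) : CC R := x%:C.
Definition CI (R : realType) : CC R := 0 +i* 1.
Definition ReC (R : realType) (z : CC R) : R := complex.Re z.
Definition ImC (R : realType) (z : CC R) : R := complex.Im z.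

Arguments CI {R}.

Definition cexp (R : realType) (z : CC R) : CC R :=
  CofR (expR (ReC z)) * (cos (ImC z) +i* sin (ImC z)).

Definition Cintegrable (R : realType) (A : set R) (g : R -> CC R) : Prop :=
  (@lebesgue_measure R).-integrable A (fun x => (ReC (g x))%:E) /\
  (@lebesgue_measure R).-integrable A (fun x => (ImC (g x))%:E).

Definition Cint (R : realType) (A : set R) (g : R -> CC R) : CC R :=
  (\int[@lebesgue_measure R]_(x in A) ReC (g x)) +i*
  (\int[@lebesgue_measure R]_(x in A) ImC (g x)).

Definition is_density (R : realType) (d : R -> R) : Prop :=
  [/\ measurable_fun setT d,
      forall x, 0 <= d x &
      (\int[@lebesgue_measure R]_x (d x)%:E)%E = 1%E].

Definition C2_on (R : realType) (A : set R) (f : R -> R) : Prop :=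
  forall x, A x ->
    [/\ derivable f x 1, derivable (derive1 f) x 1 &
        {for x, continuous (derive1n 2 f)}].

Definition convolution (R : realType) (f g : R -> R) (x : R) : R :=
  \int[@lebesgue_measure R]_y (f y * g (x - y)).

(* [convn d n] is the n-fold convolution d^{*n} for 0 < n; the value at n = 0
   is irrelevant. *)
Definition convn (R : realType) (d : R -> R) (n : nat) : R -> R :=
  iter n.-1 (convolution d) d.

Definition Fsum (R : realType) (d : R -> R) (x : R) : R :=
  limn (fun N : nat => \sum_(1 <= n < N) (convn d n x / n%:R)).

Definition fourier (R : realType) (a b : R) (d : R -> R) (k : CC R) : CC R :=
  Cint `[a, b] (fun x => CofR (d x) * cexp (CI * k * CofR x)).

Definition strip (R : realType) (c : R) : set (CC R) :=
  [set k | - c < ImC k < 0].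

(* Order of vanishing of f at k, for f holomorphic near k and not locally
   zero; 0 when f does not vanish at k. *)
Definition multiplicity (R : realType) (f : CC R -> CC R) (k : CC R) : nat :=
  xget 0%N [set m | (forall j, (j < m)%N -> derive1n j f k = 0) /\
                    derive1n m f k != 0].

Definition Eintegrand (R : realType) (a b : R) (d : R -> R) (c x u : R) : CC R :=
  let h := fourier a b d in
  let k : CC R := CofR u - CI * CofR c in
  (derive1 h k / (1 - h k) - derive1 h k) * cexp (- (CI * CofR u * CofR x)).

(* Subtracting h' cancels the n = 1 term of the series: F_d expands with this
   remainder off [a, b], and F_d - d does on [a, b].  The remainder is
   continuous in x whereas F_d jumps by d a <> 0 at x = a. *)
Definition Eterm (R : realType) (a b : R) (d : R -> R) (c x : R) : CC R :=
  (2%:R * CofR pi * CI)^-1 * Cint setT (Eintegrand a b d c x).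

(* Main.v *)
Require Import Defs.
From HB Require Import structures.
From mathcomp Require Import all_boot all_order all_algebra.
From mathcomp Require Import all_classical all_reals all_analysis.
From mathcomp Require Import measurable_realfun.
From mathcomp Require Import ring lra.
From mathcomp.real_closed Require Import complex.

Set Implicit Arguments.
Unset Strict Implicit.
Unset Printing Implicit Defensive.

Import Order.TTheory GRing.Theory Num.Theory numFieldNormedType.Exports.

Local Open Scope complex_scope.
Local Open Scope classical_set_scope.
Local Open Scope ring_scope.

(* Write h for the transform of d.  The transform of d^{*n} is h^n, so that
   x d^{*n}(x) / n is, up to a constant, the inverse transform of h^(n-1) h'.
   On the line Im k = 1 one has |h| <= exp (- a) < 1, and summing the inversion
   formulas over n >= 2 (the term n = 1 need not be integrable) represents
   x (F(x) - d(x)) by the integral of h h' / (1 - h) e^{-ikx} over that line.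
   The line is then moved down to Im k = - c, each zero z of h - 1 contributing
   its multiplicity times e^{-izx}; the zero k = 0 gives the 1.

   Zeros are divided out one at a time: if q is bounded with compact support and
   its transform vanishes at z, then (k - z)^-1 times this transform is again the
   transform of such a function.  Hence h - 1 = P Q with P a polynomial and Q a
   zero-free transform on the closed strip, and h h' / (1 - h) differs from the
   sum of the - 1 / (k - z) by the holomorphic function - Q' / Q - h'.  For the
   latter the contour shift amounts to differentiating a truncated line integral
   in the height of the line (decay at infinity is the Riemann-Lebesgue lemma),
   while 1 / (k - z) is the transform of an explicit one-sided exponential.
   Integrability on lines comes from Plancherel: h and h' are square integrable. *)

(** * Complex numbers *)

Section complex_basics.
Variable R : realType.
Implicit Types (z w : CC R) (x y : R).

(** Complex analysis is done on the side of the integrated function. The class [bcs] of bounded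
    measurable functions with support in some [0, B] is stable under multiplication by i s
    (differentiation of the transform) and by exponentials (passage to another horizontal line),
    under convolution, and under the division [qdiv]; so analyticity, orders of zeros and decay are
    read off integrals, without power series or residues. The delicate point is that dividing out
    zeros comes to an end. Riemann-Lebesgue excludes zeros with large real part, so the others stay
    within a fixed distance of 0. In the sup norm weighted by exp (l s), a division costs a factor 2
    / (l - c), small for large l, while the factors split off stay bounded at a base point; were
    there always one more zero, the transform would vanish at the base point. The base point is 0
    itself, once its zero is divided out: this zero is simple because d has positive mean. Another
    real zero u would make the integral of d s * (1 - cos (u s)) vanish, against the positivity of d
    near a. *)

Definition cabs (z : CC R) : R := ComplexField.Normc.normc z.

Lemma CC_ext z w : ReC z = ReC w -> ImC z = ImC w -> z = w.
Proof. by move: z w => [a b] [c d]; rewrite /ReC /ImC /= => -> ->. Qed.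

Lemma ReCD z w : ReC (z + w) = ReC z + ReC w.
Proof. by move: z w => [a b] [c d]. Qed.
Lemma ImCD z w : ImC (z + w) = ImC z + ImC w.
Proof. by move: z w => [a b] [c d]. Qed.
Lemma ReCN z : ReC (- z) = - ReC z.
Proof. by move: z => [a b]. Qed.
Lemma ImCN z : ImC (- z) = - ImC z.
Proof. by move: z => [a b]. Qed.
Lemma ReCM z w : ReC (z * w) = ReC z * ReC w - ImC z * ImC w.
Proof. by move: z w => [a b] [c d]. Qed.
Lemma ImCM z w : ImC (z * w) = ReC z * ImC w + ImC z * ReC w.
Proof. by move: z w => [a b] [c d]. Qed.
Lemma ReC_ofR x : ReC (CofR x) = x. Proof. by []. Qed.
Lemma ImC_ofR x : ImC (CofR x) = 0. Proof. by []. Qed.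
Lemma ReCI : ReC (@CI R) = 0. Proof. by []. Qed.
Lemma ImCI : ImC (@CI R) = 1. Proof. by []. Qed.
Lemma ReC0 : ReC (0 : CC R) = 0. Proof. by []. Qed.
Lemma ImC0 : ImC (0 : CC R) = 0. Proof. by []. Qed.
Lemma ReC1 : ReC (1 : CC R) = 1. Proof. by []. Qed.
Lemma ImC1 : ImC (1 : CC R) = 0. Proof. by []. Qed.

Definition CE := (ReCD, ImCD, ReCN, ImCN, ReCM, ImCM, ReC_ofR, ImC_ofR, ReCI,
  ImCI, ReC0, ImC0, ReC1, ImC1).

Lemma CofRD x y : CofR (x + y) = CofR x + CofR y.
Proof. by apply: CC_ext; rewrite !CE ?addr0. Qed.
Lemma CofRN x : CofR (- x) = - CofR x.
Proof. by apply: CC_ext; rewrite !CE ?oppr0. Qed.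
Lemma CofRB x y : CofR (x - y) = CofR x - CofR y.
Proof. by rewrite CofRD CofRN. Qed.
Lemma CofRM x y : CofR (x * y) = CofR x * CofR y.
Proof. by apply: CC_ext; rewrite !CE; ring. Qed.
Lemma CofR0 : CofR (0 : R) = 0. Proof. by []. Qed.
Lemma CofR1 : CofR (1 : R) = 1. Proof. by []. Qed.
Lemma CofR_nat n : CofR (n%:R : R) = n%:R.
Proof. by elim: n => // n IH; rewrite !mulrS CofRD IH. Qed.
Lemma CofRV x : CofR (x^-1) = (CofR x)^-1.
Proof. exact: (fmorphV (real_complex R)). Qed.
Lemma CofR_inj : injective (@CofR R).
Proof. by move=> x y []. Qed.
Lemma CofR_eq0 x : (CofR x == 0) = (x == 0).
Proof. by rewrite -CofR0 (inj_eq CofR_inj). Qed.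

Lemma CI2 : CI * CI = - 1 :> CC R.
Proof. by apply: CC_ext; rewrite !CE; ring. Qed.
Lemma CI_neq0 : CI != 0 :> CC R.
Proof. by apply/eqP => /(congr1 (@ImC R)); rewrite !CE => /eqP; rewrite oner_eq0. Qed.

Lemma CCE z : z = CofR (ReC z) + CI * CofR (ImC z).
Proof. by apply: CC_ext; rewrite !CE; ring. Qed.

Lemma cabs_sq z : cabs z ^+ 2 = ReC z ^+ 2 + ImC z ^+ 2.
Proof.
case: z => a b; rewrite /cabs /= sqr_sqrtr //.
by rewrite addr_ge0 // sqr_ge0.
Qed.
Lemma cabs_ge0 z : 0 <= cabs z.
Proof. by case: z => a b; rewrite /cabs /= sqrtr_ge0. Qed.
Lemma cabs0 : cabs 0 = 0. Proof. exact: ComplexField.Normc.normc0. Qed.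
Lemma cabs1 : cabs 1 = 1. Proof. exact: ComplexField.Normc.normc1. Qed.
Lemma cabs_eq0 z : (cabs z == 0) = (z == 0).
Proof.
apply/eqP/eqP => [|->]; last exact: cabs0.
exact: ComplexField.Normc.eq0_normc.
Qed.
Lemma cabs_gt0 z : (0 < cabs z) = (z != 0).
Proof. by rewrite lt_def cabs_eq0 cabs_ge0 andbT. Qed.
Lemma cabsM z w : cabs (z * w) = cabs z * cabs w.
Proof. exact: ComplexField.Normc.normcM. Qed.
Lemma cabsV z : cabs (z^-1) = (cabs z)^-1.
Proof. exact: ComplexField.Normc.normcV. Qed.
Lemma cabsN z : cabs (- z) = cabs z.
Proof. exact: normcN. Qed.
Lemma cabsD z w : cabs (z + w) <= cabs z + cabs w.
Proof. exact: le_normcD. Qed.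
Lemma cabsB z w : cabs (z - w) <= cabs z + cabs w.
Proof. by rewrite -(cabsN w) cabsD. Qed.
Lemma cabsC z w : cabs (z - w) = cabs (w - z).
Proof. by rewrite -cabsN opprB. Qed.
Lemma cabsX z n : cabs (z ^+ n) = cabs z ^+ n.
Proof. by elim: n => [|n IH]; rewrite ?expr0 ?cabs1// !exprS cabsM IH. Qed.
Lemma cabs_ofR x : cabs (CofR x) = `|x|.
Proof. by rewrite /cabs /= expr0n /= addr0 sqrtr_sqr. Qed.
Lemma cabsI : cabs CI = 1.
Proof. by rewrite /cabs /= expr0n /= add0r expr1n sqrtr1. Qed.
Lemma normCC z : `|z| = CofR (cabs z).
Proof. by case: z. Qed.
Lemma cabs_prod (s : seq (CC R)) (F : CC R -> CC R) :
  cabs (\prod_(z <- s) F z) = \prod_(z <- s) cabs (F z).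
Proof. by rewrite (big_morph cabs cabsM cabs1). Qed.
Lemma le_cabs z x : 0 <= x -> (cabs z <= x) = (ReC z ^+ 2 + ImC z ^+ 2 <= x ^+ 2).
Proof. by move=> x0; rewrite -cabs_sq ler_pXn2r // nnegrE ?cabs_ge0. Qed.
Lemma Re_le_cabs z : `|ReC z| <= cabs z.
Proof.
by rewrite -(ler_pXn2r (n := 2)) ?nnegrE ?cabs_ge0 ?normr_ge0 // cabs_sq real_normK ?num_real // lerDl sqr_ge0.
Qed.
Lemma Im_le_cabs z : `|ImC z| <= cabs z.
Proof.
by rewrite -(ler_pXn2r (n := 2)) ?nnegrE ?cabs_ge0 ?normr_ge0 // cabs_sq real_normK ?num_real // lerDr sqr_ge0.
Qed.
Lemma cabs_le_ReIm z : cabs z <= `|ReC z| + `|ImC z|.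
Proof.
rewrite le_cabs ?addr_ge0 ?normr_ge0//.
rewrite -(real_normK (num_real (ReC z))) -(real_normK (num_real (ImC z))).
have := normr_ge0 (ReC z); have := normr_ge0 (ImC z); nra.
Qed.

Lemma lerB_cabs z w : cabs z - cabs w <= cabs (z - w).
Proof. by rewrite lerBlDr (le_trans _ (cabsD _ _)) // subrK. Qed.

Lemma Re_cexp z : ReC (cexp z) = expR (ReC z) * cos (ImC z).
Proof. by rewrite /cexp ReCM !CE mul0r subr0. Qed.
Lemma Im_cexp z : ImC (cexp z) = expR (ReC z) * sin (ImC z).
Proof. by rewrite /cexp ImCM !CE mul0r addr0. Qed.
Lemma cexpD z w : cexp (z + w) = cexp z * cexp w.
Proof.
apply: CC_ext; rewrite !(Re_cexp, Im_cexp, CE) expRD ?cosD ?sinD; ring.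
Qed.
Lemma cexp0 : cexp 0 = 1 :> CC R.
Proof. by apply: CC_ext; rewrite !(Re_cexp, Im_cexp, CE) expR0 ?cos0 ?sin0; ring. Qed.
Lemma cabs_cexp z : cabs (cexp z) = expR (ReC z).
Proof.
apply/eqP; rewrite -(eqrXn2 (n := 2)) ?cabs_ge0 ?expR_ge0 // cabs_sq Re_cexp Im_cexp.
by rewrite !exprMn -mulrDr cos2Dsin2 mulr1.
Qed.
Lemma cexp_neq0 z : cexp z != 0.
Proof. by rewrite -cabs_gt0 cabs_cexp expR_gt0. Qed.
Lemma cexpN z : cexp (- z) = (cexp z)^-1.
Proof.
apply: (mulfI (cexp_neq0 z)).
by rewrite mulfV ?cexp_neq0 // -cexpD subrr cexp0.
Qed.
Lemma cexp_ofR x : cexp (CofR x) = CofR (expR x).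
Proof. by apply: CC_ext; rewrite !(Re_cexp, Im_cexp, CE) ?cos0 ?sin0; ring. Qed.

End complex_basics.

Arguments cabs : simpl never.
Arguments cexp : simpl never.
Arguments CofR : simpl never.

(** * Integrals of complex-valued functions *)

Section real_integral.
Variable R : realType.
Local Notation mu := (@lebesgue_measure R).

Definition rintg (f : R -> R) : Prop := mu.-integrable setT (EFin \o f).

Lemma rintg_meas f : rintg f -> measurable_fun setT f.
Proof. by move=> /measurable_int /measurable_EFinP. Qed.

Lemma rintg_dom (f G : R -> R) : measurable_fun setT f -> rintg G ->
  (forall x, `|f x| <= G x) -> rintg f.
Proof.
move=> mf iG fG; apply: le_integrable iG => //; first exact/measurable_EFinP.
by move=> x _ /=; rewrite lee_fin (le_trans (fG x)) // ler_norm.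
Qed.

Lemma rintgD f g : rintg f -> rintg g -> rintg (fun x => f x + g x).
Proof. by move=> fi gi; have := integrableD measurableT fi gi. Qed.

Lemma rintgN f : rintg f -> rintg (fun x => - f x).
Proof. by move=> fi; have := integrableN fi. Qed.

Lemma rintgB f g : rintg f -> rintg g -> rintg (fun x => f x - g x).
Proof. by move=> fi gi; apply: rintgD => //; exact: rintgN. Qed.

Lemma rintgZ r f : rintg f -> rintg (fun x => r * f x).
Proof. by move=> fi; have := integrableZl measurableT r fi. Qed.

Lemma rintg_norm f : rintg f -> rintg (fun x => `|f x|).
Proof. by move=> fi; have := integrable_norm fi. Qed.

Lemma rintD f g : rintg f -> rintg g ->
  \int[mu]_x (f x + g x) = \int[mu]_x f x + \int[mu]_x g x.
Proof. by move=> fi gi; apply: RintegralD. Qed.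

Lemma rintZ r f : rintg f -> \int[mu]_x (r * f x) = r * \int[mu]_x f x.
Proof. by move=> fi; apply: RintegralZl. Qed.

Lemma rintN f : rintg f -> \int[mu]_x (- f x) = - \int[mu]_x f x.
Proof.
move=> fi; rewrite -[RHS]mulN1r -rintZ //.
by apply: eq_Rintegral => x _; rewrite mulN1r.
Qed.

Lemma rintB f g : rintg f -> rintg g ->
  \int[mu]_x (f x - g x) = \int[mu]_x f x - \int[mu]_x g x.
Proof. by move=> fi gi; rewrite rintD ?rintN //; exact: rintgN. Qed.

Lemma rint_le f g : rintg f -> rintg g -> (forall x, f x <= g x) ->
  \int[mu]_x f x <= \int[mu]_x g x.
Proof. by move=> fi gi fg; apply: le_Rintegral => // x _. Qed.

Lemma rint_ge0 f : (forall x, 0 <= f x) -> 0 <= \int[mu]_x f x.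
Proof. by move=> f0; apply: Rintegral_ge0 => x _. Qed.

Lemma rintgE f : rintg f -> (\int[mu]_x (f x)%:E)%E = (\int[mu]_x f x)%:E.
Proof. by move=> fi; rewrite /Rintegral fineK // integrable_fin_num. Qed.

Lemma rdct (f_ : nat -> R -> R) (f G : R -> R) :
  (forall n, measurable_fun setT (f_ n)) -> measurable_fun setT f -> rintg G ->
  {ae mu, forall x, f_ ^~ x @ \oo --> f x} -> (forall n x, `|f_ n x| <= G x) ->
  rintg f /\ (fun n => \int[mu]_x f_ n x) @ \oo --> \int[mu]_x f x.
Proof.
move=> mf_ mf iG ff fG.
have [] := @dominated_convergence _ _ R mu setT measurableT
   (fun n x => (f_ n x)%:E) (EFin \o f) (EFin \o G).
- by move=> n; apply/measurable_EFinP; exact: mf_.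
- exact/measurable_EFinP.
- by apply: (@filterS _ _ (ae_filter_ringOfSetsType mu)) ff => x fx _; apply: cvg_EFin => //; exact: nearW.
- exact: iG.
- by apply: nearW => x n _; rewrite lee_fin.
move=> fi _ cf; split => //.
rewrite /Rintegral; apply: fine_cvg.
by rewrite fineK; [exact: cf|exact: integrable_fin_num].
Qed.

(** Domination by a product A x * B y replaces integrability on the plane: by Tonelli the double
    integral of |f| is at most the product of the integrals of |A| and |B|, and every section of f
    is integrable, not merely almost every one. *)
Lemma rfubini (f : R * R -> R) (A B : R -> R) :
  measurable_fun setT f -> rintg A -> rintg B ->
  (forall x y, `|f (x, y)| <= A x * B y) ->
  rintg (fun x => \int[mu]_y f (x, y)) /\
  \int[mu]_x \int[mu]_y f (x, y) = \int[mu]_y \int[mu]_x f (x, y).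
Proof.
move=> mf iA iB fAB.
have A0 x y : 0 <= A x * B y by apply: le_trans (fAB x y); exact: normr_ge0.
have iAB : (mu \x mu)%E.-integrable setT (EFin \o f).
  apply/integrable12ltyP; first exact/measurable_EFinP.
  have lt : (\int[mu]_x (`|A x| * (\int[mu]_y `|B y|))%:E < +oo)%E.
    have := rintgZ (\int[mu]_y `|B y|) (rintg_norm iA).
    move=> /(integrable_fin_num measurableT).
    rewrite ge0_fin_numE /=; last first.
      by apply: integral_ge0 => x _; rewrite lee_fin mulr_ge0 // rint_ge0.
    by under eq_integral do rewrite mulrC.
  apply: le_lt_trans lt; apply: ge0_le_integral => //.
  - by move=> x _; apply: integral_ge0 => y _; exact: abse_ge0.
  - apply: (@measurable_fun_fubini_tonelli_F _ _ _ _ R mu (abse \o (EFin \o f))) => //=.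
      by apply: measurableT_comp => //; exact/measurable_EFinP.
  - apply/measurable_EFinP/measurable_funM => //.
    by apply: rintg_meas; exact: rintg_norm.
  - move=> x _; rewrite EFinM -(rintgE (rintg_norm iB)) -integralZl //; last exact: rintg_norm iB.
    apply: ge0_le_integral => //.
    + apply: measurableT_comp => //; apply/measurable_EFinP.
      by apply: measurableT_comp mf _; exact: measurable_fun_pair.
    + apply/measurable_EFinP/measurable_funM => //.
      by apply: rintg_meas; exact: rintg_norm.
    + move=> y _; rewrite /= lee_fin (le_trans (fAB x y)) //.
      by rewrite -normrM ler_norm.
have i1 x : rintg (fun y => f (x, y)).
  apply: rintg_dom (rintgZ (A x) iB) _ => //.
  by apply: measurableT_comp mf _; exact: measurable_fun_pair.
have i2 y : rintg (fun x => f (x, y)).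
  apply: rintg_dom (rintgZ (B y) iA) _ => //.
    by apply: measurableT_comp mf _; exact: measurable_fun_pair.
  by move=> x; rewrite mulrC.
have F1 : fubini_F mu (EFin \o f) = EFin \o (fun x => \int[mu]_y f (x, y)).
  by apply/funext => x; rewrite /fubini_F /= rintgE.
have iF : rintg (fun x => \int[mu]_y f (x, y)).
  by rewrite /rintg -F1; exact: integrable_fubini_F iAB.
split; first exact: iF.
transitivity (fine (\int[mu]_x \int[mu]_y (EFin \o f) (x, y))%E).
  rewrite [LHS]/Rintegral; congr fine; apply: eq_integral => x _.
  by rewrite -rintgE //; exact: i1.
rewrite (Fubini iAB) [RHS]/Rintegral; congr fine; apply: eq_integral => x _.
by rewrite -rintgE //; exact: i2.
Qed.

End real_integral.

Section complex_integral.
Variable R : realType.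
Local Notation mu := (@lebesgue_measure R).

Definition cmeas d (T : measurableType d) (g : T -> CC R) : Prop :=
  measurable_fun setT (fun x => ReC (g x)) /\
  measurable_fun setT (fun x => ImC (g x)).

Section cmeas_theory.
Context d (T : measurableType d).
Implicit Types g h : T -> CC R.

Lemma cmeas_cst (z : CC R) : cmeas (fun _ : T => z).
Proof. by split; exact: measurable_cst. Qed.

Lemma cmeasD g h : cmeas g -> cmeas h -> cmeas (fun x => g x + h x).
Proof.
move=> [g1 g2] [h1 h2]; split.
  by under eq_fun do rewrite ReCD; exact: measurable_funD.
by under eq_fun do rewrite ImCD; exact: measurable_funD.
Qed.

Lemma cmeasN g : cmeas g -> cmeas (fun x => - g x).
Proof.
move=> [g1 g2]; split.
  by under eq_fun do rewrite ReCN; exact: measurable_funN.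
by under eq_fun do rewrite ImCN; exact: measurable_funN.
Qed.

Lemma cmeasB g h : cmeas g -> cmeas h -> cmeas (fun x => g x - h x).
Proof. by move=> mg mh; apply: cmeasD mg _; exact: cmeasN. Qed.

Lemma cmeasM g h : cmeas g -> cmeas h -> cmeas (fun x => g x * h x).
Proof.
move=> [g1 g2] [h1 h2]; split.
  under eq_fun do rewrite ReCM.
  by apply: measurable_funB; exact: measurable_funM.
under eq_fun do rewrite ImCM.
by apply: measurable_funD; exact: measurable_funM.
Qed.

Lemma cmeasX g n : cmeas g -> cmeas (fun x => g x ^+ n).
Proof.
move=> mg; elim: n => [|n IH].
  by under eq_fun do rewrite expr0; exact: cmeas_cst.
by under eq_fun do rewrite exprS; exact: cmeasM.
Qed.

Lemma cmeas_ofR (f : T -> R) : measurable_fun setT f -> cmeas (fun x => CofR (f x)).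
Proof. by move=> mf; split => //; exact: measurable_cst. Qed.

Lemma cmeas_cexp g : cmeas g -> cmeas (fun x => cexp (g x)).
Proof.
move=> [g1 g2]; split.
  under eq_fun do rewrite Re_cexp; apply: measurable_funM.
    exact: measurableT_comp (@measurable_expR R) g1.
  by apply: measurableT_comp g2; apply: continuous_measurable_fun; exact: continuous_cos.
under eq_fun do rewrite Im_cexp; apply: measurable_funM.
  exact: measurableT_comp (@measurable_expR R) g1.
by apply: measurableT_comp g2; apply: continuous_measurable_fun; exact: continuous_sin.
Qed.

Lemma cmeas_comp d' (T' : measurableType d') (phi : T' -> T) g :
  measurable_fun setT phi -> cmeas g -> cmeas (fun x => g (phi x)).
Proof. by move=> mphi [g1 g2]; split; [exact: (measurableT_comp g1 mphi)|exact: (measurableT_comp g2 mphi)]. Qed.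

Lemma cmeas_cabs g : cmeas g -> measurable_fun setT (fun x => cabs (g x)).
Proof.
move=> [g1 g2].
have -> : (fun x => cabs (g x)) =
    (fun x => Num.sqrt (ReC (g x) ^+ 2 + ImC (g x) ^+ 2)).
  by apply/funext => x; case: (g x).
apply: measurableT_comp; last by apply: measurable_funD; exact: measurable_funX.
by apply: continuous_measurable_fun; exact: sqrt_continuous.
Qed.

End cmeas_theory.

Definition cint (g : R -> CC R) : CC R := Cint setT g.
Definition cintg (g : R -> CC R) : Prop := Cintegrable setT g.

Lemma Re_cint g : ReC (cint g) = \int[mu]_x ReC (g x). Proof. by []. Qed.
Lemma Im_cint g : ImC (cint g) = \int[mu]_x ImC (g x). Proof. by []. Qed.

Lemma cintgE g : cintg g <->
  rintg (fun x => ReC (g x)) /\ rintg (fun x => ImC (g x)).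
Proof. by []. Qed.

Lemma cintg_meas g : cintg g -> cmeas g.
Proof. by move=> [g1 g2]; split; exact: rintg_meas. Qed.

Lemma cintg_dom g (G : R -> R) : cmeas g -> rintg G ->
  (forall x, cabs (g x) <= G x) -> cintg g.
Proof.
move=> [g1 g2] iG gG; split.
  by apply: (rintg_dom g1 iG) => x; exact: le_trans (Re_le_cabs _) (gG x).
by apply: (rintg_dom g2 iG) => x; exact: le_trans (Im_le_cabs _) (gG x).
Qed.

Lemma cintg_cabs g : cintg g -> rintg (fun x => cabs (g x)).
Proof.
move=> ig; have [i1 i2] := ig.
apply: rintg_dom (rintgD (rintg_norm i1) (rintg_norm i2)) _.
  exact: cmeas_cabs (cintg_meas ig).
by move=> x; rewrite ger0_norm ?cabs_ge0 // cabs_le_ReIm.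
Qed.

Lemma cintgD g h : cintg g -> cintg h -> cintg (fun x => g x + h x).
Proof.
move=> [g1 g2] [h1 h2]; apply/cintgE; split.
  by under eq_fun do rewrite ReCD; exact: rintgD.
by under eq_fun do rewrite ImCD; exact: rintgD.
Qed.

Lemma cintgZ (z : CC R) g : cintg g -> cintg (fun x => z * g x).
Proof.
move=> [g1 g2]; apply/cintgE; split.
  by under eq_fun do rewrite ReCM; apply: rintgB; exact: rintgZ.
by under eq_fun do rewrite ImCM; apply: rintgD; exact: rintgZ.
Qed.

Lemma cintgN g : cintg g -> cintg (fun x => - g x).
Proof.
by move=> /(cintgZ (- 1)); congr cintg; apply/funext => x; rewrite mulN1r.
Qed.

Lemma cintgB g h : cintg g -> cintg h -> cintg (fun x => g x - h x).
Proof. by move=> ig ih; apply: cintgD ig _; exact: cintgN. Qed.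

Lemma cintD g h : cintg g -> cintg h ->
  cint (fun x => g x + h x) = cint g + cint h.
Proof.
move=> [g1 g2] [h1 h2]; apply: CC_ext; rewrite ?ReCD ?ImCD ?Re_cint ?Im_cint.
  by rewrite -rintD //; apply: eq_Rintegral => x _; rewrite ReCD.
by rewrite -rintD //; apply: eq_Rintegral => x _; rewrite ImCD.
Qed.

Lemma cintZ (z : CC R) g : cintg g -> cint (fun x => z * g x) = z * cint g.
Proof.
move=> [g1 g2]; apply: CC_ext; rewrite ?ReCM ?ImCM ?Re_cint ?Im_cint.
  rewrite -!rintZ // -rintB; [|exact: rintgZ|exact: rintgZ].
  by apply: eq_Rintegral => x _; rewrite ReCM.
rewrite -!rintZ // -rintD; [|exact: rintgZ|exact: rintgZ].
by apply: eq_Rintegral => x _; rewrite ImCM.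
Qed.

Lemma cintN g : cintg g -> cint (fun x => - g x) = - cint g.
Proof.
move=> ig; rewrite -mulN1r -cintZ //; congr cint.
by apply/funext => x; rewrite mulN1r.
Qed.

Lemma cintB g h : cintg g -> cintg h ->
  cint (fun x => g x - h x) = cint g - cint h.
Proof. by move=> ig ih; rewrite cintD ?cintN //; exact: cintgN. Qed.

Lemma cintg0 : cintg (fun=> 0).
Proof.
apply: (@cintg_dom _ (cst 0)); first exact: cmeas_cst.
  exact: integrable0.
by move=> x; rewrite cabs0.
Qed.

Lemma cint0 : cint (fun=> 0) = 0.
Proof.
rewrite -[RHS](mul0r (cint (fun=> 0))) -(cintZ 0 cintg0).
by congr cint; apply/funext => x; rewrite mul0r.
Qed.

Lemma cabs_cint g : cintg g -> cabs (cint g) <= \int[mu]_x cabs (g x).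
Proof.
move=> ig; have [->|I0] := eqVneq (cint g) 0.
  by rewrite cabs0; apply: rint_ge0 => x; exact: cabs_ge0.
set z := cint g in I0 *.
(* rotate the value of the integral onto the positive real axis *)
pose w : CC R := CofR (cabs z) / z.
have w1 : cabs w = 1.
  by rewrite cabsM cabsV cabs_ofR ger0_norm ?cabs_ge0 // divff // cabs_eq0.
have : ReC (cint (fun x => w * g x)) = cabs z.
  by rewrite cintZ // -/z /w divfK.
move=> <-; rewrite Re_cint; apply: rint_le.
- by have [] := cintgZ w ig.
- exact: cintg_cabs.
- move=> x; apply: le_trans (ler_norm _) _.
  by apply: le_trans (Re_le_cabs _) _; rewrite cabsM w1 mul1r.
Qed.

Lemma cabs_cint_le g (G : R -> R) : cmeas g -> rintg G ->
  (forall x, cabs (g x) <= G x) -> cabs (cint g) <= \int[mu]_x G x.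
Proof.
move=> mg iG gG; have ig := cintg_dom mg iG gG.
apply: le_trans (cabs_cint ig) _.
by apply: rint_le => //; exact: cintg_cabs.
Qed.

Lemma cfubini (g : R * R -> CC R) (A B : R -> R) :
  cmeas g -> rintg A -> rintg B ->
  (forall x y, cabs (g (x, y)) <= A x * B y) ->
  cintg (fun x => cint (fun y => g (x, y))) /\
  cint (fun x => cint (fun y => g (x, y))) =
  cint (fun y => cint (fun x => g (x, y))).
Proof.
move=> [m1 m2] iA iB gAB.
have [i1 e1] := rfubini m1 iA iB (fun x y => le_trans (Re_le_cabs _) (gAB x y)).
have [i2 e2] := rfubini m2 iA iB (fun x y => le_trans (Im_le_cabs _) (gAB x y)).
split; first exact: (conj i1 i2).
by apply: CC_ext; [exact: e1|exact: e2].
Qed.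

Lemma cintg_fubini2 (g : R * R -> CC R) (A B : R -> R) :
  cmeas g -> rintg A -> rintg B ->
  (forall x y, cabs (g (x, y)) <= A x * B y) ->
  cintg (fun y => cint (fun x => g (x, y))).
Proof.
move=> mg iA iB gAB.
have ms : measurable_fun setT (fun p : R * R => (p.2, p.1)) by exact: measurable_swap.
have gBA x y : cabs (g (y, x)) <= B x * A y by rewrite mulrC; exact: gAB.
by have [] := @cfubini (fun p => g (p.2, p.1)) B A (cmeas_comp ms mg) iB iA gBA.
Qed.

Lemma cint_ofR (f : R -> R) : cint (fun x => CofR (f x)) = CofR (\int[mu]_x f x).
Proof.
apply: CC_ext; rewrite ?Re_cint ?Im_cint //.
by under eq_Rintegral do rewrite ImC_ofR; rewrite /Rintegral integral0.
Qed.

Lemma cintg_ofR (f : R -> R) : rintg f -> cintg (fun x => CofR (f x)).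
Proof. by move=> fi; split => //; exact: integrable0. Qed.

(* The real modulus makes real squeezing and domination lemmas applicable. *)
Definition ccvg (u : nat -> CC R) (l : CC R) : Prop :=
  (fun n => cabs (u n - l)) @ \oo --> (0 : R).

Lemma ccvgP u l : ccvg u l <->
  ((fun n => ReC (u n)) @ \oo --> ReC l) /\ ((fun n => ImC (u n)) @ \oo --> ImC l).
Proof.
split => [ul|[ul1 ul2]].
  have ev (p : CC R -> R) : (forall z, `|p z| <= cabs z) ->
      (forall z w, p (z - w) = p z - p w) -> (fun n => p (u n)) @ \oo --> p l.
    move=> pc pB; apply/cvgrPdist_le => e e0.
    move/cvgrPdist_le : ul => /(_ e e0); apply: filterS => n.
    rewrite sub0r normrN ger0_norm ?cabs_ge0 // => le.
    by rewrite distrC -pB (le_trans (pc _)).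
  split; apply: ev.
  - exact: Re_le_cabs.
  - by move=> z w; rewrite ReCD ReCN.
  - exact: Im_le_cabs.
  - by move=> z w; rewrite ImCD ImCN.
apply: (@squeeze_cvgr _ _ _ _ (fun=> 0) (fun n => `|ReC (u n) - ReC l| + `|ImC (u n) - ImC l|)).
- apply: nearW => n; rewrite cabs_ge0 /=.
  by rewrite (le_trans (cabs_le_ReIm _)) // !CE.
- exact: cvg_cst.
- rewrite -[X in _ --> X]addr0; apply: cvgD.
  + have : (fun n => ReC (u n) - ReC l) @ \oo --> (0:R).
      by rewrite -(subrr (ReC l)); apply: cvgB => //; exact: cvg_cst.
    by move/cvg_norm; rewrite normr0.
  + have : (fun n => ImC (u n) - ImC l) @ \oo --> (0:R).
      by rewrite -(subrr (ImC l)); apply: cvgB => //; exact: cvg_cst.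
    by move/cvg_norm; rewrite normr0.
Qed.

Lemma ccvg_unique u l l' : ccvg u l -> ccvg u l' -> l = l'.
Proof.
move=> /ccvgP[r1 i1] /ccvgP[r2 i2]; apply: CC_ext.
  exact: cvg_unique r1 r2.
exact: cvg_unique i1 i2.
Qed.

Lemma ccvg_cst l : ccvg (fun=> l) l.
Proof. by apply/ccvgP; split; exact: cvg_cst. Qed.

Lemma ccvgD u v l m : ccvg u l -> ccvg v m -> ccvg (fun n => u n + v n) (l + m).
Proof.
move=> /ccvgP[r1 i1] /ccvgP[r2 i2]; apply/ccvgP; rewrite ReCD ImCD; split.
  by under eq_fun do rewrite ReCD; exact: cvgD.
by under eq_fun do rewrite ImCD; exact: cvgD.
Qed.

Lemma ccvgM u v l m : ccvg u l -> ccvg v m -> ccvg (fun n => u n * v n) (l * m).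
Proof.
move=> /ccvgP[r1 i1] /ccvgP[r2 i2]; apply/ccvgP; rewrite ReCM ImCM; split.
  by under eq_fun do rewrite ReCM; apply: cvgB; exact: cvgM.
by under eq_fun do rewrite ImCM; apply: cvgD; exact: cvgM.
Qed.

Lemma cdct (g_ : nat -> R -> CC R) (g : R -> CC R) (G : R -> R) :
  (forall n, cmeas (g_ n)) -> cmeas g -> rintg G ->
  {ae mu, forall x, ccvg (g_ ^~ x) (g x)} ->
  (forall n x, cabs (g_ n x) <= G x) ->
  cintg g /\ ccvg (fun n => cint (g_ n)) (cint g).
Proof.
move=> mg_ [m1 m2] iG gg gG.
have [|i1 c1] := @rdct R (fun n x => ReC (g_ n x)) _ _ (fun n => (mg_ n).1) m1 iG
   _ (fun n x => le_trans (Re_le_cabs _) (gG n x)).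
  by apply: (@filterS _ _ (ae_filter_ringOfSetsType mu)) gg => x /ccvgP[].
have [|i2 c2] := @rdct R (fun n x => ImC (g_ n x)) _ _ (fun n => (mg_ n).2) m2 iG
   _ (fun n x => le_trans (Im_le_cabs _) (gG n x)).
  by apply: (@filterS _ _ (ae_filter_ringOfSetsType mu)) gg => x /ccvgP[].
by split => //; apply/ccvgP.
Qed.

End complex_integral.

(** * Affine substitution and the fundamental theorem of calculus *)

Section affine.
Variable R : realType.
Local Notation mu := (@lebesgue_measure R).
Variables (c e : R).
Hypothesis c0 : c != 0.

Let phi (x : measurableTypeR R) : measurableTypeR R := c * x + e.

Let measurable_phi : measurable_fun setT phi.
Proof.
by apply: (@measurable_funD _ (measurableTypeR R) R) => //.
Qed.

Let cn : {nonneg R} := NngNum (normr_ge0 c).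

Let nu : {measure set (measurableTypeR R) -> \bar R}.
Proof. by refine (mscale cn (pushforward mu phi)); exact: measurable_phi. Defined.

(** [nu] is |c| times the image of Lebesgue measure under x -> c x + e. It gives half-open intervals
    their length, and this characterises Lebesgue measure. *)
Lemma lebesgue_measure_affine (A : set (measurableTypeR R)) : measurable A ->
  mu A = nu A.
Proof.
move=> mA.
apply: (lebesgue_measure_unique (mu := nu)) => //.
move=> _ [[x y] _ <-] /=; rewrite /nu /mscale /= /pushforward.
(* For c < 0 the preimage is closed on the left and open on the right, whence the case distinction
   on the shape of the interval. *)
have [x1 [y1 [-> e1 e2]]] : exists x1 y1, [/\ phi @^-1` `]x, y]%classic =
    [set` (if 0 < c then `]x1, y1] else `[x1, y1[)],
    (x1 < y1) = (x < y) & `|c| * (y1 - x1) = y - x].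
  case: ltP => c1.
    exists ((x - e) / c), ((y - e) / c); split.
    - apply/seteqP; split => t /=; rewrite !in_itv /= /phi;
        by rewrite ltr_pdivrMr // ler_pdivlMr // ltrBlDr lerBrDr mulrC.
    - by rewrite ltr_pM2r ?invr_gt0 // ltrD2r.
    - by rewrite gtr0_norm //; field.
  have {}c1 : c < 0 by rewrite lt_neqAle c0.
  exists ((y - e) / c), ((x - e) / c); split.
  - apply/seteqP; split => t /=; rewrite !in_itv /= /phi;
      by rewrite ler_ndivrMr // ltr_ndivlMr // ltrBlDr lerBrDr mulrC andbC.
  - by rewrite ltr_nM2r ?invr_lt0 // ltrD2r.
  - by rewrite ltr0_norm //; field.
have -> : (mu [set` (if (0 < c)%R then `]x1, y1] else `[x1, y1[)] =
    if (x1 < y1)%R then (y1 - x1)%:E else 0)%E.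
  by case: ifP => _; rewrite lebesgue_measure_itv /= lte_fin; case: ifP.
rewrite lebesgue_measure_itv /= lte_fin e1.
case: ifP => xy; last by rewrite mule0.
by rewrite -!EFinD -EFinM e2.
Qed.

Lemma ge0_integral_affine (f : R -> R) : measurable_fun setT f ->
  (forall x, 0 <= f x) ->
  (\int[mu]_x (f x)%:E)%E = (`|c|%:E * \int[mu]_x (f (c * x + e))%:E)%E.
Proof.
move=> mf f0.
rewrite (eq_measure_integral nu); last first.
  by move=> A mA _; exact: lebesgue_measure_affine.
rewrite ge0_integral_mscale //; last 2 first.
- exact/measurable_EFinP.
- by move=> x _; rewrite lee_fin.
rewrite ge0_integral_pushforward //; first exact/measurable_EFinP.
by move=> x _; rewrite lee_fin.
Qed.

Lemma measurable_affine (f : R -> R) : measurable_fun setT f ->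
  measurable_fun setT (fun x => f (c * x + e)).
Proof. by move=> mf; apply: measurableT_comp mf measurable_phi. Qed.

Let pos (f : R -> R) : rintg f -> (forall x, 0 <= f x) ->
  rintg (fun x => f (c * x + e)) /\
  \int[mu]_x f x = `|c| * \int[mu]_x f (c * x + e).
Proof.
move=> fi f0; have mf := rintg_meas fi.
have E := ge0_integral_affine mf f0.
have i2 : rintg (fun x => f (c * x + e)).
  apply/integrableP; split; first by apply/measurable_EFinP; exact: measurable_affine.
  under eq_integral do rewrite /= ger0_norm //.
  move: E; rewrite rintgE //.
  have I0 : (0 <= \int[mu]_x (f (c * x + e))%:E)%E.
    by apply: integral_ge0 => x _; rewrite lee_fin.
  case: (\int[mu]_x (f (c * x + e))%:E)%E I0 => [r||] //= _.
    by rewrite ltry.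
  by rewrite gt0_muley ?lte_fin ?normr_gt0.
split => //; move: E; rewrite !rintgE //.
by rewrite -EFinM => -[].
Qed.

Lemma rintg_affine (f : R -> R) : rintg f -> rintg (fun x => f (c * x + e)).
Proof.
move=> fi.
have [i1 _] := pos (rintg_norm fi) (fun x => normr_ge0 _).
by apply: rintg_dom i1 _ => //; exact: measurable_affine (rintg_meas fi).
Qed.

(** The nonnegative case applies to |f| and to |f| + f; the signed case is their difference. *)
Lemma rint_affine (f : R -> R) : rintg f ->
  \int[mu]_x f x = `|c| * \int[mu]_x f (c * x + e).
Proof.
move=> fi; have fn := rintg_norm fi.
have [_ e1] := pos fn (fun x => normr_ge0 _).
have ip : rintg (fun x => `|f x| + f x) by exact: rintgD.
have [_ e2] := pos ip (fun x => ltac:(by rewrite -lerBlDr sub0r -normrN ler_norm)).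
move: e2; rewrite !rintD //; last 2 first.
- exact: rintg_affine fn.
- exact: rintg_affine fi.
by rewrite mulrDr e1 => /addrI.
Qed.

Lemma cintg_affine (g : R -> CC R) : cintg g -> cintg (fun x => g (c * x + e)).
Proof.
move=> [g1 g2]; apply/cintgE; split; first exact: rintg_affine g1.
exact: rintg_affine g2.
Qed.

Lemma cint_affine (g : R -> CC R) : cintg g ->
  cint g = CofR `|c| * cint (fun x => g (c * x + e)).
Proof.
move=> [g1 g2]; apply: CC_ext.
  by rewrite ReCM ReC_ofR ImC_ofR mul0r subr0 !Re_cint; exact: rint_affine g1.
by rewrite ImCM ReC_ofR ImC_ofR mul0r addr0 !Im_cint; exact: rint_affine g2.
Qed.

End affine.

Section complex_ftc.
Variable R : realType.
Local Notation mu := (@lebesgue_measure R).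

(** Componentwise, because source and target are normed spaces over different fields; the real mean
    value theorem, the fundamental theorem of calculus and differentiation under the integral then
    apply to each component. *)
Definition cder (F : R -> CC R) (x : R) (D : CC R) : Prop :=
  is_derive x 1 (fun t => ReC (F t)) (ReC D) /\
  is_derive x 1 (fun t => ImC (F t)) (ImC D).

Definition ccont (F : R -> CC R) (x : R) : Prop :=
  ((fun t => ReC (F t)) @ x --> ReC (F x)) /\
  ((fun t => ImC (F t)) @ x --> ImC (F x)).

Lemma cder_ccont F x D : cder F x D -> ccont F x.
Proof.
move=> [[d1 _] [d2 _]]; split.
  exact: (differentiable_continuous (proj1 (derivable1_diffP _ _) d1)).
exact: (differentiable_continuous (proj1 (derivable1_diffP _ _) d2)).
Qed.

Lemma ccont_meas F : (forall x, ccont F x) -> cmeas F.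
Proof.
move=> cF; split; apply: continuous_measurable_fun => x; first exact: (cF x).1.
exact: (cF x).2.
Qed.

Definition cind (A : set R) (g : R -> CC R) (x : R) : CC R :=
  CofR (\1_A x) * g x.

Lemma cindT (A : set R) g x : A x -> cind A g x = g x.
Proof. by move=> Ax; rewrite /cind indicE mem_set // mul1r. Qed.

Lemma cindF (A : set R) g x : ~ A x -> cind A g x = 0.
Proof. by move=> Ax; rewrite /cind indicE memNset // mul0r. Qed.

Lemma cabs_cind_le (A : set R) g x : cabs (cind A g x) <= cabs (g x).
Proof.
have [Ax|Ax] := pselect (A x); first by rewrite cindT.
by rewrite cindF // cabs0 cabs_ge0.
Qed.

Lemma cmeas_cind (A : set R) g : measurable A -> cmeas g -> cmeas (cind A g).
Proof. by move=> mA mg; apply: cmeasM mg; apply: cmeas_ofR; exact: measurable_indic. Qed.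

Lemma Re_cind A g x : ReC (cind A g x) = \1_A x * ReC (g x).
Proof. by rewrite /cind !CE mul0r subr0. Qed.
Lemma Im_cind A g x : ImC (cind A g x) = \1_A x * ImC (g x).
Proof. by rewrite /cind !CE mul0r addr0. Qed.

Lemma rint_indic (A : set R) (f : R -> R) : measurable A ->
  \int[mu]_x (\1_A x * f x) = \int[mu]_(x in A) f x.
Proof.
move=> mA; rewrite [RHS]Rintegral_mkcond; apply: eq_Rintegral => x _.
rewrite /patch indicE; case: ifPn => xA; first by rewrite mul1r.
by rewrite mul0r.
Qed.

Lemma cint_cind (A : set R) g : measurable A -> cint (cind A g) = Cint A g.
Proof.
move=> mA; apply: CC_ext; rewrite ?Re_cint ?Im_cint /=.
  by under eq_Rintegral do rewrite Re_cind; rewrite rint_indic.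
by under eq_Rintegral do rewrite Im_cind; rewrite rint_indic.
Qed.

Lemma rint_cst_itv (a b M : R) : a <= b ->
  rintg (fun x => M * \1_`[a, b]%classic x) /\
  \int[mu]_x (M * \1_`[a, b]%classic x) = M * (b - a).
Proof.
move=> ab.
have i : rintg (\1_`[a, b]%classic : R -> R) by exact: integrable_indic_itv.
split; first exact: rintgZ.
rewrite rintZ //; congr (_ * _).
rewrite /Rintegral integral_indic // setIT.
transitivity (fine (if (a%:E < b%:E)%E then (b%:E - a%:E)%E else 0%E)).
  by congr fine; exact: (lebesgue_measure_itv `[a, b]).
by rewrite /= lte_fin; case: ltgtP ab => //= [->] _; rewrite ?subrr.
Qed.

Lemma cintg_bounded_itv (a b M : R) g : a <= b -> cmeas g ->
  (forall x, x \in `[a, b] -> cabs (g x) <= M) ->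
  (forall x, x \notin `[a, b] -> g x = 0) ->
  cintg g /\ cabs (cint g) <= M * (b - a).
Proof.
move=> ab mg gM g0; have [i1 i2] := rint_cst_itv M ab.
have le x : cabs (g x) <= M * \1_`[a, b]%classic x.
  rewrite indicE; case: (boolP (x \in `[a, b])) => xab.
    by rewrite mem_set // mulr1 gM.
  by rewrite g0 // cabs0 memNset ?mulr0 //; apply/negP.
split; first exact: cintg_dom mg i1 le.
by rewrite -i2; exact: cabs_cint_le.
Qed.

Lemma ftc_closed (f F : R -> R) (a b : R) : a < b ->
  (forall x, x \in `[a, b] -> is_derive x 1 F (f x)) ->
  (forall x, x \in `[a, b] -> {for x, continuous f}) ->
  \int[mu]_(x in `[a, b]) f x = F b - F a.
Proof.
move=> ab dF cf.
have cF x : x \in `[a, b] -> {for x, continuous F}.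
  move=> xab; have [d _] := dF x xab.
  exact/differentiable_continuous/derivable1_diffP.
rewrite /Rintegral (@continuous_FTC2 _ f F a b ab) //.
- apply: continuous_in_subspaceT => x /set_mem; exact: cf.
- split.
  + by move=> x xab; have [] := dF x (subset_itv_oo_cc xab).
  + by apply: cvg_at_right_filter; apply: cF; rewrite in_itv /= lexx ltW.
  + by apply: cvg_at_left_filter; apply: cF; rewrite in_itv /= lexx ltW.
- move=> x xab; rewrite derive1E; have [_ ->] := dF x (subset_itv_oo_cc xab).
  by [].
Qed.

Lemma cftc (g F : R -> CC R) (a b : R) : a <= b ->
  (forall x, x \in `[a, b] -> cder F x (g x)) ->
  (forall x, x \in `[a, b] -> ccont g x) ->
  cint (cind `[a, b]%classic g) = F b - F a.
Proof.
move=> ab dF cg; rewrite cint_cind //.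
move: ab; rewrite le_eqVlt => /orP[/eqP <-|ab].
  by rewrite subrr; apply: CC_ext; rewrite /= set_itv1 Rintegral_set1.
apply: CC_ext; rewrite ?(ReCD, ReCN, ImCD, ImCN).
  apply: (@ftc_closed (fun x => ReC (g x)) (fun x => ReC (F x))) => // x xab.
    by have [] := dF x xab.
  by have [] := cg x xab.
apply: (@ftc_closed (fun x => ImC (g x)) (fun x => ImC (F x))) => // x xab.
  by have [] := dF x xab.
by have [] := cg x xab.
Qed.

Lemma cder_cexp (k : CC R) (x : R) : cder (fun t => cexp (k * CofR t)) x (k * cexp (k * CofR x)).
Proof.
case: k => p q; split.
  have -> : (fun t : R => ReC (cexp ((p +i* q : CC R) * CofR t))) =
      (fun t => expR (p * t) * cos (q * t)).
    by apply/funext => t; rewrite Re_cexp !CE /= !mulr0 subr0 add0r.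
  apply: is_derive_eq.
  rewrite !(CE, Re_cexp, Im_cexp) /= !scaler1 /GRing.scale /=.
  by rewrite !mulr0 !subr0 !add0r; ring.
have -> : (fun t : R => ImC (cexp ((p +i* q : CC R) * CofR t))) =
    (fun t => expR (p * t) * sin (q * t)).
  by apply/funext => t; rewrite Im_cexp !CE /= !mulr0 subr0 add0r.
apply: is_derive_eq.
rewrite !(CE, Re_cexp, Im_cexp) /= !scaler1 /GRing.scale /=.
by rewrite !mulr0 !subr0 !add0r; ring.
Qed.

Lemma ccont_cexp (k : CC R) (x : R) : ccont (fun t => cexp (k * CofR t)) x.
Proof. exact: cder_ccont (cder_cexp k x). Qed.

Lemma cmeas_cexpZ (k : CC R) : cmeas (fun t : R => cexp (k * CofR t)).
Proof. by apply: ccont_meas => x; exact: ccont_cexp. Qed.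

Lemma ccontM F G x : ccont F x -> ccont G x -> ccont (fun t => F t * G t) x.
Proof.
move=> [f1 f2] [g1 g2]; split.
  by rewrite ReCM; under eq_fun do rewrite ReCM; apply: cvgB; exact: cvgM.
by rewrite ImCM; under eq_fun do rewrite ImCM; apply: cvgD; exact: cvgM.
Qed.

Lemma ccont_cst (z : CC R) (x : R) : ccont (fun=> z) x.
Proof. by split; exact: cvg_cst. Qed.

(** Stated without division by k so that k = 0 is covered; [ft_qdiv] needs this when the two
    arguments coincide. *)
Lemma cint_cexp_itv (k : CC R) (a b : R) : a <= b ->
  k * cint (cind `[a, b]%classic (fun t => cexp (k * CofR t))) =
  cexp (k * CofR b) - cexp (k * CofR a).
Proof.
move=> ab.
rewrite -(cftc (g := fun t => k * cexp (k * CofR t)) (F := fun t => cexp (k * CofR t)) ab);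
  last 2 first.
- by move=> x _; exact: cder_cexp.
- by move=> x _; apply: ccontM; [exact: ccont_cst|exact: ccont_cexp].
rewrite -cintZ; first by congr cint; apply/funext => x; rewrite /cind mulrCA.
have [] // := @cintg_bounded_itv a b (expR (`|ReC k| * (`|a| + `|b|))) (cind `[a, b]%classic (fun t => cexp (k * CofR t))) ab.
- by apply: cmeas_cind => //; exact: cmeas_cexpZ.
- move=> x xab; apply: le_trans (cabs_cind_le _ _ _) _.
  rewrite cabs_cexp !CE mulr0 subr0 ler_expR.
  rewrite (le_trans (ler_norm _)) // normrM ler_wpM2l //.
  move: xab; rewrite in_itv /= => /andP[ax xb].
  rewrite ler_norml; apply/andP; split.
    by have := ler_norm (- a); have := normr_ge0 b; rewrite normrN; lra.
  by have := ler_norm b; have := normr_ge0 a; lra.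
- by move=> x xab; rewrite cindF //; apply/negP.
Qed.

End complex_ftc.

(** * Fourier transform and inversion *)

Section one_sided.
Variable R : realType.
Local Notation mu := (@lebesgue_measure R).

(** Dominated convergence for the constant sequence g, which tends to h almost everywhere. *)
Lemma cint_ae (g h : R -> CC R) : cintg g -> cmeas h ->
  {ae mu, forall x, g x = h x} -> cintg h /\ cint g = cint h.
Proof.
move=> ig mh gh.
have [ih cv] := @cdct R (fun=> g) h (fun x => cabs (g x))
  (fun=> cintg_meas ig) mh (cintg_cabs ig)
  ltac:(by apply: (@filterS _ _ (ae_filter_ringOfSetsType mu)) gh => x ->;
           exact: ccvg_cst) (fun _ _ => lexx _).
split => //; exact: ccvg_unique (ccvg_cst _) cv.
Qed.

Lemma ae_neq (s : seq R) : {ae mu, forall x, x \notin s}.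
Proof.
exists [set` s]; split.
- by apply: countable_measurable => //; exact: (finite_set_countable (finite_seq s)).
- by apply: countable_lebesgue_measure0; exact: (finite_set_countable (finite_seq s)).
- by move=> x /= /negP; rewrite negbK.
Qed.

Lemma ge0_even_rintg (f : R -> R) (l : R) : (forall x, 0 <= f x) ->
  continuous f -> (forall x, f (- x) = f x) ->
  (\int[mu]_(x in `[0%R, +oo[) (f x)%:E)%E = l%:E ->
  rintg f /\ \int[mu]_x f x = 2 * l.
Proof.
move=> f0 cf ef fl.
have := @ge0_symfun_integralT R f f0 cf (fun x => esym (ef x)).
rewrite -set_itvcy fl -EFinM => fT.
split; last by rewrite /Rintegral fT.
apply/integrableP; split.
  by apply/measurable_EFinP; exact: continuous_measurable_fun.
by under eq_integral do rewrite /= ger0_norm //; rewrite fT ltry.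
Qed.

Lemma rint_exp_norm (l : R) : 0 < l -> rintg (fun x => expR (- (l * `|x|))) /\
  \int[mu]_x expR (- (l * `|x|)) = 2 * l^-1.
Proof.
move=> l0.
have cf : continuous (fun x : R => expR (- (l * `|x|))).
  move=> x; apply: continuous_comp; last exact: continuous_expR.
  by apply: cvgN; apply: cvgM; [exact: cvg_cst|exact: norm_continuous].
apply: ge0_even_rintg => //.
- by move=> x; rewrite normrN.
transitivity (\int[mu]_(x in `[0%R, +oo[) (expR (- (l * x)))%:E)%E.
  by apply: eq_integral => x; rewrite inE /= in_itv /= andbT => x0; rewrite ger0_norm.
pose F x := - (l^-1 * expR (- (l * x))).
have dF x : is_derive x (1 : R) F (expR (- (l * x))).
  apply: is_derive_eq; rewrite /GRing.scale /=.
  by field; rewrite gt_eqF.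
have cF : continuous F.
  move=> x; have [d _] := dF x.
  exact: (differentiable_continuous (proj1 (derivable1_diffP _ _) d)).
rewrite (@ge0_continuous_FTC2y _ _ F 0 0).
- by rewrite sub0e /F mulr0 oppr0 expR0 mulr1 EFinN oppeK.
- by move=> x _; exact: expR_ge0.
- apply: continuous_subspaceT => x; apply: continuous_comp; last exact: continuous_expR.
  by apply: cvgN; apply: cvgM; [exact: cvg_cst|exact: cvg_id].
- rewrite -oppr0 -(mulr0 l^-1); apply: cvgN; apply: cvgM; first exact: cvg_cst.
  apply: (@cvg_comp _ _ _ (fun x : R => l * x) (fun y => expR (- y)) _ +oo%R); last exact: cvgr_expR.
  exact: gt0_cvgMry.
- by move=> x _; have [] := dF x.
- exact/cvg_at_right_filter/cF.
- by move=> x _; rewrite derive1E; have [_ ->] := dF x.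
Qed.

Lemma rintg_exp_norm (l : R) : 0 < l -> rintg (fun x => expR (- (l * `|x|))).
Proof. by move=> /rint_exp_norm[]. Qed.

(** The mass 2 pi of this kernel is the origin of the factor 2 pi in Fourier inversion. *)
Lemma rintg_cauchy : rintg (fun x : R => 2 / (1 + x ^+ 2)) /\
  \int[mu]_x (2 / (1 + x ^+ 2)) = 2 * pi :> R.
Proof.
have [] := @ge0_even_rintg (fun x => (oneDsqr x)^-1) (pi / 2).
- by move=> x; rewrite invr_ge0.
- exact: continuous_oneDsqrV.
- by move=> x; rewrite /oneDsqr sqrrN.
- exact: integral0y_oneDsqr.
move=> i1 e1; split; first exact: rintgZ.
by rewrite rintZ // e1; field.
Qed.

Lemma rintg_poisson (d x : R) : 0 < d ->
  rintg (fun s : R => 2 * d / (d ^+ 2 + (s - x) ^+ 2)).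
Proof.
move=> d0; have d1 : d^-1 != 0 by rewrite invr_eq0 gt_eqF.
have := rintgZ d^-1 (rintg_affine (- x / d) d1 rintg_cauchy.1).
congr rintg; apply/funext => s.
have h1 : 0 < d ^+ 2 + (s - x) ^+ 2 by rewrite ltr_pwDl ?exprn_gt0 // sqr_ge0.
have h2 : 1 + (d^-1 * s + - x / d) ^+ 2 = (d ^+ 2 + (s - x) ^+ 2) / d ^+ 2.
  by field; rewrite gt_eqF.
by rewrite h2; field; rewrite !gt_eqF.
Qed.

Lemma poisson_le (d s : R) : 0 < d -> `|2 * d / (d ^+ 2 + s ^+ 2)| <= 2 / d.
Proof.
move=> d0.
have ds : 0 < d ^+ 2 + s ^+ 2 by rewrite ltr_pwDl ?exprn_gt0 // sqr_ge0.
rewrite ger0_norm; last by rewrite divr_ge0 ?mulr_ge0 ?(ltW d0) ?(ltW ds).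
rewrite ler_pdivrMr // mulrDr (_ : 2 / d * d ^+ 2 = 2 * d); last by field; rewrite gt_eqF.
by rewrite lerDl mulr_ge0 ?sqr_ge0 // divr_ge0 // ltW.
Qed.

Lemma poisson_scale (d t : R) : 0 < d ->
  d * (2 * d / (d ^+ 2 + (d * t) ^+ 2)) = 2 / (1 + t ^+ 2).
Proof.
move=> d0; have t1 : 1 + t ^+ 2 != 0 by rewrite gt_eqF // ltr_pwDl // sqr_ge0.
rewrite (_ : d ^+ 2 + (d * t) ^+ 2 = d ^+ 2 * (1 + t ^+ 2)); last by ring.
by field; rewrite t1 gt_eqF.
Qed.

Lemma cexp_ray_dom (A : set R) (k : CC R) (x : R) : (forall y, A y -> 0 <= y) ->
  cabs (cind A (fun s => cexp (k * CofR s)) x) <= expR (- (- ReC k * `|x|)).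
Proof.
move=> A0; have [Ax|Ax] := pselect (A x); last by rewrite cindF ?cabs0 ?expR_ge0.
by rewrite cindT // cabs_cexp !CE mulr0 subr0 ger0_norm ?A0 // mulNr opprK.
Qed.

Lemma ccvg_near (u : nat -> CC R) (l : CC R) :
  (\forall n \near \oo, u n = l) -> ccvg u l.
Proof.
move=> ul; apply/(cvgrPdist_le (F := \oo)) => e e0.
apply: filterS ul => n ->.
by rewrite subrr cabs0 subrr normr0 ltW.
Qed.

(** The approximating intervals are closed, as [cint_cexp_itv] wants them, and the limiting ray is
    open; they disagree only at 0, a null set. *)
Lemma ccvg_cind_itv (g : R -> CC R) (x : R) : x != 0 ->
  ccvg (fun n => cind `[0, (n%:R : R)]%classic g x) (cind `]0, +oo[%classic g x).
Proof.
move=> x0; have [xn|xp] := ltP x 0.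
  rewrite cindF; last by rewrite /= in_itv /= andbT; apply/negP; rewrite -leNgt ltW.
  by apply: ccvg_near; apply: nearW => n; rewrite cindF //= in_itv /= leNgt xn.
rewrite cindT; last by rewrite /= in_itv /= andbT lt_neqAle eq_sym x0.
apply: ccvg_near; near=> n; rewrite cindT //= in_itv /= xp /=.
by near: n; exact: nbhs_infty_ger.
Unshelve. all: by end_near. Qed.

Lemma ccvg_expR (k : CC R) : ReC k < 0 -> ccvg (fun n => cexp (k * CofR n%:R)) 0.
Proof.
move=> k0; rewrite /ccvg; under eq_fun do rewrite subr0 cabs_cexp !CE mulr0 subr0.
have -> : (fun n : nat => expR (ReC k * n%:R)) = (fun n => expR (ReC k) ^+ n).
  by apply/funext => n; rewrite mulrC expRM_natl.
by apply: cvg_expr; rewrite ger0_norm ?expR_ge0 // expR_lt1.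
Qed.

Lemma cint_cexp_pos (k : CC R) : ReC k < 0 ->
  cintg (cind `]0, +oo[%classic (fun s => cexp (k * CofR s))) /\
  cint (cind `]0, +oo[%classic (fun s => cexp (k * CofR s))) = - k^-1.
Proof.
move=> k0; have kn0 : k != 0.
  by apply/eqP => k_; move: k0; rewrite k_ ReC0 ltxx.
have mE : cmeas (fun s : R => cexp (k * CofR s)) by exact: cmeas_cexpZ.
pose g_ n := cind `[0, (n%:R : R)]%classic (fun s => cexp (k * CofR s)).
have nk0 : 0 < - ReC k by rewrite oppr_gt0.
have [||||ig cv] := @cdct R (fun n => g_ n) (cind `]0, +oo[%classic (fun s => cexp (k * CofR s)))
  _ _ _ (rintg_exp_norm nk0).
- by move=> n; apply: cmeas_cind.
- by apply: cmeas_cind.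
- apply: (@filterS _ _ (ae_filter_ringOfSetsType mu)) (ae_neq [:: 0]) => x.
  by rewrite inE => x0; exact: ccvg_cind_itv.
- by move=> n x; apply: cexp_ray_dom => y /=; rewrite in_itv /= => /andP[].
split => //.
have E n : cint (g_ n) = k^-1 * (cexp (k * CofR n%:R) - 1).
  apply: (mulfI kn0); rewrite mulVKf //.
  by rewrite /g_ cint_cexp_itv ?ler0n // CofR0 mulr0 cexp0.
apply: ccvg_unique cv _.
have -> : (fun n => cint (g_ n)) = (fun n => k^-1 * (cexp (k * CofR n%:R) - 1)).
  by apply/funext.
have -> : - k^-1 = k^-1 * (0 - 1) by rewrite sub0r mulrN1.
apply: (@ccvgM _ (fun=> k^-1)); first exact: ccvg_cst.
by apply: ccvgD; [exact: ccvg_expR|exact: ccvg_cst].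
Qed.

Lemma cint_cexp_neg (k : CC R) : 0 < ReC k ->
  cintg (cind `]-oo, 0[%classic (fun s => cexp (k * CofR s))) /\
  cint (cind `]-oo, 0[%classic (fun s => cexp (k * CofR s))) = k^-1.
Proof.
move=> k0; have k1 : ReC (- k) < 0 by rewrite ReCN oppr_lt0.
have [ig e] := cint_cexp_pos k1.
have N1 : -1 != 0 :> R by rewrite oppr_eq0 oner_eq0.
have E : (fun s => cind `]0, +oo[%classic (fun s => cexp (- k * CofR s)) (-1 * s + 0)) =
    cind `]-oo, 0[%classic (fun s => cexp (k * CofR s)).
  apply/funext => s; rewrite /cind addr0 mulN1r CofRN mulrNN !indicE.
  have -> : (- s \in `]0, +oo[%classic) = (s \in `]-oo, 0[%classic).
    by apply/idP/idP; rewrite !inE /= !in_itv /= andbT oppr_gt0.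
  by [].
split; first by rewrite -E; exact: cintg_affine.
have := cint_affine 0 N1 ig; rewrite E e normrN1 mul1r => <-.
by rewrite invrN opprK.
Qed.

(** Split at 0 into one-sided exponentials of rates [k1] = i t - d and [k2] = i t + d; the value is
    - 1 / [k1] + 1 / [k2] = ([k1] - [k2]) / ([k1] [k2]), with numerator - 2 d and denominator - (d^2
    + t^2). *)
Lemma cint_exp_norm (d t : R) : 0 < d ->
  cintg (fun u => CofR (expR (- (d * `|u|))) * cexp (CI * CofR t * CofR u)) /\
  cint (fun u => CofR (expR (- (d * `|u|))) * cexp (CI * CofR t * CofR u)) =
  CofR (2 * d / (d ^+ 2 + t ^+ 2)).
Proof.
move=> d0.
pose k1 : CC R := CI * CofR t - CofR d; pose k2 : CC R := CI * CofR t + CofR d.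
have r1 : ReC k1 < 0 by rewrite /k1 !CE; lra.
have r2 : 0 < ReC k2 by rewrite /k2 !CE; lra.
have [i1 e1] := cint_cexp_pos r1; have [i2 e2] := cint_cexp_neg r2.
have k10 : k1 != 0 by apply/eqP => k_; move: r1; rewrite k_ ReC0 ltxx.
have k20 : k2 != 0 by apply/eqP => k_; move: r2; rewrite k_ ReC0 ltxx.
have [] // := @cint_ae _ (fun u => CofR (expR (- (d * `|u|))) * cexp (CI * CofR t * CofR u)) (cintgD i1 i2).
- apply: cmeasM; last exact: cmeas_cexpZ.
  by apply: cmeas_ofR; apply: rintg_meas; exact: rintg_exp_norm.
- apply: (@filterS _ _ (ae_filter_ringOfSetsType mu)) (ae_neq [:: 0]) => x.
  rewrite inE neq_lt => /orP[x0|x0].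
    rewrite cindF ?add0r /=; last by rewrite in_itv /= andbT; apply/negP; rewrite -leNgt ltW.
    rewrite cindT /= ?in_itv //= -cexp_ofR -cexpD; congr cexp.
    by rewrite /k2 ltr0_norm // mulrN opprK CofRM; ring.
  rewrite [X in _ + X]cindF ?addr0 /=; last by rewrite in_itv /=; apply/negP; rewrite -leNgt ltW.
  rewrite cindT /= ?in_itv //= ?andbT // -cexp_ofR -cexpD; congr cexp.
  by rewrite /k1 gtr0_norm // CofRN CofRM; ring.
move=> ii <-; split => //; rewrite cintD // e1 e2.
have dt : d ^+ 2 + t ^+ 2 != 0 by rewrite gt_eqF // ltr_pwDl ?exprn_gt0 // sqr_ge0.
have k12 : k1 * k2 = - CofR (d ^+ 2 + t ^+ 2).
  rewrite /k1 /k2 CofRD !expr2 !CofRM.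
  transitivity (CI * CI * (CofR t * CofR t) - CofR d * CofR d); first by ring.
  by rewrite CI2; ring.
have -> : - k1^-1 + k2^-1 = (k1 - k2) / (k1 * k2) by field; rewrite k10 k20.
rewrite k12 [in LHS]/k1 /k2 CofRM CofRV CofRM CofR_nat.
by rewrite invrN mulrN; ring.
Qed.

End one_sided.

(** * The Fourier transform on the real line and its Poisson regularisation *)

Section fourier_transform.
Variable R : realType.
Local Notation mu := (@lebesgue_measure R).
Implicit Types (q : R -> CC R) (k : CC R).

Definition ft q k : CC R := cint (fun s => q s * cexp (CI * k * CofR s)).

Lemma cabs_cexp_real (t s : R) : cabs (cexp (CI * CofR t * CofR s)) = 1.
Proof. by rewrite cabs_cexp !CE !(mul0r, mulr0, subr0, addr0) expR0. Qed.

Lemma cabs_cexp_imag (t s : R) : cabs (cexp (- (CI * CofR t * CofR s))) = 1.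
Proof. by rewrite cabs_cexp !CE !(mul0r, mulr0, subr0, addr0, oppr0) expR0. Qed.

Lemma cintg_mul_unit q (e : R -> CC R) : cintg q -> cmeas e ->
  (forall x, cabs (e x) <= 1) -> cintg (fun x => q x * e x).
Proof.
move=> iq me e1; apply: cintg_dom (cintg_cabs iq) _.
  exact: cmeasM (cintg_meas iq) me.
by move=> x; rewrite cabsM ler_piMr ?cabs_ge0.
Qed.

Lemma cabs_ft_real q (u : R) : cintg q ->
  cabs (ft q (CofR u)) <= \int[mu]_x cabs (q x).
Proof.
move=> iq; apply: cabs_cint_le.
- by apply: cmeasM (cintg_meas iq) _; exact: cmeas_cexpZ.
- exact: cintg_cabs.
- by move=> x; rewrite cabsM cabs_cexp_real mulr1.
Qed.

Let mfst : measurable_fun setT (fst : R * R -> R). Proof. exact: measurable_fst. Qed.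
Let msnd : measurable_fun setT (snd : R * R -> R). Proof. exact: measurable_snd. Qed.

Lemma cmeas_fst (g : R -> CC R) : cmeas g -> cmeas (fun p : R * R => g p.1).
Proof. exact: cmeas_comp. Qed.
Lemma cmeas_snd (g : R -> CC R) : cmeas g -> cmeas (fun p : R * R => g p.2).
Proof. exact: cmeas_comp. Qed.

(** Measurability in the parameter comes from Fubini, which needs integrability in u as well: the
    integrand is damped by exp (- |u|), and the damping is undone afterwards. *)
Lemma cmeas_ft_real q : cintg q -> cmeas (fun u => ft q (CofR u)).
Proof.
move=> iq.
have [] := @cfubini R (fun p => CofR (expR (- (1 * `|p.1|))) * (q p.2 * cexp (CI * CofR p.1 * CofR p.2)))
  (fun x => expR (- (1 * `|x|))) (fun x => cabs (q x)).
- apply: cmeasM.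
    exact: (cmeas_fst (cmeas_ofR (rintg_meas (rintg_exp_norm _)))).
  apply: cmeasM; first exact: (cmeas_snd (cintg_meas iq)).
  apply: cmeas_cexp; apply: cmeasM; last exact: (cmeas_ofR msnd).
  by apply: cmeasM; [exact: cmeas_cst|exact: (cmeas_ofR mfst)].
- exact: rintg_exp_norm.
- exact: cintg_cabs.
- move=> x y /=; rewrite cabsM cabsM cabs_cexp_real mulr1 cabs_ofR ger0_norm ?expR_ge0 //.
move=> ii _.
have -> : (fun u => ft q (CofR u)) = fun u => CofR (expR (1 * `|u|)) *
   cint (fun y => CofR (expR (- (1 * `|u|))) * (q y * cexp (CI * CofR u * CofR y))).
  apply/funext => u; rewrite cintZ; last first.
    apply: cintg_mul_unit => //; first exact: cmeas_cexpZ.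
    by move=> x; rewrite cabs_cexp_real.
  by rewrite mulrA -CofRM -expRD subrr expR0 mul1r.
apply: cmeasM; last exact: cintg_meas ii.
apply: cmeas_ofR; apply: continuous_measurable_fun => x.
apply: continuous_comp; last exact: continuous_expR.
by apply: cvgM; [exact: cvg_cst|exact: norm_continuous].
Qed.

Lemma ft_damp_fubini q (d x : R) : 0 < d -> cintg q ->
  cint (fun u => cint (fun s => CofR (expR (- (d * `|u|))) *
     (q s * cexp (CI * CofR u * CofR (s - x))))) =
  cint (fun s => cint (fun u => CofR (expR (- (d * `|u|))) *
     (q s * cexp (CI * CofR u * CofR (s - x))))).
Proof.
move=> d0 iq.
have [] := @cfubini R (fun p => CofR (expR (- (d * `|p.1|))) * (q p.2 * cexp (CI * CofR p.1 * CofR (p.2 - x))))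
  (fun x => expR (- (d * `|x|))) (fun x => cabs (q x)).
- apply: cmeasM.
    exact: (cmeas_fst (cmeas_ofR (rintg_meas (rintg_exp_norm _)))).
  apply: cmeasM; first exact: (cmeas_snd (cintg_meas iq)).
  apply: cmeas_cexp; apply: cmeasM; last by apply: cmeas_ofR; apply: measurable_funB.
  by apply: cmeasM; [exact: cmeas_cst|exact: (cmeas_ofR mfst)].
- exact: rintg_exp_norm.
- exact: cintg_cabs.
- move=> y z /=; rewrite cabsM cabsM cabs_cexp_real mulr1 cabs_ofR ger0_norm ?expR_ge0 //.
by [].
Qed.

(* The Poisson kernel is the transform of [exp (- d |u|)]; damping the inverse
   transform by it turns the integral into a Poisson average of q. *)
Lemma ft_poisson q (d x : R) : 0 < d -> cintg q ->
  cintg (fun t => q (d * t + x) * CofR (2 / (1 + t ^+ 2))) /\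
  cint (fun u => ft q (CofR u) * CofR (expR (- (d * `|u|))) *
                 cexp (- (CI * CofR u * CofR x))) =
  cint (fun t => q (d * t + x) * CofR (2 / (1 + t ^+ 2))).
Proof.
move=> d0 iq.
have iP : cintg (fun s => q s * CofR (2 * d / (d ^+ 2 + (s - x) ^+ 2))).
  apply: cintg_dom (rintgZ (2 / d) (cintg_cabs iq)) _.
    apply: cmeasM (cintg_meas iq) _; apply: cmeas_ofR.
    by apply: rintg_meas; exact: rintg_poisson.
  move=> s; rewrite cabsM cabs_ofR mulrC; apply: ler_wpM2r; first exact: cabs_ge0.
  exact: poisson_le.
have E t : CofR d * (q (d * t + x) * CofR (2 * d / (d ^+ 2 + (d * t + x - x) ^+ 2))) =
    q (d * t + x) * CofR (2 / (1 + t ^+ 2)).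
  by rewrite mulrCA -CofRM addrK poisson_scale.
have dn0 : d != 0 by rewrite gt_eqF.
have iA := cintg_affine x dn0 iP.
split; first by under eq_fun do rewrite -E; exact: cintgZ.
transitivity (cint (fun s => q s * CofR (2 * d / (d ^+ 2 + (s - x) ^+ 2)))); last first.
  rewrite (cint_affine x dn0 iP) gtr0_norm // -cintZ //.
  by congr cint; apply/funext => t; rewrite E.
transitivity (cint (fun y => cint (fun x0 =>
   CofR (expR (- (d * `|x0|))) * (q y * cexp (CI * CofR x0 * CofR (y - x)))))); last first.
  congr cint; apply/funext => s.
  have [i1 e1] := cint_exp_norm (s - x) d0.
  rewrite -e1 -cintZ //; congr cint; apply/funext => u.
  by rewrite mulrCA; congr (_ * (_ * cexp _)); ring.
rewrite -(ft_damp_fubini x d0 iq); congr cint; apply/funext => u.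
rewrite /ft [in LHS]mulrAC -mulrA mulrC -cintZ; last first.
  apply: cintg_mul_unit => //; first exact: cmeas_cexpZ.
  by move=> s; rewrite cabs_cexp_real.
congr cint; apply/funext => s.
transitivity (CofR (expR (- (d * `|u|))) * (q s * (cexp (- (CI * CofR u * CofR x)) * cexp (CI * CofR u * CofR s)))).
  by ring.
by rewrite -cexpD; congr (_ * (_ * cexp _)); rewrite CofRB; ring.
Qed.

End fourier_transform.

(** * Fourier inversion and square integrability of transforms *)

Section inversion.
Variable R : realType.
Local Notation mu := (@lebesgue_measure R).
Implicit Types (q : R -> CC R) (k : CC R).

Definition cconj (z : CC R) : CC R := CofR (ReC z) - CI * CofR (ImC z).

Lemma Re_cconj z : ReC (cconj z) = ReC z.
Proof. by rewrite /cconj !CE; ring. Qed.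
Lemma Im_cconj z : ImC (cconj z) = - ImC z.
Proof. by rewrite /cconj !CE; ring. Qed.
Lemma cabs_cconj z : cabs (cconj z) = cabs z.
Proof.
by apply/eqP; rewrite -(eqrXn2 (n := 2)) ?cabs_ge0 // !cabs_sq Re_cconj Im_cconj sqrrN.
Qed.
Lemma cconjM z w : cconj (z * w) = cconj z * cconj w.
Proof. by apply: CC_ext; rewrite !(CE, Re_cconj, Im_cconj); ring. Qed.
Lemma mul_cconj z : z * cconj z = CofR (cabs z ^+ 2).
Proof. by rewrite cabs_sq; apply: CC_ext; rewrite !(CE, Re_cconj, Im_cconj); ring. Qed.
Lemma cconj_cexp z : cconj (cexp z) = cexp (cconj z).
Proof.
by apply: CC_ext; rewrite !(Re_cconj, Im_cconj, Re_cexp, Im_cexp) ?cosN ?sinN ?mulrN.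
Qed.
Lemma cmeas_cconj d (T : measurableType d) (g : T -> CC R) : cmeas g ->
  cmeas (fun x => cconj (g x)).
Proof.
move=> [g1 g2]; split.
  by under eq_fun do rewrite Re_cconj.
by under eq_fun do rewrite Im_cconj; exact: measurable_funN.
Qed.
Lemma cintg_cconj (g : R -> CC R) : cintg g -> cintg (fun x => cconj (g x)).
Proof.
move=> ig; apply: cintg_dom (cintg_cabs ig) _.
  exact/cmeas_cconj/cintg_meas.
by move=> x; rewrite cabs_cconj.
Qed.
Lemma cint_cconj (g : R -> CC R) : cintg g -> cint (fun x => cconj (g x)) = cconj (cint g).
Proof.
move=> [i1 i2]; apply: CC_ext; rewrite ?Re_cconj ?Im_cconj ?Re_cint ?Im_cint.
  by apply: eq_Rintegral => x _; rewrite Re_cconj.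
by rewrite -rintN //; apply: eq_Rintegral => x _; rewrite Im_cconj.
Qed.

Definition damp (n : nat) (u : R) : R := expR (- (n.+1%:R^-1 * `|u|)).

Lemma damp_ge0 n u : 0 <= damp n u. Proof. exact: expR_ge0. Qed.
Lemma damp_le1 n u : damp n u <= 1.
Proof. by rewrite /damp -expR0 ler_expR oppr_le0 mulr_ge0 // invr_ge0. Qed.
Lemma damp_nd u : {homo damp ^~ u : m n / (m <= n)%N >-> m <= n}.
Proof.
move=> m n mn; rewrite /damp ler_expR lerN2 ler_wpM2r // lef_pV2 ?posrE //.
by rewrite ler_nat ltnS.
Qed.
Lemma rintg_damp n : rintg (damp n).
Proof. by apply: rintg_exp_norm; rewrite invr_gt0. Qed.
Lemma cvg_damp u : (fun n => damp n u) @ \oo --> (1 : R).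
Proof.
rewrite -expR0.
apply: (@cvg_comp _ _ _ (fun n : nat => - (n.+1%:R^-1 * `|u|)) (@expR R) _ (nbhs (0 : R)));
  last exact: continuous_expR.
rewrite -oppr0; apply: cvgN; rewrite -(mul0r `|u|).
apply: cvgM; last exact: cvg_cst.
exact: cvg_harmonic.
Qed.

Lemma ccvg_ofR (u : nat -> R) (l : R) : u @ \oo --> l -> ccvg (fun n => CofR (u n)) (CofR l).
Proof. by move=> ul; apply/ccvgP; split => //; exact: cvg_cst. Qed.

Lemma ft_damp q n (x : R) : cintg q ->
  cint (fun u => ft q (CofR u) * CofR (damp n u) * cexp (- (CI * CofR u * CofR x))) =
  cint (fun t => q (n.+1%:R^-1 * t + x) * CofR (2 / (1 + t ^+ 2))).
Proof.
by move=> iq; have [] // := @ft_poisson R q n.+1%:R^-1 x ltac:(by rewrite invr_gt0) iq.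
Qed.

Lemma cauchy_ge0 (t : R) : 0 <= 2 / (1 + t ^+ 2).
Proof. by rewrite divr_ge0 // addr_ge0 // sqr_ge0. Qed.

(** A Poisson average is bounded by the sup norm times the mass 2 pi. The bound does not depend on
    n, which is what makes the limit in [ft_sq_rintg] possible. *)
Lemma ft_damp_bound q M n (x : R) : cintg q -> (forall s, cabs (q s) <= M) ->
  cabs (cint (fun u => ft q (CofR u) * CofR (damp n u) *
     cexp (- (CI * CofR u * CofR x)))) <= M * (2 * pi).
Proof.
move=> iq qM; rewrite ft_damp //.
have [iC eC] := rintg_cauchy R.
rewrite -eC -rintZ //.
apply: cabs_cint_le.
- apply: cmeasM; last exact: cmeas_ofR (rintg_meas iC).
  by apply: cintg_meas; apply: cintg_affine => //; rewrite invr_eq0.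
- exact: rintgZ.
- move=> t; rewrite cabsM cabs_ofR ger0_norm ?cauchy_ge0 //.
  by apply: ler_wpM2r; [exact: cauchy_ge0|exact: qM].
Qed.

Lemma cmeas_kernel (x : R) : cmeas (fun u : R => cexp (- (CI * CofR u * CofR x))).
Proof.
have -> : (fun u : R => cexp (- (CI * CofR u * CofR x))) = fun u => cexp ((- CI * CofR x) * CofR u).
  by apply/funext => u; congr cexp; ring.
exact: cmeas_cexpZ.
Qed.

(** The two sides of [ft_damp] are passed to the limit separately: the damped inverse transform is
    dominated by |[ft q]|, the Poisson average by M times the Cauchy kernel, where continuity of q
    at x identifies the limit. *)
Theorem fourier_inversion q M (x : R) : cintg q -> (forall s, cabs (q s) <= M) ->
  ccont q x -> cintg (fun u => ft q (CofR u)) ->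
  cint (fun u => ft q (CofR u) * cexp (- (CI * CofR u * CofR x))) =
  CofR (2 * pi) * q x.
Proof.
move=> iq qM cq ih.
have mh := cintg_meas ih.
have [] := @cdct R (fun n u => ft q (CofR u) * CofR (damp n u) * cexp (- (CI * CofR u * CofR x)))
   (fun u => ft q (CofR u) * cexp (- (CI * CofR u * CofR x))) (fun u => cabs (ft q (CofR u))).
- move=> n; apply: cmeasM; last exact: cmeas_kernel.
  by apply: cmeasM => //; exact: cmeas_ofR (rintg_meas (rintg_damp n)).
- by apply: cmeasM => //; exact: cmeas_kernel.
- exact: cintg_cabs.
- apply: nearW => u; apply: ccvgM; last exact: ccvg_cst.
  rewrite -[X in ccvg _ X]mulr1; apply: ccvgM; first exact: ccvg_cst.
  exact/ccvg_ofR/cvg_damp.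
- move=> n u; rewrite cabsM cabs_cexp_imag mulr1 cabsM cabs_ofR.
  rewrite ger0_norm ?damp_ge0 //; apply: ler_piMr; first exact: cabs_ge0.
  exact: damp_le1.
move=> _ cv1.
have [iC eC] := rintg_cauchy R.
have [] := @cdct R (fun n t => q (n.+1%:R^-1 * t + x) * CofR (2 / (1 + t ^+ 2)))
   (fun t => q x * CofR (2 / (1 + t ^+ 2))) (fun t => M * (2 / (1 + t ^+ 2))).
- move=> n; apply: cmeasM; last exact: cmeas_ofR (rintg_meas iC).
  by apply: cintg_meas; apply: cintg_affine => //; rewrite invr_eq0.
- by apply: cmeasM; [exact: cmeas_cst|exact: cmeas_ofR (rintg_meas iC)].
- exact: rintgZ.
- apply: nearW => t; apply: ccvgM; last exact: ccvg_cst.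
  have cv : (fun n : nat => n.+1%:R^-1 * t + x) @ \oo --> x.
    rewrite -[X in _ --> X]add0r; apply: cvgD; last exact: cvg_cst.
    rewrite -(mul0r t); apply: cvgM; last exact: cvg_cst.
    exact: cvg_harmonic.
  case: cq => c1 c2; apply/ccvgP; split.
    exact: (cvg_comp _ _ cv c1).
  exact: (cvg_comp _ _ cv c2).
- move=> n t; rewrite cabsM cabs_ofR ger0_norm ?cauchy_ge0 //.
  by apply: ler_wpM2r; [exact: cauchy_ge0|exact: qM].
move=> _ cv2.
apply: ccvg_unique cv1 _.
have -> : (fun n => cint (fun u => ft q (CofR u) * CofR (damp n u) *
   cexp (- (CI * CofR u * CofR x)))) =
   (fun n => cint (fun t => q (n.+1%:R^-1 * t + x) * CofR (2 / (1 + t ^+ 2)))).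
  by apply/funext => n; rewrite ft_damp.
by rewrite cintZ ?cint_ofR ?eC // in cv2; [rewrite mulrC|exact: cintg_ofR].
Qed.

(** Half of Plancherel, with damping. Writing |[ft q]|^2 as [ft q] times the conjugate transform and
    exchanging integrals leaves the integral of conj (q y) times the damped inverse transform at y,
    which [ft_damp_bound] controls. *)
Lemma ft_sq_damp q M n : cintg q -> (forall s, cabs (q s) <= M) ->
  rintg (fun u => cabs (ft q (CofR u)) ^+ 2 * damp n u) /\
  \int[mu]_u (cabs (ft q (CofR u)) ^+ 2 * damp n u) <=
    M * (2 * pi) * \int[mu]_s cabs (q s).
Proof.
move=> iq qM; pose C := \int[mu]_s cabs (q s).
have C0 : 0 <= C by apply: rint_ge0 => s; exact: cabs_ge0.
have mh := cmeas_ft_real iq.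
have le1 u : cabs (ft q (CofR u)) <= C by exact: cabs_ft_real.
have i1 : rintg (fun u => cabs (ft q (CofR u)) ^+ 2 * damp n u).
  apply: rintg_dom (rintgZ (C ^+ 2) (rintg_damp n)) _.
    apply: measurable_funM; last exact: rintg_meas (rintg_damp n).
    exact/measurable_funX/cmeas_cabs.
  move=> u; rewrite ger0_norm; last by rewrite mulr_ge0 ?damp_ge0 // sqr_ge0.
  apply: ler_wpM2r; first exact: damp_ge0.
  by rewrite ler_pXn2r // nnegrE ?cabs_ge0.
split => //.
have id : cintg (fun u => ft q (CofR u) * CofR (damp n u)).
  apply: cintg_dom (rintgZ C (rintg_damp n)) _.
    by apply: cmeasM => //; exact: cmeas_ofR (rintg_meas (rintg_damp n)).
  move=> u; rewrite cabsM cabs_ofR ger0_norm ?damp_ge0 //.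
  by apply: ler_wpM2r; [exact: damp_ge0|exact: le1].
pose g (p : R * R) := ft q (CofR p.1) * CofR (damp n p.1) *
   (cconj (q p.2) * cexp (- (CI * CofR p.1 * CofR p.2))).
have mg : cmeas g.
  apply: cmeasM; first exact: (cmeas_fst (cintg_meas id)).
  apply: cmeasM; first exact: (cmeas_snd (cmeas_cconj (cintg_meas iq))).
  apply/cmeas_cexp/cmeasN/cmeasM; last exact: (cmeas_ofR (measurable_snd)).
  by apply: cmeasM; [exact: cmeas_cst|exact: (cmeas_ofR measurable_fst)].
have gle u s : cabs (g (u, s)) <= cabs (ft q (CofR u) * CofR (damp n u)) * cabs (q s).
  rewrite /g cabsM; apply: ler_wpM2l; first exact: cabs_ge0.
  by rewrite cabsM cabs_cexp_imag mulr1 cabs_cconj.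
have [_ ee] := cfubini mg (cintg_cabs id) (cintg_cabs iq) gle.
have i2 := cintg_fubini2 mg (cintg_cabs id) (cintg_cabs iq) gle.
have E2 y : cint (fun u => g (u, y)) = cconj (q y) * cint (fun u =>
    ft q (CofR u) * CofR (damp n u) * cexp (- (CI * CofR u * CofR y))).
  rewrite -cintZ; first by congr cint; apply/funext => u; rewrite /g; ring.
  by apply: cintg_mul_unit id _ _; [exact: cmeas_kernel|move=> u; rewrite cabs_cexp_imag].
have e1 : cint (fun u => CofR (cabs (ft q (CofR u)) ^+ 2 * damp n u)) =
   cint (fun y => cconj (q y) * cint (fun u => ft q (CofR u) * CofR (damp n u) *
      cexp (- (CI * CofR u * CofR y)))).
  transitivity (cint (fun x => cint (fun y => ft q (CofR x) * CofR (damp n x) *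
      (cconj (q y) * cexp (- (CI * CofR x * CofR y)))))).
    congr cint; apply/funext => u.
    rewrite cintZ; last first.
      apply: cintg_mul_unit; first exact: cintg_cconj.
        have -> : (fun s : R => cexp (- (CI * CofR u * CofR s))) = fun s => cexp ((- CI * CofR u) * CofR s).
          by apply/funext => s; congr cexp; ring.
        exact: cmeas_cexpZ.
      by move=> s; rewrite cabs_cexp_imag.
    have -> : cint (fun y => cconj (q y) * cexp (- (CI * CofR u * CofR y))) = cconj (ft q (CofR u)).
      rewrite /ft -cint_cconj; last first.
        by apply: cintg_mul_unit iq _ _; [exact: cmeas_cexpZ|move=> s; rewrite cabs_cexp_real].
      congr cint; apply/funext => s; rewrite cconjM cconj_cexp; congr (_ * cexp _).
      by apply: CC_ext; rewrite !(Re_cconj, Im_cconj, CE); ring.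
    by rewrite CofRM -mul_cconj; ring.
  by rewrite -/g ee; congr cint; apply/funext => y; exact: E2.
apply: le_trans (ler_norm _) _.
rewrite -cabs_ofR -cint_ofR e1 {e1 ee}.
rewrite -rintZ; last exact: cintg_cabs.
apply: cabs_cint_le.
- apply: cintg_meas; move: i2; congr cintg; apply/funext => y; exact: E2.
- exact/rintgZ/cintg_cabs.
- move=> y; rewrite cabsM cabs_cconj mulrC.
  by apply: ler_wpM2r; [exact: cabs_ge0|exact: ft_damp_bound].
Qed.

(** The dampings increase to 1 and the bound of [ft_sq_damp] is uniform, so monotone convergence
    applies. *)
Lemma ft_sq_rintg q M : cintg q -> (forall s, cabs (q s) <= M) ->
  rintg (fun u => cabs (ft q (CofR u)) ^+ 2).
Proof.
move=> iq qM; have mh := cmeas_cabs (cmeas_ft_real iq).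
apply/integrableP; split.
  by apply/measurable_EFinP; exact: measurable_funX.
pose g n (u : R) := (cabs (ft q (CofR u)) ^+ 2 * damp n u)%:E.
have g0 n u : (0 <= g n u)%E by rewrite lee_fin mulr_ge0 ?damp_ge0 // sqr_ge0.
have -> : (\int[mu]_x `|(EFin \o (fun u => cabs (ft q (CofR u)) ^+ 2)%R) x| =
    \int[mu]_x limn (g ^~ x))%E.
  apply: eq_integral => u _ /=; rewrite ger0_norm ?sqr_ge0 //.
  apply/esym/cvg_lim => //; apply: cvg_EFin; first exact: nearW.
  rewrite -[X in _ --> X]mulr1; apply: cvgM; first exact: cvg_cst.
  exact: cvg_damp.
rewrite (@monotone_convergence _ _ R mu setT measurableT g) //; first last.
- by move=> u _ m n mn; rewrite lee_fin; apply: ler_wpM2l; [exact: sqr_ge0|exact: damp_nd].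
- by move=> n; apply/measurable_EFinP; apply: rintg_meas; have [] := ft_sq_damp n iq qM.
apply: le_lt_trans (ltry (M * (2 * pi) * \int[mu]_s cabs (q s))).
apply: lime_le.
  apply: ereal_nondecreasing_is_cvgn => m n mn; apply: ge0_le_integral => //.
  - by apply/measurable_EFinP; apply: rintg_meas; have [] := ft_sq_damp m iq qM.
  - by apply/measurable_EFinP; apply: rintg_meas; have [] := ft_sq_damp n iq qM.
  - by move=> u _; rewrite lee_fin; apply: ler_wpM2l; [exact: sqr_ge0|exact: damp_nd].
apply: nearW => n; have [i1 l1] := ft_sq_damp n iq qM.
by rewrite rintgE // lee_fin.
Qed.

Lemma ft_mul_cintg q1 q2 M1 M2 : cintg q1 -> (forall s, cabs (q1 s) <= M1) ->
  cintg q2 -> (forall s, cabs (q2 s) <= M2) ->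
  cintg (fun u => ft q1 (CofR u) * ft q2 (CofR u)).
Proof.
move=> i1 b1 i2 b2.
apply: cintg_dom (rintgD (ft_sq_rintg i1 b1) (ft_sq_rintg i2 b2)) _.
  by apply: cmeasM; exact: cmeas_ft_real.
move=> u; rewrite cabsM.
have := cabs_ge0 (ft q1 (CofR u)); have := cabs_ge0 (ft q2 (CofR u)).
move: (cabs _) (cabs _) => p r p0 r0.
have := sqr_ge0 (p - r); nra.
Qed.

End inversion.

(** * Holomorphy of transforms and division of zeros *)

Section derivative_eps.
Variable K : numFieldType.

Lemma is_derive_epsP (f : K -> K) (x D : K) :
  is_derive x (1 : K) f D <->
  forall e : K, 0 < e -> exists2 r : K, 0 < r &
    forall h, `|h| <= r -> `|f (x + h) - f x - h * D| <= e * `|h|.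
Proof.
split.
- move=> [d dD] e e0.
  have cv : h^-1 *: ((f \o shift x) (h *: 1) - f x) @[h --> 0^'] --> D.
    by rewrite -dD; exact: d.
  move/cvgrPdist_le : cv => /(_ e e0).
  rewrite near_withinE => /nbhs_normP[r /= r0 H].
  (* Halved because the neighbourhood is an open ball while the estimate is wanted on a closed
     one. *)
  exists (r / 2); first by rewrite divr_gt0.
  move=> h hr; have [->|h0] := eqVneq h 0.
    by rewrite addr0 subrr mul0r subr0 normr0 mulr0.
  have : ball_ Num.norm 0 r h.
    by rewrite /ball_ /= sub0r normrN (le_lt_trans hr) // ltr_pdivrMr // ltr_pMr // ltr1n.
  move=> /H /(_ h0) /=.
  rewrite /GRing.scale /= mulr1 => le1.
  have -> : f (x + h) - f x - h * D = - (D - h^-1 * (f (h + x) - f x)) * h.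
    by rewrite [in RHS]addrC (addrC h); field.
  by rewrite normrM normrN ler_wpM2r.
- move=> H.
  have cv : h^-1 *: ((f \o shift x) (h *: 1) - f x) @[h --> 0^'] --> D.
    apply/cvgrPdist_le => e e0; have [r r0 {}H] := H e e0.
    have n1 : \forall h \near (0 : K)^', `|h| <= r by exact: dnbhs0_le.
    near=> h.
    have h0 : h != 0 by near: h; exact: nbhs_dnbhs_neq.
    have : `|h| <= r by near: h.
    move=> /H; rewrite /= /GRing.scale /= mulr1 => le1.
    rewrite -(ler_pM2r (x := `|h|)) ?normr_gt0 // -normrM.
    rewrite -normrN; apply: le_trans le1.
    rewrite le_eqVlt; apply/orP; left; apply/eqP; congr `|_|.
    by rewrite (addrC h); field.
  split; first by apply/cvg_ex; exists D.
  exact: (cvg_lim _ cv).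
Unshelve. all: by end_near. Qed.

End derivative_eps.

Section complex_derivative.
Variable R : realType.

Lemma ltC0_CofR (e : CC R) : 0 < e -> exists2 r : R, 0 < r & e = CofR r.
Proof.
case: e => a b; rewrite ltcE /= => /andP[/eqP b0 a0].
by exists a => //; apply: CC_ext.
Qed.

Lemma CofR_gt0 (r : R) : (0 < CofR r) = (0 < r).
Proof. by rewrite -(ltcR 0 r). Qed.

Lemma leCofR (x y : R) : (CofR x <= CofR y) = (x <= y).
Proof. exact: lecR. Qed.

Lemma is_cderiveP (f : CC R -> CC R) (k D : CC R) :
  is_derive k (1 : CC R) f D <->
  forall e : R, 0 < e -> exists2 r : R, 0 < r &
    forall h, cabs h <= r -> cabs (f (k + h) - f k - h * D) <= e * cabs h.
Proof.
split => [/is_derive_epsP H e e0|H].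
  have [|r r0 {}H] := H (CofR e); first by rewrite CofR_gt0.
  have [r' r'0 rE] := ltC0_CofR r0; exists r' => // h hr.
  have := H h; rewrite rE !normCC -CofRM !leCofR; exact.
apply/is_derive_epsP => e /ltC0_CofR[e' e'0 ->].
have [r r0 {}H] := H e' e'0; exists (CofR r); first by rewrite CofR_gt0.
by move=> h; rewrite !normCC -CofRM !leCofR; exact: H.
Qed.

Lemma is_cderive_quad (f : CC R -> CC R) (k D : CC R) (C r : R) : 0 < r ->
  (forall h, cabs h <= r -> cabs (f (k + h) - f k - h * D) <= C * cabs h ^+ 2) ->
  is_derive k (1 : CC R) f D.
Proof.
move=> r0 H; apply/is_cderiveP => e e0.
have C1 : 0 < `|C| + 1 by rewrite ltr_wpDl.
exists (Num.min r (e / (`|C| + 1))); first by rewrite lt_min r0 divr_gt0.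
move=> h; rewrite le_min => /andP[/H le1 le2].
apply: le_trans le1 _; rewrite expr2 mulrA ler_wpM2r ?cabs_ge0 //.
apply: (@le_trans _ _ ((`|C| + 1) * cabs h)).
  by apply: ler_wpM2r; [exact: cabs_ge0|have := ler_norm C; lra].
by rewrite mulrC -ler_pdivlMr.
Qed.

(** Chain rule along a real line of direction v. The cases v = 1 and v = [CI] together are the
    Cauchy-Riemann equations that drive the contour shift. *)
Lemma is_cderive_line (f : CC R -> CC R) (k v D : CC R) (t : R) :
  is_derive (k + CofR t * v) (1 : CC R) f D ->
  cder (fun s => f (k + CofR s * v)) t (v * D).
Proof.
move=> /is_cderiveP H.
have H' e : 0 < e -> exists2 r : R, 0 < r & forall h : R, `|h| <= r ->
    cabs (f (k + CofR (t + h) * v) - f (k + CofR t * v) - CofR h * (v * D)) <= e * `|h|.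
  move=> e0; have v1 : 0 < cabs v + 1 by rewrite ltr_wpDl ?cabs_ge0.
  have [|r r0 {}H] := H (e / (cabs v + 1)); first by rewrite divr_gt0.
  exists (r / (cabs v + 1)); first by rewrite divr_gt0.
  move=> h hr; have := H (CofR h * v); rewrite cabsM cabs_ofR => Hh.
  rewrite CofRD mulrDl addrA mulrA; apply: le_trans (Hh _) _.
    apply: le_trans (_ : `|h| * (cabs v + 1) <= _).
      by apply: ler_wpM2l => //; rewrite lerDl.
    by rewrite -ler_pdivlMr.
  rewrite mulrAC -mulrA mulrC [X in _ <= X]mulrC -mulrA.
  rewrite mulrA ler_wpM2r ?(ltW e0) //.
  rewrite ler_pdivrMr // ler_wpM2l // lerDl //.
split; apply/is_derive_epsP => e e0; have [r r0 {}H'] := H' e e0; exists r => // h hr;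
  apply: le_trans (H' h hr).
  apply: le_trans (Re_le_cabs _).
  by rewrite !(ReCD, ReCN) [ReC (CofR h * _)]ReCM ReC_ofR ImC_ofR mul0r subr0.
apply: le_trans (Im_le_cabs _).
by rewrite !(ImCD, ImCN) [ImC (CofR h * _)]ImCM ReC_ofR ImC_ofR mul0r addr0.
Qed.

End complex_derivative.

(** * Quadratic Taylor estimates for the exponential *)

Section exponential_taylor.
Variable R : realType.

(** Only 1 + t <= exp t is used. At t = - x / 2, after squaring, it gives (1 - x / 2)^2 exp x <= 1,
    and for x <= 1 the polynomial (1 + x + 2 x^2) (1 - x / 2)^2 is at least 1. *)
Lemma expR_quad (x : R) : x <= 1 -> 0 <= expR x - 1 - x <= 2 * x ^+ 2.
Proof.
move=> x1; apply/andP; split; first by have := expR_ge1Dx x; lra.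
have h : 1 - x / 2 <= expR (- (x / 2)) by have := expR_ge1Dx (- (x / 2)); lra.
have h0 : 0 < 1 - x / 2 by lra.
have hh : (1 - x / 2) ^+ 2 * expR x <= 1.
  have -> : expR x = expR (x / 2) ^+ 2.
    by rewrite expr2 -expRD; congr expR; field.
  rewrite -exprMn; apply: exprn_ile1.
    by rewrite mulr_ge0 ?expR_ge0 // ltW.
  by rewrite -ler_pdivlMr ?expR_gt0 // div1r -expRN.
have p : 1 <= (1 + x + 2 * x ^+ 2) * (1 - x / 2) ^+ 2.
  rewrite -subr_ge0.
  have -> : (1 + x + 2 * x ^+ 2) * (1 - x / 2) ^+ 2 - 1 =
     x ^+ 2 * ((1 - x) * (5 / 4 - x / 2)) by field.
  by rewrite mulr_ge0 ?sqr_ge0 // mulr_ge0; lra.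
have h2 : 0 < (1 - x / 2) ^+ 2 by rewrite exprn_gt0.
have : expR x <= 1 + x + 2 * x ^+ 2.
  by rewrite -(ler_pM2r h2) mulrC; exact: le_trans hh p.
lra.
Qed.

Lemma MVT0 (f df : R -> R) (y : R) : (forall x, is_derive x (1 : R) f (df x)) ->
  exists2 c, `|c| <= `|y| & f y - f 0 = df c * y.
Proof.
move=> dF.
have cF a b : {within `[a, b], continuous f}.
  apply: continuous_subspaceT => x; have [d _] := dF x.
  exact: (differentiable_continuous (proj1 (derivable1_diffP _ _) d)).
have [y0|y0] := leP 0 y.
  have [c] := @MVT_segment R f df 0 y y0 (fun x _ => dF x) (cF _ _).
  rewrite in_itv /= subr0 => /andP[c0 cy] e; exists c => //.
  by rewrite !ger0_norm.
have [c] := @MVT_segment R f df y 0 (ltW y0) (fun x _ => dF x) (cF _ _).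
rewrite in_itv /= sub0r => /andP[cy c0] e; exists c.
  by rewrite !ler0_norm ?lerN2 // ltW.
by rewrite -opprB e mulrN opprK.
Qed.

Lemma sin_le_norm (y : R) : `|sin y| <= `|y|.
Proof.
have [c _] := @MVT0 sin cos y (fun x => is_derive_sin x).
rewrite sin0 subr0 => ->; rewrite normrM ler_piMl //.
by rewrite ler_norml cos_geN1 cos_le1.
Qed.

Lemma cos_quad (y : R) : `|cos y - 1| <= y ^+ 2.
Proof.
have [c cy] := @MVT0 cos (fun x => - sin x) y (fun x => is_derive_cos x).
rewrite cos0 => ->; rewrite normrM normrN.
rewrite -(real_normK (num_real y)) expr2 ler_wpM2r //.
exact: le_trans (sin_le_norm c) cy.
Qed.

Lemma sin_quad (y : R) : `|y| <= 1 -> `|sin y - y| <= y ^+ 2.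
Proof.
move=> y1.
have dF (x : R) : is_derive x (1 : R) (fun x => sin x - x) (cos x - 1).
  exact: (is_deriveB (is_derive_sin x) (is_derive_id x 1)).
have [c cy] := MVT0 y dF.
rewrite sin0 !subr0 => ->; rewrite normrM.
rewrite -(real_normK (num_real y)) expr2 ler_wpM2r //.
apply: le_trans (cos_quad c) _.
rewrite -(real_normK (num_real c)) expr2.
by rewrite -[leRHS]mulr1; apply: ler_pM => //; exact: le_trans cy y1.
Qed.

(** With [E] = exp x - 1 - x, both components split into products of real remainders, each at most 2
    x^2 + 2 y^2 up to the cross term |x| |y|; the constant 8 leaves room for the sum. *)
Lemma cexp_quad (z : CC R) : cabs z <= 1 ->
  cabs (cexp z - 1 - z) <= 8 * cabs z ^+ 2.
Proof.
move=> z1; rewrite cabs_sq.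
have x1 := le_trans (Re_le_cabs z) z1; have y1 := le_trans (Im_le_cabs z) z1.
apply: le_trans (cabs_le_ReIm _) _.
rewrite !(ReCD, ImCD, ReCN, ImCN) !(ReC1, ImC1) Re_cexp Im_cexp.
move: (ReC z) (ImC z) x1 y1 => x y x1 y1.
have := expR_quad (le_trans (ler_norm x) x1); have := cos_quad y; have := sin_quad y1.
have := cos_le1 y; have := cos_geN1 y; have := sin_le1 y; have := sin_geN1 y.
set E := expR x - 1 - x; have -> : expR x = 1 + x + E by rewrite /E; ring.
move: E (cos y) (sin y) => E c s s1 s2 c1 c2 hs hc /andP[E0 hE].
have E1 : `|E| <= 2 * x ^+ 2 by rewrite ger0_norm.
have c3 : `|c| <= 1 by rewrite ler_norml c1 c2.
have s3 : `|s| <= 1 by rewrite ler_norml s1 s2.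
have x2 : `|1 + x| <= 2 by apply: le_trans (ler_normD _ _) _; rewrite normr1; lra.
have le1 : `|(1 + x + E) * c - 1 - x| <= 2 * x ^+ 2 + 2 * y ^+ 2.
  have -> : (1 + x + E) * c - 1 - x = E * c + (1 + x) * (c - 1) by ring.
  apply: le_trans (ler_normD _ _) _; rewrite !normrM; apply: lerD.
    by rewrite -[leRHS]mulr1; apply: ler_pM.
  by apply: ler_pM.
have le2 : `|(1 + x + E) * s - 0 - y| <= 2 * x ^+ 2 + 2 * y ^+ 2 + `|x| * `|y|.
  have -> : (1 + x + E) * s - 0 - y = E * s + (1 + x) * (s - y) + x * y by ring.
  apply: le_trans (ler_normD _ _) _; rewrite [`|x * y|]normrM lerD2r.
  apply: le_trans (ler_normD _ _) _; rewrite !normrM; apply: lerD.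
    by rewrite -[leRHS]mulr1; apply: ler_pM.
  by apply: ler_pM.
apply: le_trans (lerD le1 le2) _.
rewrite -(real_normK (num_real x)) -(real_normK (num_real y)).
have := sqr_ge0 (`|x| - `|y|); nra.
Qed.

End exponential_taylor.

(** * Transforms of bounded functions with compact support, and division by a linear factor *)

Section transform_class.
Variable R : realType.
Local Notation mu := (@lebesgue_measure R).
Implicit Types (q : R -> CC R) (k : CC R) (B : R).

Lemma measurable_pairr (s : R) : measurable_fun setT (fun x : R => (s, x)).
Proof. exact: measurable_fun_pair. Qed.

Lemma cabs_cint_itv (a b M : R) q : a <= b -> cmeas q ->
  (forall x, x \in `[a, b] -> cabs (q x) <= M) ->
  (forall x, x \notin `[a, b] -> q x = 0) -> cabs (cint q) <= M * (b - a).
Proof. by move=> ab mq qM q0; have [] := cintg_bounded_itv ab mq qM q0. Qed.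

(* Bounded with compact support. *)
Definition bcs B q : Prop :=
  [/\ 0 <= B, cmeas q, exists M, forall s, cabs (q s) <= M &
      forall s, s \notin `[0, B] -> q s = 0].

Lemma bcs_cintg B q : bcs B q -> cintg q.
Proof.
move=> [B0 mq [M qM] q0].
by have [] := cintg_bounded_itv B0 mq (fun x _ => qM x) q0.
Qed.

Lemma bcs_mul B q (e : R -> CC R) (N : R) : bcs B q -> cmeas e ->
  (forall s, s \in `[0, B] -> cabs (e s) <= N) -> bcs B (fun s => q s * e s).
Proof.
move=> [B0 mq [M qM] q0] me eN; split => //.
- exact: cmeasM.
- exists (M * N) => s; case: (boolP (s \in `[0, B])) => sB.
    by rewrite cabsM; apply: ler_pM; rewrite ?cabs_ge0 // eN.
  have M0 : 0 <= M by apply: le_trans (qM s); exact: cabs_ge0.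
  have N0 : 0 <= N.
    have B0' : (0 : R) \in `[0, B] by rewrite in_itv /= lexx.
    by apply: le_trans (eN _ B0'); exact: cabs_ge0.
  by rewrite q0 // mul0r cabs0 mulr_ge0.
- by move=> s /q0 ->; rewrite mul0r.
Qed.

Lemma cabs_cexp_itv B (z : CC R) (s : R) : s \in `[0, B] ->
  cabs (cexp (z * CofR s)) <= expR (`|ReC z| * B).
Proof.
rewrite in_itv /= => /andP[s0 sB].
rewrite cabs_cexp !CE mulr0 subr0 ler_expR.
apply: le_trans (ler_norm _) _; rewrite normrM (ger0_norm s0).
exact: ler_wpM2l.
Qed.

Lemma bcs_cexp B q (z : CC R) : bcs B q -> bcs B (fun s => q s * cexp (z * CofR s)).
Proof.
move=> bq; apply: bcs_mul bq (cmeas_cexpZ z) _ => s; exact: cabs_cexp_itv.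
Qed.

Definition mulix q (s : R) : CC R := q s * (CI * CofR s).

Lemma measurable_idR : measurable_fun setT (fun s : R => s).
Proof. exact: measurable_id. Qed.

Lemma bcs_mulix B q : bcs B q -> bcs B (mulix q).
Proof.
move=> bq; apply: (bcs_mul (N := B) bq).
  by apply: cmeasM; [exact: cmeas_cst|exact: cmeas_ofR measurable_idR].
move=> s; rewrite in_itv /= => /andP[s0 sB].
by rewrite cabsM cabsI mul1r cabs_ofR ger0_norm.
Qed.

Lemma ft_shift q k k' :
  ft q (k + k') = ft (fun s => q s * cexp (CI * k' * CofR s)) k.
Proof.
rewrite /ft; congr cint; apply/funext => s.
by rewrite -[RHS]mulrA -cexpD; congr (_ * cexp _); ring.
Qed.

Lemma cabs_ft_bcs B q M k : bcs B q -> (forall s, cabs (q s) <= M) ->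
  cabs (ft q k) <= M * expR (`|ImC k| * B) * B.
Proof.
move=> bq qM; have [B0 mq _ q0] := bq.
have M0 : 0 <= M by apply: le_trans (qM 0); exact: cabs_ge0.
rewrite -[X in _ * X]subr0; apply: cabs_cint_itv => //.
- by apply: cmeasM => //; exact: cmeas_cexpZ.
- move=> s sB; rewrite cabsM; apply: ler_pM; rewrite ?cabs_ge0 //.
  by apply: le_trans (cabs_cexp_itv _ sB) _; rewrite !CE mul0r mul1r sub0r normrN.
- by move=> s /q0 ->; rewrite mul0r.
Qed.

Lemma ft_is_derive B q k : bcs B q -> is_derive k (1 : CC R) (ft q) (ft (mulix q) k).
Proof.
move=> bq; have [B0 mq [M qM] q0] := bq.
have bk := bcs_cexp (CI * k) bq.
have [_ mk [N kN] _] := bk.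
have N0 : 0 <= N by apply: le_trans (kN 0); exact: cabs_ge0.
(* [N] bounds q s exp (i k s), 8 B^2 comes from [cexp_quad] with |h s| <= |h| B, and the last B is
   the length of the support. The radius keeps |h s| <= 1 and makes sense for B = 0 too. *)
apply: (@is_cderive_quad _ _ _ _ (N * (8 * B ^+ 2) * B) (B + 1)^-1).
  by rewrite invr_gt0 ltr_wpDl.
move=> h hr.
have ik k' := bcs_cintg (bcs_cexp (CI * k') bq).
have i2 : cintg (fun s => h * (mulix q s * cexp (CI * k * CofR s))).
  apply: cintgZ; exact: (bcs_cintg (bcs_cexp (CI * k) (bcs_mulix bq))).
rewrite /ft -cintB // -cintZ; last exact: (bcs_cintg (bcs_cexp (CI * k) (bcs_mulix bq))).
rewrite -cintB //; last exact: cintgB.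
have -> : (fun s => q s * cexp (CI * (k + h) * CofR s) - q s * cexp (CI * k * CofR s) -
    h * (mulix q s * cexp (CI * k * CofR s))) =
  (fun s => (q s * cexp (CI * k * CofR s)) *
     (cexp (CI * h * CofR s) - 1 - CI * h * CofR s)).
  apply/funext => s; rewrite /mulix.
  have -> : CI * (k + h) * CofR s = CI * k * CofR s + CI * h * CofR s by ring.
  by rewrite cexpD; ring.
have E0 : B = B - 0 by rewrite subr0.
rewrite [leRHS]mulrAC [X in _ <= _ * X]E0; apply: cabs_cint_itv => //.
- apply: cmeasM => //; apply: cmeasB.
    by apply: cmeasB; [exact: cmeas_cexpZ|exact: cmeas_cst].
  by apply: cmeasM; [exact: cmeas_cst|exact: cmeas_ofR measurable_idR].
- move=> s; rewrite in_itv /= => /andP[s0 sB].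
  have hs : cabs (CI * h * CofR s) = cabs h * s.
    by rewrite cabsM cabsM cabsI mul1r cabs_ofR ger0_norm.
  rewrite cabsM -[leRHS]mulrA; apply: ler_pM; rewrite ?cabs_ge0 //.
  apply: le_trans (cexp_quad _) _.
    rewrite hs; apply: le_trans (_ : cabs h * (B + 1) <= _).
      by apply: ler_wpM2l; rewrite ?cabs_ge0 //; lra.
    by rewrite -ler_pdivlMr ?div1r // ltr_wpDl.
  rewrite hs exprMn [leRHS]mulrAC -[leRHS]mulrA; apply: ler_wpM2l; first by [].
  apply: ler_wpM2l; first exact: sqr_ge0.
  by rewrite ler_pXn2r // nnegrE (le_trans s0).
- by move=> s /q0 ->; rewrite !mul0r.
Qed.

Lemma ft_derive1 B q : bcs B q -> derive1 (ft q) = ft (mulix q).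
Proof.
by move=> bq; apply/funext => k; rewrite derive1E; have [_ ->] := ft_is_derive k bq.
Qed.

(* When the transform of q vanishes at k0, that of [qdiv k0 q] is its quotient by
   k - k0, and [qdiv k0 q] still vanishes outside [0, B]. *)
Definition qdiv k0 q (s : R) : CC R :=
  cint (fun x => CofR (\1_[set p : R * R | 0 <= p.1 <= p.2] (s, x)) *
    (CI * cexp (CI * k0 * CofR (x - s)) * q x)).

Let A2 := [set p : R * R | 0 <= p.1 <= p.2].

Let mA2 : measurable A2.
Proof.
have -> : A2 = [set p : R * R | 0 <= p.1] `&` [set p | p.1 <= p.2].
  by apply/seteqP; split => p /=; [move=> /andP[]|move=> [? ?]; exact/andP].
apply: measurableI.
  have := @measurable_fun_ler _ _ R setT (fun _ : R * R => 0) fst (measurable_cst _) measurable_fst.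
  by move=> /(_ measurableT [set true] ltac:(by [])); rewrite setTI; congr measurable;
    apply/seteqP; split => p.
have := @measurable_fun_ler _ _ R setT (fst : R * R -> R) snd measurable_fst measurable_snd.
by move=> /(_ measurableT [set true] ltac:(by [])); rewrite setTI; congr measurable;
    apply/seteqP; split => p.
Qed.

(** The double integrand of [ft (qdiv k0 q) k]; at k = 0 it reduces to the integrand of [qdiv]
    itself, so one domination serves both. *)
Let qint k0 k q (p : R * R) : CC R :=
  CofR (\1_A2 p) * (CI * cexp (CI * k0 * CofR (p.2 - p.1)) * q p.2 * cexp (CI * k * CofR p.1)).

Let qint_dom B k0 k q : bcs B q -> exists N,
  [/\ cmeas (qint k0 k q), rintg (fun s => N * \1_`[0, B]%classic s),
     rintg (fun s : R => \1_`[0, B]%classic s : R) &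
  forall s x, cabs (qint k0 k q (s, x)) <= (N * \1_`[0, B]%classic s) * \1_`[0, B]%classic x].
Proof.
move=> bq; have [B0 mq [M qM] q0] := bq.
have M0 : 0 <= M by apply: le_trans (qM 0); exact: cabs_ge0.
exists (expR (`|ImC k0| * B) * M * expR (`|ImC k| * B)); split.
- apply: cmeasM; first by apply: cmeas_ofR; exact: measurable_indic.
  apply: cmeasM; last first.
    apply: cmeas_cexp; apply: cmeasM; first exact: cmeas_cst.
    exact: (cmeas_ofR measurable_fst).
  apply: cmeasM; last exact: (cmeas_snd mq).
  apply: cmeasM; first exact: cmeas_cst.
  apply: cmeas_cexp; apply: cmeasM; first exact: cmeas_cst.
  by apply: cmeas_ofR; apply: measurable_funB; [exact: measurable_snd|exact: measurable_fst].
- by have [] := rint_cst_itv (expR (`|ImC k0| * B) * M * expR (`|ImC k| * B)) B0.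
- have [i1 _] := rint_cst_itv 1 B0; move: i1; congr rintg.
  by apply/funext => x; rewrite mul1r.
move=> s x; rewrite /qint /= indicE.
case: (boolP (x \in `[0, B])) => xB; last first.
  rewrite q0 // mulr0 mul0r mulr0 cabs0 mulr_ge0 // ?indicE //.
  by rewrite !mulr_ge0 ?expR_ge0 // indicE.
case: (boolP ((s, x) \in A2)); last first.
  by move=> _; rewrite mul0r cabs0 !mulr_ge0 ?expR_ge0 ?indicE.
rewrite inE /A2 /= => /andP[s0 sx]; rewrite mul1r.
move: (xB); rewrite in_itv /= => /andP[x0 xB'].
have sB : s \in `[0, B] by rewrite in_itv /= s0 (le_trans sx).
rewrite !indicE !mem_set // !mulr1.
rewrite cabsM; apply: ler_pM; rewrite ?cabs_ge0 //; last first.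
  by apply: le_trans (cabs_cexp_itv _ sB) _; rewrite !CE mul0r mul1r sub0r normrN.
rewrite cabsM; apply: ler_pM; rewrite ?cabs_ge0 //.
rewrite cabsM cabsI mul1r.
have xsB : x - s \in `[0, B] by rewrite in_itv /= subr_ge0 sx lerBlDr ler_wpDr.
by apply: le_trans (cabs_cexp_itv _ xsB) _; rewrite !CE mul0r mul1r sub0r normrN.
Qed.

Lemma rint_indic_itv1 B : 0 <= B -> \int[mu]_x (\1_`[0, B]%classic x) = B.
Proof.
move=> B0; have [_ e] := rint_cst_itv 1 B0; rewrite -[RHS](subr0 B) -[RHS]mul1r -e.
by apply: eq_Rintegral => x _; rewrite mul1r.
Qed.

Lemma bcs_qdiv B k0 q : bcs B q -> bcs B (qdiv k0 q).
Proof.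
move=> bq; have [B0 mq [M qM] q0] := bq.
have [N [mg iA iB le]] := qint_dom k0 0 bq.
have E s : qdiv k0 q s = cint (fun x => qint k0 0 q (s, x)).
  congr cint; apply/funext => x; rewrite /qint /=.
  by rewrite mulr0 mul0r cexp0 mulr1.
split => //.
- have [ii _] := cfubini mg iA iB le.
  by move/cintg_meas : ii; congr cmeas; apply/funext => s; rewrite E.
- exists (`|N| * B) => s; rewrite E -(rint_indic_itv1 B0) -rintZ //.
  apply: cabs_cint_le.
  + exact: (cmeas_comp (measurable_pairr s) mg).
  + exact: rintgZ.
  + move=> x; apply: le_trans (le s x) _.
    apply: ler_wpM2r; first by rewrite indicE.
    apply: le_trans (ler_norm _) _; rewrite normrM ler_piMr // indicE.
    by case: (_ \in _); rewrite ?normr1 ?normr0.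
- move=> s sB; rewrite -(cint0 R) E; congr cint; apply/funext => x.
  rewrite /qint /= indicE; case: (boolP ((s, x) \in A2)); last by rewrite mul0r.
  rewrite inE /A2 /= => /andP[s0 sx].
  rewrite q0 ?mulr0 ?mul0r ?mulr0 //.
  apply: contra sB; rewrite !in_itv /= => /andP[_ xB].
  by rewrite s0 (le_trans sx).
Qed.

(** After exchanging integrals, the inner integral over s in [0, x] is that of exp (i (k - k0) s),
    and i (k - k0) times it is exp (i (k - k0) x) - 1. Subtracting [ft q k0] makes the identity hold
    whether or not k0 is a zero. *)
Lemma ft_qdiv B k0 k q : bcs B q -> ft q k - ft q k0 = (k - k0) * ft (qdiv k0 q) k.
Proof.
move=> bq; have [B0 mq [M qM] q0] := bq.
have [N [mg iA iB le]] := qint_dom k0 k bq.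
have ig s : cintg (fun x => CofR (\1_A2 (s, x)) * (CI * cexp (CI * k0 * CofR (x - s)) * q x)).
  have [N' [mg' iA' iB' le']] := qint_dom k0 0 bq.
  have E : (fun x => CofR (\1_A2 (s, x)) * (CI * cexp (CI * k0 * CofR (x - s)) * q x)) =
      fun x => qint k0 0 q (s, x).
    by apply/funext => x; rewrite /qint /= mulr0 mul0r cexp0 mulr1.
  rewrite E; apply: cintg_dom (rintgZ (N' * \1_`[0, B]%classic s) iB') (le' s).
  exact: (cmeas_comp (measurable_pairr s) mg').
have -> : ft (qdiv k0 q) k = cint (fun s => cint (fun x => qint k0 k q (s, x))).
  rewrite /ft; congr cint; apply/funext => s.
  rewrite mulrC /qdiv -cintZ; last exact: ig.
  congr cint; apply/funext => x.
  by rewrite /qint /=; ring.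
rewrite (cfubini mg iA iB le).2.
have inner x : (k - k0) * cint (fun s => qint k0 k q (s, x)) =
    q x * cexp (CI * k * CofR x) - q x * cexp (CI * k0 * CofR x).
  case: (boolP (x \in `[0, B])) => xB; last first.
    rewrite q0 // !mul0r subr0.
    have -> : (fun s => qint k0 k q (s, x)) = fun=> 0.
      by apply/funext => s; rewrite /qint /= q0 // mulr0 mul0r mulr0.
    by rewrite cint0 mulr0.
  move: xB; rewrite in_itv /= => /andP[x0 xB].
  have -> : (fun s => qint k0 k q (s, x)) = fun s =>
     (CI * cexp (CI * k0 * CofR x) * q x) *
     cind `[0, x]%classic (fun s => cexp (CI * (k - k0) * CofR s)) s.
    apply/funext => s; rewrite /qint /cind /=.
    have -> : \1_A2 (s, x) = \1_`[0, x]%classic s :> R.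
      have e : ((s, x) \in A2) = (s \in `[0, x]%classic).
        by apply/idP/idP; rewrite !inE /A2 /= ?in_itv.
      by rewrite !indicE e.
    have -> : CI * (k - k0) * CofR s = CI * k * CofR s - CI * k0 * CofR s by ring.
    have -> : CI * k0 * CofR (x - s) = CI * k0 * CofR x - CI * k0 * CofR s.
      by rewrite CofRB; ring.
    by rewrite !cexpD; ring.
  rewrite cintZ; last first.
    have [] // := @cintg_bounded_itv R 0 x (expR (`|ReC (CI * (k - k0))| * x)) (cind `[0, x]%classic (fun t => cexp (CI * (k - k0) * CofR t))) x0.
    - by apply: cmeas_cind => //; exact: cmeas_cexpZ.
    - by move=> t xt; apply: le_trans (cabs_cind_le _ _ _) _; exact: cabs_cexp_itv.
    - by move=> t xt; rewrite cindF //; apply/negP.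
  have := cint_cexp_itv (CI * (k - k0)) x0.
  rewrite CofR0 mulr0 cexp0 => e.
  transitivity (cexp (CI * k0 * CofR x) * q x * (CI * (k - k0) *
    cint (cind `[0, x] (fun t : R => cexp (CI * (k - k0) * CofR t))))); first by ring.
  rewrite e.
  have -> : CI * (k - k0) * CofR x = CI * k * CofR x - CI * k0 * CofR x by ring.
  rewrite cexpD cexpN; field; exact: cexp_neq0.
have [N' [mg' iA' iB' le']] := qint_dom k0 k bq.
rewrite -cintZ; last exact: cintg_fubini2 mg' iA' iB' le'.
rewrite /ft -cintB; [|exact: (bcs_cintg (bcs_cexp _ bq))|exact: (bcs_cintg (bcs_cexp _ bq))].
by congr cint; apply/funext => x; rewrite inner.
Qed.

End transform_class.

(** * Exhausting the zeros of a transform in a bounded region *)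

Section zeros.
Variable R : realType.
Local Notation mu := (@lebesgue_measure R).
Implicit Types (q : R -> CC R) (k : CC R) (B : R).

(* With an exponential weight, dividing out a zero contracts the sup norm;
   this is what bounds the number of zeros. *)
Lemma qdiv_bound B q k0 (M l c : R) : bcs B q ->
  (forall s, cabs (q s) <= M * expR (- (l * s))) -> - c <= ImC k0 -> c < l ->
  forall s, cabs (qdiv k0 q s) <= M * (2 / (l - c)) * expR (- (l * s)).
Proof.
move=> bq qM kc cl s; have [B0 mq _ q0] := bq.
have M0 : 0 <= M.
  by have := le_trans (cabs_ge0 _) (qM 0); rewrite pmulr_lge0 // expR_gt0.
have lc : 0 < l - c by rewrite subr_gt0.
(* For x >= s the integrand is at most M exp (- l s) exp (- (l - c) (x - s)). The half-line integral
   is bounded by that of exp (- (l - c) |x - s|) over the whole line, hence the 2 in 2 / (l - c). *)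
have [i1 e1] := rint_exp_norm lc.
have i2 : rintg (fun x => expR (- ((l - c) * `|1 * x + - s|))).
  exact: (rintg_affine (- s) (oner_neq0 R) i1).
have e2 : \int[mu]_x expR (- ((l - c) * `|1 * x + - s|)) = 2 / (l - c).
  by rewrite -e1 (rint_affine (- s) (oner_neq0 R) i1) normr1 mul1r.
have -> : M * (2 / (l - c)) * expR (- (l * s)) =
   \int[mu]_x (M * expR (- (l * s)) * expR (- ((l - c) * `|1 * x + - s|))).
  by rewrite rintZ // e2 mulrAC.
apply: cabs_cint_le.
- apply: cmeasM.
    apply: cmeas_ofR.
    have -> : (fun x : R => \1_[set p : R * R | 0 <= p.1 <= p.2] (s, x)) =
       (\1_[set x : R | 0 <= s <= x] : R -> R).
      apply/funext => x; rewrite !indicE.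
      have -> : ((s, x) \in [set p : R * R | 0 <= p.1 <= p.2]) = (x \in [set x : R | 0 <= s <= x]).
        by apply/idP/idP; rewrite !inE.
      by [].
    apply: measurable_indic.
    case: (leP 0 s) => s0; last first.
      rewrite (_ : [set _ | _] = set0) //; apply/seteqP; split => x //=; by rewrite leNgt s0.
    rewrite (_ : [set _ | _] = `[s, +oo[%classic) //.
    by apply/seteqP; split => x /=; rewrite in_itv /= andbT.
  apply: cmeasM => //; apply: cmeasM; first exact: cmeas_cst.
  apply: cmeas_cexp; apply: cmeasM; first exact: cmeas_cst.
  by apply: cmeas_ofR; apply: measurable_funB => //; exact: measurable_idR.
- exact: rintgZ.
- move=> x; rewrite indicE; case: (boolP (_ \in _)) => [|_]; last first.
    by rewrite mul0r cabs0 !mulr_ge0 ?expR_ge0.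
  rewrite inE /= => /andP[s0 sx]; rewrite (_ : CofR true%:R = 1) //.
  rewrite [1 * (_ * _)]mul1r cabsM cabsM cabsI [1 * cabs _]mul1r cabs_cexp.
  rewrite !CE mul0r mul1r sub0r mulr0 subr0.
  rewrite mul1r ger0_norm ?subr_ge0 // -mulrA -expRD.
  apply: le_trans (_ : expR (- ImC k0 * (x - s)) * (M * expR (- (l * x))) <= _).
    by apply: ler_wpM2l; rewrite ?expR_ge0.
  rewrite mulrCA -expRD; apply: ler_wpM2l => //; rewrite ler_expR.
  have : 0 <= (ImC k0 + c) * (x - s) by rewrite mulr_ge0 //; lra.
  lra.
Qed.

(** If the division never stopped, there would be N factors for every N. At [k1] their product is at
    most L^N, and the remaining transform is at most a constant times (2 / (l - c))^N, so
    |[ft q k1]| <= C 2^-N for all N, against [ft q k1 != 0]. *)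
Lemma factor_zeros B q (c L : R) k1 (Om : CC R -> Prop) : bcs B q -> 0 <= c -> 0 <= L ->
  (forall k, Om k -> - c <= ImC k /\ cabs (k1 - k) <= L) -> ft q k1 != 0 ->
  exists ks q', [/\ bcs B q', forall z, z \in ks -> Om z /\ ft q z = 0,
    forall k, ft q k = (\prod_(z <- ks) (k - z)) * ft q' k &
    forall k, Om k -> ft q' k != 0].
Proof.
move=> bq c0 L0 OmP qk1; have [B0 mq [M qM] q0] := bq.
apply: contrapT => nE.
(* Chosen so that L * (2 / (l - c)) <= 1 / 2; the summand 4 keeps l - c positive when L = 0. *)
pose l := c + (4 * L + 4).
have l0 : 0 <= l by rewrite /l; lra.
have cl : c < l by rewrite /l; lra.
have M0 : 0 <= M by apply: le_trans (qM 0); exact: cabs_ge0.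
(* On [0, B] the weight exp (- l s) is at least exp (- l B), so the unweighted bound M becomes the
   weighted bound [M'] with which the iteration starts. *)
pose M' := M * expR (l * B).
have M'0 : 0 <= M' by rewrite mulr_ge0 ?expR_ge0.
have step N : exists ks q', [/\ bcs B q', forall z, z \in ks -> Om z /\ ft q z = 0,
    forall k, ft q k = (\prod_(z <- ks) (k - z)) * ft q' k, size ks = N &
    forall s, cabs (q' s) <= M' * (2 / (l - c)) ^+ N * expR (- (l * s))].
  elim: N => [|N [ks [q' [bq' ksP fE sz q'M]]]].
    exists [::], q; split => //.
      by move=> k; rewrite big_nil mul1r.
    move=> s; rewrite expr0 mulr1 /M' -mulrA -expRD.
    case: (boolP (s \in `[0, B])) => sB; last first.
      by rewrite q0 // cabs0 mulr_ge0 ?expR_ge0.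
    apply: le_trans (qM s) _; rewrite ler_peMr // -expR0 ler_expR.
    move: sB; rewrite in_itv /= => /andP[_ sB].
    by rewrite subr_ge0; apply: ler_wpM2l.
  have [z [Oz z0]] : exists z, Om z /\ ft q' z = 0.
    apply: contrapT => nz; apply: nE; exists ks, q'; split => // k Ok.
    by apply/eqP => e; apply: nz; exists k.
  exists (z :: ks), (qdiv z q'); split.
  - exact: bcs_qdiv.
  - move=> w; rewrite inE => /orP[/eqP ->|]; last exact: ksP.
    by split => //; rewrite fE z0 mulr0.
  - move=> k; rewrite big_cons mulrAC -mulrA mulrCA [RHS]mulrC fE -[RHS]mulrC.
    by have := ft_qdiv z k bq'; rewrite z0 subr0 => ->; ring.
  - by rewrite /= sz.
  - have [kc _] := OmP z Oz.
    by move=> s; have := qdiv_bound bq' q'M kc cl s; rewrite exprS; congr (_ <= _); ring.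
pose C := M' * expR (`|ImC k1| * B) * B.
have key N : cabs (ft q k1) <= C * (2^-1) ^+ N.
  have [ks [q' [bq' ksP fE sz q'M]]] := step N.
  rewrite fE cabsM.
  have P1 : cabs (\prod_(z <- ks) (k1 - z)) <= L ^+ N.
    rewrite cabs_prod -sz -(count_predT ks) -iter_mulr_1 -big_const_seq.
    rewrite big_seq [leRHS]big_seq; apply: ler_prod => z zk.
    by rewrite cabs_ge0 /=; have [/OmP[]] := ksP z zk.
  have b' s : cabs (q' s) <= M' * (2 / (l - c)) ^+ N.
    case: (boolP (s \in `[0, B])) => sB; last first.
      have [_ _ _ q'0] := bq'; rewrite q'0 // cabs0 mulr_ge0 // exprn_ge0 // divr_ge0 //.
      by rewrite subr_ge0 ltW.
    apply: le_trans (q'M s) _; rewrite ler_piMr //.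
      by rewrite mulr_ge0 // exprn_ge0 // divr_ge0 // subr_ge0 ltW.
    rewrite -expR0 ler_expR oppr_le0 mulr_ge0 //.
    by move: sB; rewrite in_itv /= => /andP[].
  have P2 := cabs_ft_bcs k1 bq' b'.
  apply: le_trans (ler_pM _ _ P1 P2) _; rewrite ?cabs_ge0 //.
  have -> : L ^+ N * (M' * (2 / (l - c)) ^+ N * expR (`|ImC k1| * B) * B) =
      C * (L * (2 / (l - c))) ^+ N by rewrite /C [in RHS](exprMn _ L); move: (L ^+ N) ((2 / (l - c)) ^+ N) => u v; ring.
  apply: ler_wpM2l; first by rewrite /C !mulr_ge0 ?expR_ge0.
  have lcE : l - c = 4 * L + 4 by rewrite /l; ring.
  have le2 : L * (2 / (4 * L + 4)) <= 2^-1 by rewrite mulrA ler_pdivrMr; lra.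
  have ge0 : 0 <= L * (2 / (4 * L + 4)) by rewrite mulr_ge0 // divr_ge0; lra.
  by apply: lerXn2r; rewrite ?nnegrE ?lcE.
have cv : (fun N : nat => C * (2^-1) ^+ N) @ \oo --> (0 : R).
  rewrite -(mulr0 C); apply: cvgM; first exact: cvg_cst.
  by apply: cvg_expr; rewrite ger0_norm ?invf_lt1 ?ltr1n.
move: qk1; rewrite -cabs_gt0 => qk1.
move/cvgrPdist_lt : cv => /(_ _ qk1)[N _ /(_ N (leqnn N))].
rewrite sub0r normrN => lt1.
by have := lt_le_trans lt1 (key N); rewrite ltNge ler_norm.
Qed.

End zeros.

(** * Transforms on horizontal lines *)

Section strip_transform.
Variable R : realType.
Local Notation mu := (@lebesgue_measure R).
Implicit Types (q : R -> CC R) (k : CC R) (B : R).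

Definition ln_ (y u : R) : CC R := CofR u + CI * CofR y.

Lemma Re_ln y u : ReC (ln_ y u) = u. Proof. by rewrite /ln_ !CE; ring. Qed.
Lemma Im_ln y u : ImC (ln_ y u) = y. Proof. by rewrite /ln_ !CE; ring. Qed.
Lemma lnE k : k = ln_ (ImC k) (ReC k).
Proof. by apply: CC_ext; rewrite ?Re_ln ?Im_ln. Qed.

(** Almost everywhere continuity gives this by dominated convergence along a sequence of bad
    translations tending to 0, with no approximation by smooth functions. *)
Lemma translation_L1 B q : bcs B q -> {ae mu, forall s, ccont q s} ->
  forall e, 0 < e -> exists2 r, 0 < r &
    forall t, `|t| <= r -> \int[mu]_s cabs (q s - q (1 * s + t)) <= e.
Proof.
move=> bq cq e e0; have [B0 mq [M qM] q0] := bq; apply: contrapT => nE.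
have M0 : 0 <= M by apply: le_trans (qM 0); exact: cabs_ge0.
have /choice[t tP] : forall n : nat, exists t, `|t| <= n.+1%:R^-1 /\
    e < \int[mu]_s cabs (q s - q (1 * s + t)).
  move=> n; apply: contrapT => nt; apply: nE; exists n.+1%:R^-1; first by rewrite invr_gt0.
  by move=> t tn; rewrite leNgt; apply/negP => lt; apply: nt; exists t.
have t_cvg : t @ \oo --> (0 : R).
  apply/cvgrPdist_le => d d0; have cv := @cvg_harmonic R.
  move/cvgrPdist_le : cv => /(_ d d0); apply: filterS => n.
  rewrite !sub0r !normrN; apply: le_trans; rewrite [leRHS]ger0_norm ?invr_ge0 //.
  by have [] := tP n.
have iq := bcs_cintg bq.
have it n : cintg (fun s => q (1 * s + t n)) by apply: cintg_affine => //; exact: oner_neq0.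
(* All translations satisfy |t n| <= 1, so both q and its translates vanish outside [-1, B + 1]. *)
have ab : -1 <= B + 1 by lra.
have [iI _] := rint_cst_itv (M + M) ab.
have [] := @rdct R (fun n s => cabs (q s - q (1 * s + t n))) (fun=> 0)
   (fun s => (M + M) * \1_`[-1, B + 1]%classic s) _ _ iI.
- by move=> n; apply: cmeas_cabs; apply: cmeasB => //; exact: cintg_meas.
- exact: measurable_cst.
- apply: (@filterS _ _ (ae_filter_ringOfSetsType mu)) cq => s cs.
  have cv : (fun n => 1 * s + t n) @ \oo --> s.
    rewrite mul1r -[X in _ --> X]addr0; apply: cvgD => //; exact: cvg_cst.
  have : ccvg (fun n => q (1 * s + t n)) (q s).
    case: cs => c1 c2; apply/ccvgP; split; first exact: (cvg_comp _ _ cv c1).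
    exact: (cvg_comp _ _ cv c2).
  by rewrite /ccvg; under eq_fun do rewrite cabsC.
- move=> n s; rewrite ger0_norm ?cabs_ge0 // indicE.
  case: (boolP (s \in `[-1, B + 1])) => sB.
    rewrite mem_set // mulr1; apply: le_trans (cabsB _ _) _; exact: lerD.
  rewrite memNset ?mulr0; last exact/negP.
  have [tn _] := tP n.
  have {}tn : `|t n| <= 1 by apply: le_trans tn _; rewrite invf_le1 // ler1n.
  move: tn; rewrite ler_norml => /andP[t1 t2].
  rewrite q0; last first.
    by apply: contra sB; rewrite !in_itv /= => /andP[h1 h2]; apply/andP; split; lra.
  rewrite q0 ?subrr ?cabs0 //.
  by apply: contra sB; rewrite !in_itv /= mul1r => /andP[h1 h2]; apply/andP; split; lra.
move=> _ cv.
have I0 : \int[mu]_x (0 : R) = 0 by rewrite /Rintegral integral0.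
rewrite I0 in cv.
move/cvgrPdist_lt : cv => /(_ e e0)[N _ /(_ N (leqnn N))].
rewrite sub0r normrN ger0_norm; last by apply: rint_ge0 => s; exact: cabs_ge0.
by have [_ lt1] := tP N; rewrite ltNge (ltW lt1).
Qed.

(** Translating by t = pi / u multiplies the exponential by - exp (- y t). Hence (1 + exp (y t))
    times the transform is the transform of q - q (. + t), which is small by [translation_L1],
    uniformly for |y| <= Y; the factor 1 + exp (y t) >= 1 may be dropped. *)
Theorem riemann_lebesgue B q (Y e : R) : bcs B q -> {ae mu, forall s, ccont q s} ->
  0 <= Y -> 0 < e -> exists2 L, 0 < L &
    forall u y, L <= `|u| -> `|y| <= Y -> cabs (ft q (ln_ y u)) <= e.
Proof.
move=> bq cq Y0 e0; have [B0 mq [M qM] q0] := bq.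
(* Bounds |exp (i k s)| = exp (- y s) for |s| <= B + 1, an interval that contains the supports of q
   and of its translates by |t| <= 1. *)
pose K := expR (Y * (B + 1)); have K0 : 0 < K by exact: expR_gt0.
have [|r r0 rP] := translation_L1 bq cq (e := e / K); first by rewrite divr_gt0.
have pi0 := @pi_gt0 R.
exists (pi / Num.min r 1); first by rewrite divr_gt0 // lt_min r0 ltr01.
move=> u y uL yY.
have m0 : 0 < Num.min r 1 by rewrite lt_min r0 ltr01.
have u0 : 0 < `|u| by apply: lt_le_trans uL; rewrite divr_gt0.
have u1 : u != 0 by rewrite -normr_gt0.
pose t := pi / u.
have tm : `|t| <= Num.min r 1.
  rewrite /t normrM normfV (gtr0_norm pi0) ler_pdivrMr // mulrC -ler_pdivrMr //.
move: (tm); rewrite le_min => /andP[tr t1].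
set k := ln_ y u.
have ig := bcs_cintg (bcs_cexp (CI * k) bq).
have N1 := oner_neq0 R.
have E0 s : q (1 * s + t) * cexp (CI * k * CofR (1 * s + t)) =
    cexp (CI * k * CofR t) * (q (1 * s + t) * cexp (CI * k * CofR s)).
  have -> : CI * k * CofR (1 * s + t) = CI * k * CofR t + CI * k * CofR s.
    by rewrite mul1r CofRD; ring.
  by rewrite cexpD; ring.
have it : cintg (fun s => q (1 * s + t) * cexp (CI * k * CofR s)).
  have := cintgZ (cexp (- (CI * k * CofR t))) (cintg_affine t N1 ig).
  have -> : (fun s => cexp (- (CI * k * CofR t)) * (q (1 * s + t) * cexp (CI * k * CofR (1 * s + t)))) =
     (fun s => q (1 * s + t) * cexp (CI * k * CofR s)).
    by apply/funext => s; rewrite E0 mulrA -cexpD addNr cexp0 mul1r.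
  by [].
have E1 : ft q k = cexp (CI * k * CofR t) * cint (fun s => q (1 * s + t) * cexp (CI * k * CofR s)).
  rewrite [LHS](cint_affine t N1 ig) normr1 CofR1 mul1r -(cintZ _ it).
  by congr cint; apply/funext => s; exact: E0.
have ek : cexp (CI * k * CofR t) = - CofR (expR (- (y * t))).
  have -> : CI * k * CofR t = CI * CofR pi + CofR (- (y * t)).
    have uu : CofR u * (CofR pi / CofR u) = CofR pi.
      by rewrite mulrCA mulfV ?mulr1 // CofR_eq0.
    rewrite /k /ln_ /t CofRN !CofRM CofRV.
    transitivity (CI * (CofR u * (CofR pi / CofR u)) + CI * CI * (CofR y * (CofR pi / CofR u))); first by ring.
    by rewrite uu CI2 mulN1r.
  rewrite cexpD cexp_ofR.
  have -> : cexp (CI * CofR pi) = - 1 :> CC R.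
    apply: CC_ext; rewrite !(Re_cexp, Im_cexp, CE) !(mul0r, mulr0, subr0, mul1r, addr0, add0r) expR0 ?cospi ?sinpi; ring.
  by rewrite mulN1r.
rewrite ek in E1.
have E2 : ft q k * (1 + CofR (expR (y * t))) =
    cint (fun s => (q s - q (1 * s + t)) * cexp (CI * k * CofR s)).
  have -> : (fun s => (q s - q (1 * s + t)) * cexp (CI * k * CofR s)) =
     (fun s => q s * cexp (CI * k * CofR s) - q (1 * s + t) * cexp (CI * k * CofR s)).
    by apply/funext => s; rewrite mulrBl.
  rewrite (cintB ig it) -/(ft q k) mulrDr mulr1; congr (_ + _).
  rewrite E1 mulrAC mulNr -CofRM -expRD addrC subrr expR0 CofR1 mulN1r.
  by [].
have ge1 : 1 <= cabs (1 + CofR (expR (y * t))).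
  rewrite -CofR1 -CofRD cabs_ofR ger0_norm ?addr_ge0 ?expR_ge0 //.
  by rewrite lerDl expR_ge0.
apply: le_trans (_ : cabs (ft q k * (1 + CofR (expR (y * t)))) <= _).
  by rewrite cabsM; apply: ler_peMr => //; exact: cabs_ge0.
rewrite E2 {E1 E2}.
have iqt : cintg (fun s => q (1 * s + t)) by apply: cintg_affine => //; exact: bcs_cintg bq.
have id := cintgB (bcs_cintg bq) iqt.
apply: le_trans (cabs_cint_le (G := fun s => K * cabs (q s - q (1 * s + t))) _ _ _) _.
- by apply: cmeasM; [exact: cintg_meas|exact: cmeas_cexpZ].
- exact/rintgZ/cintg_cabs.
- move=> s; rewrite cabsM mulrC; case: (boolP (s \in `[- (B + 1), B + 1])) => sB.
    apply: ler_wpM2r; first exact: cabs_ge0.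
    rewrite cabs_cexp /K ler_expR.
    have -> : ReC (CI * k * CofR s) = - (y * s) by rewrite /k /ln_ !CE; ring.
    apply: le_trans (ler_norm _) _; rewrite normrN normrM; apply: ler_pM => //.
    by rewrite ler_norml; move: sB; rewrite in_itv.
  move: t1; rewrite ler_norml => /andP[t1 t2].
  rewrite q0; last first.
    by apply: contra sB; rewrite !in_itv /= => /andP[h1 h2]; apply/andP; split; lra.
  rewrite q0 ?subrr ?cabs0 ?mulr0 //.
  by apply: contra sB; rewrite !in_itv /= mul1r => /andP[h1 h2]; apply/andP; split; lra.
rewrite rintZ; last exact: cintg_cabs.
by rewrite mulrC -ler_pdivlMr //; exact: rP.
Qed.

(** A horizontal line becomes the real axis at the price of the weight exp (- y s), which preserves
    [bcs]; the integrability and inversion statements for lines are reduced to the real axis in this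
    way. *)
Lemma ft_line q y u :
  ft q (ln_ y u) = ft (fun s => q s * cexp (CI * (CI * CofR y) * CofR s)) (CofR u).
Proof. exact: ft_shift. Qed.

Lemma ft_line_mul_cintg B1 B2 q1 q2 y : bcs B1 q1 -> bcs B2 q2 ->
  cintg (fun u => ft q1 (ln_ y u) * ft q2 (ln_ y u)).
Proof.
move=> b1 b2; under eq_fun do rewrite !ft_line.
have c1 := bcs_cexp (CI * (CI * CofR y)) b1; have c2 := bcs_cexp (CI * (CI * CofR y)) b2.
have [_ _ [M1 q1M] _] := c1; have [_ _ [M2 q2M] _] := c2.
exact: (ft_mul_cintg (bcs_cintg c1) q1M (bcs_cintg c2) q2M).
Qed.

Lemma ft_line_inversion B q (y x : R) : bcs B q -> ccont q x ->
  cintg (fun u => ft q (ln_ y u)) ->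
  cint (fun u => ft q (ln_ y u) * cexp (- (CI * ln_ y u * CofR x))) =
  CofR (2 * pi) * q x.
Proof.
move=> bq cq; under eq_fun do rewrite ft_line; move=> ih.
have c1 := bcs_cexp (CI * (CI * CofR y)) bq; have [_ _ [M qM] _] := c1.
have cq' : ccont (fun s => q s * cexp (CI * (CI * CofR y) * CofR s)) x.
  by apply: ccontM => //; exact: ccont_cexp.
have := fourier_inversion (bcs_cintg c1) qM cq' ih.
move/(congr1 ( *%R (cexp (- (CI * (CI * CofR y) * CofR x))))).
rewrite -cintZ; last first.
  by apply: cintg_mul_unit ih _ _; [exact: cmeas_kernel|move=> u; rewrite cabs_cexp_imag].
have -> : cexp (- (CI * (CI * CofR y) * CofR x)) *
    (CofR (2 * pi) * (q x * cexp (CI * (CI * CofR y) * CofR x))) = CofR (2 * pi) * q x.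
  set A := CI * (CI * CofR y) * CofR x.
  have ee : cexp (- A) * cexp A = 1 by rewrite -cexpD addNr cexp0.
  transitivity (CofR (2 * pi) * q x * (cexp (- A) * cexp A)); first by ring.
  by rewrite ee mulr1.
move=> <-; congr cint; apply/funext => u; rewrite ft_line.
have -> : - (CI * ln_ y u * CofR x) = - (CI * (CI * CofR y) * CofR x) + - (CI * CofR u * CofR x).
  by rewrite /ln_; ring.
by rewrite cexpD; ring.
Qed.

Lemma ccont_ft_line B q y u : bcs B q -> ccont (fun u => ft q (ln_ y u)) u.
Proof.
move=> bq; have dq := ft_is_derive (ln_ y u) bq.
have e : ln_ y u = CI * CofR y + CofR u * 1 by rewrite /ln_ mulr1 addrC.
rewrite e in dq.
have -> : (fun u => ft q (ln_ y u)) = (fun s => ft q (CI * CofR y + CofR s * 1)).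
  by apply/funext => v; congr (ft q _); rewrite /ln_; ring.
exact: cder_ccont (is_cderive_line dq).
Qed.

Lemma cmeas_ft_line B q y : bcs B q -> cmeas (fun u => ft q (ln_ y u)).
Proof. by move=> bq; apply: ccont_meas => u; exact: ccont_ft_line bq. Qed.

End strip_transform.

(** * Inverse transforms of simple poles *)

Section poles.
Variable R : realType.
Local Notation mu := (@lebesgue_measure R).

(** The exponential exp (- i z s) is kept on the half-line where it decays, with the sign that makes
    the transform 1 / (u - z). On x > 0 it is therefore nonzero exactly for poles below the real
    axis: this plays the role of the residue theorem. *)
Definition pole_density (z : CC R) : R -> CC R :=
  if ImC z < 0 then fun s => - CI * cind `]0, +oo[%classic (fun s => cexp (- (CI * z) * CofR s)) s
  else fun s => CI * cind `]-oo, 0[%classic (fun s => cexp (- (CI * z) * CofR s)) s.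

Lemma Re_NCIM (z : CC R) : ReC (- (CI * z)) = ImC z.
Proof. by rewrite !CE; ring. Qed.

Lemma ReIM (u : R) (z : CC R) : ReC (CI * (CofR u - z)) = ImC z.
Proof. by rewrite !CE; ring. Qed.

Lemma cabs_pole_density z s : cabs (pole_density z s) <= 1.
Proof.
rewrite /pole_density; case: ifP => z0.
  rewrite cabsM cabsN cabsI mul1r; have [s0|s0] := ltP 0 s; last first.
    by rewrite cindF ?cabs0 //= in_itv /= andbT; apply/negP; rewrite -leNgt.
  rewrite cindT /= ?in_itv /= ?andbT // cabs_cexp ReCM Re_NCIM ReC_ofR ImC_ofR mulr0 subr0.
  by rewrite -expR0 ler_expR mulr_le0_ge0 // ltW.
rewrite cabsM cabsI mul1r; have [s0|s0] := ltP s 0; last first.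
  by rewrite cindF ?cabs0 //= in_itv /=; apply/negP; rewrite -leNgt.
rewrite cindT /= ?in_itv /= // cabs_cexp ReCM Re_NCIM ReC_ofR ImC_ofR mulr0 subr0.
by rewrite -expR0 ler_expR mulr_ge0_le0 // ?(ltW s0) // leNgt z0.
Qed.

Lemma pole_density_cintg z : ImC z != 0 -> cintg (pole_density z).
Proof.
rewrite /pole_density; case: ifP => z0 zn; apply: cintgZ.
  by have [] // := @cint_cexp_pos R (- (CI * z)); rewrite Re_NCIM.
by have [] // := @cint_cexp_neg R (- (CI * z)); rewrite Re_NCIM lt_def zn /= leNgt z0.
Qed.

Lemma ft_pole_density z (u : R) : ImC z != 0 ->
  ft (pole_density z) (CofR u) = (CofR u - z)^-1.
Proof.
move=> zn; rewrite /ft /pole_density.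
have uz : CofR u - z != 0.
  by apply/eqP => e; move: zn; have := congr1 (@ImC R) e; rewrite !CE add0r => /eqP;
     rewrite oppr_eq0 => ->.
have E s : cexp (- (CI * z) * CofR s) * cexp (CI * CofR u * CofR s) = cexp (CI * (CofR u - z) * CofR s).
  by rewrite -cexpD; congr cexp; ring.
case: ifP => z0.
  have [|i e] := @cint_cexp_pos R (CI * (CofR u - z)); first by rewrite ReIM.
  transitivity (cint (fun s => - CI * cind `]0, +oo[%classic (fun s => cexp (CI * (CofR u - z) * CofR s)) s)).
    by congr cint; apply/funext => s; rewrite -[LHS]mulrA; congr (_ * _); rewrite /cind -mulrA E.
  rewrite cintZ // e invfM mulrNN mulrA mulfV ?mul1r //; exact: CI_neq0.
have [|i e] := @cint_cexp_neg R (CI * (CofR u - z)).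
  by rewrite ReIM lt_def zn /= leNgt z0.
transitivity (cint (fun s => CI * cind `]-oo, 0[%classic (fun s => cexp (CI * (CofR u - z) * CofR s)) s)).
  by congr cint; apply/funext => s; rewrite -[LHS]mulrA; congr (_ * _); rewrite /cind -mulrA E.
rewrite cintZ // e invfM mulrA mulfV ?mul1r //; exact: CI_neq0.
Qed.

Lemma ccont_near (F G : R -> CC R) (x : R) : (\forall t \near x, F t = G t) ->
  ccont G x -> ccont F x.
Proof.
move=> FG [g1 g2]; have FGx := nbhs_singleton FG; rewrite /ccont FGx; split.
  apply: cvg_trans g1; apply: near_eq_cvg.
  by apply: filterS FG => t ->.
apply: cvg_trans g2; apply: near_eq_cvg.
by apply: filterS FG => t ->.
Qed.

Lemma pole_densityE z (x : R) : 0 < x ->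
  pole_density z x = if ImC z < 0 then - CI * cexp (- (CI * z * CofR x)) else 0.
Proof.
move=> x0; rewrite /pole_density; case: ifP => z0.
  by rewrite cindT /= ?in_itv /= ?andbT // (mulNr (CI * z)).
by rewrite cindF ?mulr0 //= in_itv /=; apply/negP; rewrite -leNgt ltW.
Qed.

Lemma ccont_pole_density z (x : R) : 0 < x -> ccont (pole_density z) x.
Proof.
move=> x0.
apply: (@ccont_near _ (fun x => if ImC z < 0 then - CI * cexp (- (CI * z) * CofR x) else 0)).
  near=> t; have t0 : 0 < t by near: t; exact: lt_nbhsr.
  by rewrite pole_densityE // (mulNr (CI * z)).
case: (ImC z < 0); last exact: ccont_cst.
by apply: ccontM; [exact: ccont_cst|exact: ccont_cexp].
Unshelve. all: by end_near. Qed.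

Lemma cabs_pole_sq (z : CC R) (u : R) :
  cabs (CofR u - z) ^+ 2 = `|ImC z| ^+ 2 + (u - ReC z) ^+ 2.
Proof. by rewrite cabs_sq !CE add0r sqrrN addrC real_normK ?num_real. Qed.

Lemma rintg_pole_sq (z : CC R) : ImC z != 0 ->
  rintg (fun u : R => cabs ((CofR u - z)^-1) ^+ 2).
Proof.
move=> zn; have z0 : 0 < `|ImC z| by rewrite normr_gt0.
have := rintgZ (2 * `|ImC z|)^-1 (rintg_poisson (ReC z) z0).
congr rintg; apply/funext => u.
rewrite cabsV exprVn cabs_pole_sq.
have h : `|ImC z| ^+ 2 + (u - ReC z) ^+ 2 != 0.
  by rewrite gt_eqF // ltr_pwDl ?exprn_gt0 // sqr_ge0.
by field; rewrite h gt_eqF.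
Qed.

Lemma CofR_sub_neq0 (z : CC R) (u : R) : ImC z != 0 -> CofR u - z != 0.
Proof.
move=> zn; apply/eqP => e; move: zn; have := congr1 (@ImC R) e; rewrite !CE add0r => /eqP.
by rewrite oppr_eq0 => ->.
Qed.

Lemma cmeas_pole (z : CC R) : ImC z != 0 -> cmeas (fun u => (CofR u - z)^-1).
Proof.
move=> zn; have := cmeas_ft_real (pole_density_cintg zn).
by congr cmeas; apply/funext => u; exact: ft_pole_density.
Qed.

(** The difference of the poles is (z - w) times a product of two square integrable functions, so
    inversion applies at x > 0, where both densities are continuous; that of w vanishes there. *)
Lemma pole_inversion (z w : CC R) (x : R) : 0 < x -> ImC z != 0 -> 0 < ImC w ->
  cintg (fun u => (CofR u - z)^-1 - (CofR u - w)^-1) /\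
  cint (fun u => ((CofR u - z)^-1 - (CofR u - w)^-1) * cexp (- (CI * CofR u * CofR x))) =
  if ImC z < 0 then - (CofR (2 * pi) * CI * cexp (- (CI * z * CofR x))) else 0.
Proof.
move=> x0 zn w0; have wn : ImC w != 0 by rewrite gt_eqF.
have ip : cintg (fun s => pole_density z s - pole_density w s).
  by apply: cintgB; exact: pole_density_cintg.
have ftE u : ft (fun s => pole_density z s - pole_density w s) (CofR u) =
    (CofR u - z)^-1 - (CofR u - w)^-1.
  rewrite -!ft_pole_density // /ft -cintB; first last.
  - apply: cintg_mul_unit; [exact: pole_density_cintg|exact: cmeas_cexpZ|].
    by move=> s; rewrite cabs_cexp_real.
  - apply: cintg_mul_unit; [exact: pole_density_cintg|exact: cmeas_cexpZ|].
    by move=> s; rewrite cabs_cexp_real.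
  by congr cint; apply/funext => s; rewrite mulrBl.
have ii : cintg (fun u => (CofR u - z)^-1 - (CofR u - w)^-1).
  apply: cintg_dom (rintgZ (cabs (z - w)) (rintgD (rintg_pole_sq zn) (rintg_pole_sq wn))) _.
    by apply: cmeasB; exact: cmeas_pole.
  move=> u; have uz := CofR_sub_neq0 u zn; have uw := CofR_sub_neq0 u wn.
  have -> : (CofR u - z)^-1 - (CofR u - w)^-1 = (z - w) * ((CofR u - z)^-1 * (CofR u - w)^-1).
    by field; rewrite uz uw.
  rewrite cabsM; apply: ler_wpM2l; first exact: cabs_ge0.
  rewrite cabsM.
  have := cabs_ge0 ((CofR u - z)^-1); have := cabs_ge0 ((CofR u - w)^-1).
  move: (cabs _) (cabs _) => p r p0 r0; have := sqr_ge0 (p - r); nra.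
split => //.
have b2 s : cabs (pole_density z s - pole_density w s) <= 1 + 1.
  apply: le_trans (cabsB _ _) _.
  by apply: lerD; exact: cabs_pole_density.
have c2 : ccont (fun s => pole_density z s - pole_density w s) x.
  have [z1 z2] := ccont_pole_density z x0; have [w1 w2] := ccont_pole_density w x0.
  split; rewrite ?(ReCD, ReCN, ImCD, ImCN).
    by under eq_fun do rewrite ReCD ReCN; exact: cvgB.
  by under eq_fun do rewrite ImCD ImCN; exact: cvgB.
have ftE' : (fun u => ft (fun s => pole_density z s - pole_density w s) (CofR u)) =
    (fun u => (CofR u - z)^-1 - (CofR u - w)^-1) by apply/funext.
have := fourier_inversion ip b2 c2; rewrite ftE' => /(_ ii) F.
transitivity (CofR (2 * pi) * (pole_density z x - pole_density w x)).
  by rewrite -F; congr cint; apply/funext => u; rewrite ftE.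
rewrite !pole_densityE // [ImC w < 0]ltNge (ltW w0) /= subr0.
by case: ifP => _; [ring|rewrite mulr0].
Qed.

End poles.

(** * Moving a horizontal line of integration *)

Section contour.
Variable R : realType.
Local Notation mu := (@lebesgue_measure R).

(** The mean value theorem is applied to the real and imaginary parts separately, with possibly
    different intermediate points; hence N + N. *)
Lemma cder_lip (F D : R -> CC R) (a b N : R) : a <= b ->
  (forall y, y \in `[a, b] -> cder F y (D y)) ->
  (forall y, y \in `[a, b] -> cabs (D y) <= N) ->
  cabs (F b - F a) <= (N + N) * (b - a).
Proof.
move=> ab dF DN.
have real_mvt (p : CC R -> R) :
    (forall y, y \in `[a, b] -> is_derive y (1 : R) (fun t => p (F t)) (p (D y))) ->
    (forall z, `|p z| <= cabs z) -> `|p (F b) - p (F a)| <= N * (b - a).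
  move=> dp pz.
  have h1 y : y \in `]a, b[ -> is_derive y (1 : R) (fun t => p (F t)) (p (D y)).
    by move=> yab; apply: dp; exact: subset_itv_oo_cc.
  have h2 : {within `[a, b], continuous (fun t => p (F t))}.
    apply: continuous_in_subspaceT => y /set_mem yab; have [d _] := dp y yab.
    exact: (differentiable_continuous (proj1 (derivable1_diffP _ _) d)).
  have [c cab ->] := MVT_segment ab h1 h2.
  rewrite normrM [`|b - a|]ger0_norm ?subr_ge0 //.
  apply: ler_wpM2r; first by rewrite subr_ge0.
  exact: le_trans (pz _) (DN _ cab).
apply: le_trans (cabs_le_ReIm _) _; rewrite !(ReCD, ReCN, ImCD, ImCN) mulrDl.
apply: lerD.
  by apply: (real_mvt (@ReC R)) => [y yab|z]; [have [] := dF y yab|exact: Re_le_cabs].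
by apply: (real_mvt (@ImC R)) => [y yab|z]; [have [] := dF y yab|exact: Im_le_cabs].
Qed.

Lemma cder_under_integral (F D : R -> R -> CC R) (u v a : R) (G : R -> R) :
  u < a < v -> (forall y, u < y < v -> cintg (F y)) ->
  (forall y x, u < y < v -> cder (fun y => F y x) y (D y x)) ->
  rintg G -> (forall x, 0 <= G x) ->
  (forall y x, u < y < v -> cabs (D y x) <= G x) ->
  cder (fun y => cint (F y)) a (cint (D a)).
Proof.
move=> auv iF dF iG G0 DG.
have real_under (p : CC R -> R) :
    (forall y, u < y < v -> rintg (fun x => p (F y x))) ->
    (forall y x, u < y < v -> is_derive y (1 : R) (fun y => p (F y x)) (p (D y x))) ->
    (forall z, `|p z| <= cabs z) ->
    is_derive a (1 : R) (fun y => \int[mu]_x p (F y x)) (\int[mu]_x p (D a x)).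
  move=> ip dp pz.
  have h1 : `]u, v[%classic a by rewrite /= in_itv.
  have h2 y : `]u, v[%classic y -> mu.-integrable setT (EFin \o (fun x => p (F y x))).
    by rewrite /= in_itv => /ip.
  have h3 y x : `]u, v[%classic y -> setT x -> derivable (fun y => p (F y x)) y 1.
    by rewrite /= in_itv /= => yI _; have [] := dp y x yI.
  have E y x : u < y < v -> partial1of2 (fun y x => p (F y x)) y x = p (D y x).
    by move=> yI; rewrite partial1of2E; have [_ ->] := dp y x yI.
  have h4 y x : `]u, v[%classic y -> setT x -> `|partial1of2 (fun y x => p (F y x)) y x| <= G x.
    rewrite /= in_itv /= => yI _; rewrite E //.
    exact: le_trans (pz _) (DG _ _ yI).
  split; first exact: (derivable_under_integral measurableT h1 h2 h3 G0 iG h4).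
  rewrite -derive1E (differentiation_under_integral measurableT h1 h2 h3 G0 iG h4).
  by apply: eq_Rintegral => x _; rewrite E.
split; rewrite ?Re_cint ?Im_cint.
  apply: (real_under (@ReC R)).
  - by move=> y yI; have [] := iF y yI.
  - by move=> y x yI; have [] := dF y x yI.
  - exact: Re_le_cabs.
apply: (real_under (@ImC R)).
- by move=> y yI; have [] := iF y yI.
- by move=> y x yI; have [] := dF y x yI.
- exact: Im_le_cabs.
Qed.

Variables (Phi Psi : CC R -> CC R) (y0 y1 : R).
Hypothesis y01 : y0 < y1.
Let strip_ (k : CC R) := y0 <= ImC k <= y1.
Hypothesis dPhi : forall k, strip_ k -> is_derive k (1 : CC R) Phi (Psi k).
Hypothesis cPsi : forall y u, y0 <= y <= y1 -> ccont (fun u => Psi (ln_ y u)) u.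
Hypothesis bPsi : forall T, exists N, forall u y, `|u| <= T -> y0 <= y <= y1 ->
  cabs (Psi (ln_ y u)) <= N.

Let J (T y : R) : CC R := cint (cind `[- T, T]%classic (fun u => Phi (ln_ y u))).

Let dPhi_u y u : y0 <= y <= y1 -> cder (fun u => Phi (ln_ y u)) u (Psi (ln_ y u)).
Proof.
move=> yI; have e : ln_ y u = CI * CofR y + CofR u * 1 by rewrite /ln_; ring.
have := dPhi (k := ln_ y u); rewrite /strip_ Im_ln => /(_ yI); rewrite [in X in is_derive X]e => dP.
have -> : (fun u => Phi (ln_ y u)) = (fun s => Phi (CI * CofR y + CofR s * 1)).
  by apply/funext => v; congr Phi; rewrite /ln_; ring.
by have := is_cderive_line dP; rewrite mul1r.
Qed.

Let dPhi_y y u : y0 <= y <= y1 -> cder (fun y => Phi (ln_ y u)) y (CI * Psi (ln_ y u)).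
Proof.
move=> yI; have e : ln_ y u = CofR u + CofR y * CI by rewrite /ln_; ring.
have := dPhi (k := ln_ y u); rewrite /strip_ Im_ln => /(_ yI); rewrite [in X in is_derive X]e => dP.
have -> : (fun y => Phi (ln_ y u)) = (fun s => Phi (CofR u + CofR s * CI)).
  by apply/funext => v; congr Phi; rewrite /ln_; ring.
exact: is_cderive_line dP.
Qed.

Let cPhi y u : y0 <= y <= y1 -> ccont (fun u => Phi (ln_ y u)) u.
Proof. by move=> yI; exact: cder_ccont (dPhi_u u yI). Qed.

Let mPhi y : y0 <= y <= y1 -> cmeas (fun u => Phi (ln_ y u)).
Proof. by move=> yI; apply: ccont_meas => u; exact: cPhi. Qed.

Let J_int T y : y0 <= y <= y1 -> 0 <= T -> cintg (cind `[- T, T]%classic (fun u => Phi (ln_ y u))).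
Proof.
move=> yI T0; have nT : - T <= T by lra.
have [c cP] : exists N, forall u, u \in `[- T, T] -> cabs (Phi (ln_ y u)) <= N.
  have [N NP] := bPsi T.
  exists (cabs (Phi (ln_ y (- T))) + (N + N) * (T - - T)) => u; rewrite in_itv /= => /andP[u1 u2].
  have := @cder_lip (fun u => Phi (ln_ y u)) (fun u => Psi (ln_ y u)) (- T) u N u1
    (fun v _ => dPhi_u v yI).
  have N0 : 0 <= N.
    by apply: le_trans (NP T y _ yI); [exact: cabs_ge0|rewrite ger0_norm].
  have h : forall v, v \in `[- T, u] -> cabs (Psi (ln_ y v)) <= N.
    move=> v; rewrite in_itv /= => /andP[v1 v2]; apply: NP => //.
    by rewrite ler_norml v1 (le_trans v2).
  move=> /(_ h) le1; rewrite -lerBlDl; apply: le_trans (lerB_cabs _ _) _.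
  apply: le_trans le1 _; apply: ler_wpM2l; first by rewrite addr_ge0.
  by rewrite lerB.
have [] // := @cintg_bounded_itv R (- T) T c (cind `[- T, T]%classic (fun u => Phi (ln_ y u))) nT.
- by apply: cmeas_cind => //; exact: mPhi.
- by move=> u uT; apply: le_trans (cabs_cind_le _ _ _) _; exact: cP.
- by move=> u uT; rewrite cindF //; apply/negP.
Qed.

Let cder_cind (A : set R) (F : R -> R -> CC R) D y u :
  cder (fun y => F y u) y D -> cder (fun y => cind A (F y) u) y (CofR (\1_A u) * D).
Proof.
move=> [d1 d2]; rewrite /cind; split.
  under eq_fun do rewrite ReCM ReC_ofR ImC_ofR mul0r subr0.
  by rewrite ReCM ReC_ofR ImC_ofR mul0r subr0; apply: is_deriveZ.
under eq_fun do rewrite ImCM ReC_ofR ImC_ofR mul0r addr0.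
by rewrite ImCM ReC_ofR ImC_ofR mul0r addr0; apply: is_deriveZ.
Qed.

(** The vertical derivative of [Phi] is i [Psi], and [Psi] is its horizontal derivative:
    differentiating under the integral and then integrating back horizontally leaves only the two
    end points. *)
Let J_der T y : y0 < y < y1 -> 0 <= T ->
  cder (J T) y (CI * (Phi (ln_ y T) - Phi (ln_ y (- T)))).
Proof.
move=> yI T0; have nT : - T <= T by lra.
have cl z : y0 < z < y1 -> y0 <= z <= y1 by move=> /andP[h1 h2]; rewrite !ltW.
have [N NP] := bPsi T.
have N0 : 0 <= N.
  by apply: le_trans (NP T y _ (cl _ yI)); [exact: cabs_ge0|rewrite ger0_norm].
have [iG _] := rint_cst_itv N nT.
have -> : CI * (Phi (ln_ y T) - Phi (ln_ y (- T))) =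
    cint (fun u => CofR (\1_`[- T, T]%classic u) * (CI * Psi (ln_ y u))).
  have <- := @cftc R (fun u => Psi (ln_ y u)) (fun u => Phi (ln_ y u)) (- T) T nT
    (fun u _ => dPhi_u u (cl _ yI)) (fun u _ => cPsi u (cl _ yI)).
  rewrite -cintZ; first by congr cint; apply/funext => u; rewrite /cind mulrCA.
  have [] // := @cintg_bounded_itv R (- T) T N (cind `[- T, T]%classic (fun u => Psi (ln_ y u))) nT.
  - apply: cmeas_cind => //; apply: ccont_meas => u; exact: cPsi (cl _ yI).
  - move=> u uT; apply: le_trans (cabs_cind_le _ _ _) _; apply: NP (cl _ yI).
    by move: uT; rewrite in_itv /= ler_norml.
  - by move=> u uT; rewrite cindF //; apply/negP.
apply: (@cder_under_integral (fun y => cind `[- T, T]%classic (fun u => Phi (ln_ y u)))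
   (fun y u => CofR (\1_`[- T, T]%classic u) * (CI * Psi (ln_ y u))) y0 y1 y _ yI _ _ iG).
- by move=> z zI; apply: J_int (cl _ zI) T0.
- by move=> z u zI; apply: (@cder_cind _ (fun y u => Phi (ln_ y u))); exact: dPhi_y (cl _ zI).
- by move=> u; rewrite mulr_ge0 // indicE.
- move=> z u zI; rewrite cabsM cabs_ofR indicE.
  case: (boolP (u \in `[- T, T])) => uT.
    rewrite mem_set // normr1 mul1r mulr1 cabsM cabsI mul1r; apply: NP (cl _ zI).
    by move: uT; rewrite in_itv /= ler_norml.
  by rewrite memNset ?normr0 ?mul0r ?mulr0 //; apply/negP.
Qed.

(** [J_der] is confined to the open interval of heights; this crude bound, with K depending on T,
    carries the comparison up to the two boundary lines. *)
Let J_lip T : 0 <= T -> exists2 K, 0 <= K & forall s t, y0 <= s -> s <= t -> t <= y1 ->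
  cabs (J T t - J T s) <= K * (t - s).
Proof.
move=> T0; have nT : - T <= T by lra.
have [N NP] := bPsi T.
have N0 : 0 <= N.
  by apply: le_trans (NP T y0 _ _); [exact: cabs_ge0|rewrite ger0_norm|rewrite lexx ltW].
exists ((N + N) * (T - - T)); first by rewrite mulr_ge0 ?addr_ge0 //; lra.
move=> s t s0 st t1; rewrite /J -cintB; last 2 first.
- by apply: J_int => //; rewrite (le_trans s0).
- by apply: J_int => //; rewrite s0 (le_trans st).
rewrite mulrAC; apply: cabs_cint_itv => //.
- by apply: cmeasB; apply: cmeas_cind => //; apply: mPhi; rewrite ?s0 ?t1 ?(le_trans s0) ?(le_trans st).
- move=> u uT; rewrite !cindT //.
  apply: (@cder_lip (fun y => Phi (ln_ y u)) (fun y => CI * Psi (ln_ y u))) => // y;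
    rewrite in_itv /= => /andP[h1 h2]; have yI : y0 <= y <= y1 by
      rewrite (le_trans s0 h1) (le_trans h2).
    exact: dPhi_y.
  rewrite cabsM cabsI mul1r; apply: NP => //.
  by move: uT; rewrite in_itv /= ler_norml.
- by move=> u uT; rewrite !cindF ?subrr //; apply/negP.
Qed.

Let J_small T e : 0 <= T -> (forall y, y0 <= y <= y1 ->
    cabs (Phi (ln_ y T)) <= e /\ cabs (Phi (ln_ y (- T))) <= e) ->
  cabs (J T y1 - J T y0) <= 4 * e * (y1 - y0).
Proof.
move=> T0 Pe; have [K K0 KP] := J_lip T0.
have e0 : 0 <= e.
  by have [|h _] := Pe y0; [rewrite lexx ltW|apply: le_trans h; exact: cabs_ge0].
apply/ler_addgt0Pr => d d0.
(* The first bound keeps [y0 + h, y1 - h] nonempty and interior; the second makes the two boundary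
   layers, K h each, cost at most d together. *)
pose h := Num.min ((y1 - y0) / 3) (d / (2 * (K + 1))).
have h0 : 0 < h by rewrite lt_min !divr_gt0 ?subr_gt0 // mulr_gt0 // ltr_wpDl.
have h1 : h <= (y1 - y0) / 3 by rewrite ge_min lexx.
have h2 : h * (2 * (K + 1)) <= d.
  by rewrite -ler_pdivlMr; [rewrite ge_min lexx orbT|rewrite mulr_gt0 // ltr_wpDl].
have y10 : 0 < y1 - y0 by rewrite subr_gt0.
have st : y0 + h <= y1 - h by lra.
have D1 : cabs (J T (y1 - h) - J T (y0 + h)) <= (2 * e + 2 * e) * (y1 - h - (y0 + h)).
  apply: (@cder_lip _ (fun y => CI * (Phi (ln_ y T) - Phi (ln_ y (- T))))) => // y;
    rewrite in_itv /= => /andP[z1 z2].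
    by apply: J_der => //; apply/andP; split; lra.
  rewrite cabsM cabsI mul1r; apply: le_trans (cabsB _ _) _.
  have [|p1 p2] := Pe y; first by apply/andP; split; lra.
  lra.
have D2 : cabs (J T y1 - J T (y1 - h)) <= K * (y1 - (y1 - h)) by apply: KP; lra.
have D3 : cabs (J T (y0 + h) - J T y0) <= K * (y0 + h - y0) by apply: KP; lra.
have -> : J T y1 - J T y0 = (J T y1 - J T (y1 - h)) +
   ((J T (y1 - h) - J T (y0 + h)) + (J T (y0 + h) - J T y0)) by ring.
apply: le_trans (cabsD _ _) _; apply: le_trans (lerD D2 (le_trans (cabsD _ _) (lerD D1 D3))) _.
have : 0 <= e * h by rewrite mulr_ge0 // ltW.
nra.
Qed.

(** Integrability is asked only of the two extreme lines. In between, decay uniform in y makes the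
    difference of the truncated integrals tend to 0. *)
Theorem contour_shift :
  (forall e, 0 < e -> exists L, forall u y, L <= `|u| -> y0 <= y <= y1 -> cabs (Phi (ln_ y u)) <= e) ->
  cintg (fun u => Phi (ln_ y0 u)) -> cintg (fun u => Phi (ln_ y1 u)) ->
  cint (fun u => Phi (ln_ y0 u)) = cint (fun u => Phi (ln_ y1 u)).
Proof.
move=> dec i0 i1.
have cv y : cintg (fun u => Phi (ln_ y u)) ->
    ccvg (fun n => J n%:R y) (cint (fun u => Phi (ln_ y u))).
  move=> iy; have my := cintg_meas iy.
  have [] // := @cdct R (fun n => cind `[- (n%:R : R), n%:R]%classic (fun u => Phi (ln_ y u)))
    (fun u => Phi (ln_ y u)) (fun u => cabs (Phi (ln_ y u))).
  - by move=> n; exact: cmeas_cind.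
  - exact: cintg_cabs.
  - apply: nearW => u; apply: ccvg_near; near=> n.
    rewrite cindT //= in_itv /= -ler_norml; near: n; exact: nbhs_infty_ger.
  - by move=> n u; exact: cabs_cind_le.
have cd : ccvg (fun n => J n%:R y1 - J n%:R y0) 0.
  apply/(cvgrPdist_le (F := \oo)) => e e0.
  have y10 : 0 < y1 - y0 by rewrite subr_gt0.
  have [|L LP] := dec (e / (4 * (y1 - y0))); first by rewrite divr_gt0 // mulr_gt0.
  near=> n; rewrite sub0r normrN subr0 ger0_norm ?cabs_ge0 //.
  have Ln : L <= `|n%:R : R| by rewrite normr_nat; near: n; exact: nbhs_infty_ger.
  apply: le_trans (J_small (e := e / (4 * (y1 - y0))) (ler0n _ n) _) _.
    by move=> y yI; split; apply: LP => //; rewrite normrN.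
  by rewrite le_eqVlt; apply/orP; left; apply/eqP; field; rewrite gt_eqF.
have := ccvgD (cv _ i0) cd; rewrite addr0.
have -> : (fun n => J n%:R y0 + (J n%:R y1 - J n%:R y0)) = (fun n => J n%:R y1).
  by apply/funext => n; rewrite addrC subrK.
by move=> /ccvg_unique; apply; exact: cv.
Unshelve. all: by end_near. Qed.

End contour.

(** * The density and its convolution powers *)

Section convolution.
Variable R : realType.
Local Notation mu := (@lebesgue_measure R).
Implicit Types (q : R -> CC R) (x : R).

Definition cconv q1 q2 x : CC R := cint (fun y => q1 y * q2 (x - y)).

Lemma measurable_subr : measurable_fun setT (fun p : R * R => p.1 - p.2).
Proof. by apply: measurable_funB; [exact: measurable_fst|exact: measurable_snd]. Qed.

Lemma cmeas_sub q : cmeas q -> cmeas (fun p : R * R => q (p.1 - p.2)).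
Proof. exact: cmeas_comp measurable_subr. Qed.

Lemma bcs_bound_pos B q : bcs B q -> exists2 M, 0 <= M & forall s, cabs (q s) <= M.
Proof.
by move=> [_ _ [M qM] _]; exists M => //; apply: le_trans (qM 0); exact: cabs_ge0.
Qed.

Lemma cconv_int (B1 B2 : R) q1 q2 : bcs B1 q1 -> bcs B2 q2 ->
  cmeas (cconv q1 q2) /\ cint (cconv q1 q2) = cint q1 * cint q2.
Proof.
move=> bq1 bq2; have [M1 M10 qM1] := bcs_bound_pos bq1.
have [M2 M20 qM2] := bcs_bound_pos bq2.
have [B10 m1 _ s1] := bq1; have [B20 m2 _ s2] := bq2.
pose g (p : R * R) := q1 p.2 * q2 (p.1 - p.2).
have mg : cmeas g.
  by apply: cmeasM (cmeas_sub m2); exact: cmeas_comp measurable_snd m1.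
have [iA _] := rint_cst_itv M2 (addr_ge0 B10 B20).
have [iB _] := rint_cst_itv M1 B10.
(* q2 (x - y) is not of product form, but the compact supports confine the integrand to a box, and
   this supplies the product bound that [cfubini] expects. *)
have gAB x y : cabs (g (x, y)) <= M2 * \1_`[0, B1 + B2]%classic x * (M1 * \1_`[0, B1]%classic y).
  have A0 (A : set R) z : 0 <= \1_A z :> R by rewrite indicE.
  rewrite /g cabsM /=; case: (boolP (y \in `[0, B1])) => yB; last first.
    by rewrite s1 // cabs0 mul0r !mulr_ge0.
  case: (boolP (x - y \in `[0, B2])) => xB; last first.
    by rewrite s2 // cabs0 mulr0 !mulr_ge0.
  move: (yB) (xB); rewrite !in_itv /= => /andP[y0 yB1] /andP[x0 xB2].
  rewrite !indicE !mem_set /= ?in_itv /= ?y0 ?yB1 //; last by apply/andP; split; lra.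
  by rewrite !mulr1 mulrC; apply: ler_pM; rewrite ?cabs_ge0.
have [i1 e1] := cfubini mg iA iB gAB.
split; first exact: cintg_meas i1.
transitivity (cint (fun y => cint q2 * q1 y)); last first.
  by clear e1; rewrite [RHS]mulrC; apply: cintZ; exact: bcs_cintg bq1.
transitivity (cint (fun y => cint (fun x => g (x, y)))); first exact: e1.
clear e1; congr cint; apply/funext => y.
have iq := bcs_cintg bq2.
have iqy : cintg (fun x => q2 (x - y)).
  have := cintg_affine (- y) (oner_neq0 R) iq.
  by under eq_fun do rewrite mul1r.
rewrite /g /= cintZ; last exact: iqy.
rewrite mulrC; congr (_ * _).
transitivity (CofR `|1 : R| * cint (fun x => q2 (1 * x - y))).
  by rewrite normr1 CofR1 [RHS]mul1r; congr cint; apply/funext => x; rewrite mul1r.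
exact/esym/(cint_affine (- y) (oner_neq0 R) iq).
Qed.

Lemma bcs_cconv B1 B2 q1 q2 : bcs B1 q1 -> bcs B2 q2 -> bcs (B1 + B2) (cconv q1 q2).
Proof.
move=> bq1 bq2; have [M1 M10 qM1] := bcs_bound_pos bq1.
have [M2 M20 qM2] := bcs_bound_pos bq2.
have [B10 m1 _ s1] := bq1; have [B20 m2 _ s2] := bq2.
split; first exact: addr_ge0.
- by have [] := cconv_int bq1 bq2.
- exists (M1 * M2 * (B1 - 0)) => x; apply: cabs_cint_itv => //.
  + apply: cmeasM => //; apply: cmeas_comp m2; apply: measurable_funB => //.
  + by move=> y _; rewrite cabsM; apply: ler_pM; rewrite ?cabs_ge0.
  + by move=> y /s1 ->; rewrite mul0r.
- move=> x xB; rewrite /cconv -[RHS](cint0 R); congr cint; apply/funext => y.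
  case: (boolP (y \in `[0, B1])) => yB; last by rewrite s1 // mul0r.
  rewrite (s2 (x - y)) ?mulr0 //; apply: contra xB.
  by move: yB; rewrite !in_itv /= => /andP[? ?] /andP[? ?]; apply/andP; split; lra.
Qed.

(** Since exp (i k x) = exp (i k y) exp (i k (x - y)), the weighted convolution is the convolution
    of the weighted functions, and [cconv_int] applies to these. *)
Lemma ft_cconv B1 B2 q1 q2 k : bcs B1 q1 -> bcs B2 q2 ->
  ft (cconv q1 q2) k = ft q1 k * ft q2 k.
Proof.
move=> bq1 bq2.
have [_ e] := cconv_int (bcs_cexp (CI * k) bq1) (bcs_cexp (CI * k) bq2).
rewrite /ft -[RHS]e; congr cint; apply/funext => x.
rewrite /cconv mulrC -cintZ; last first.
  apply: (@bcs_cintg R B1); have [M2 M20 qM2] := bcs_bound_pos bq2.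
  have [_ m2 _ _] := bq2.
  apply: (bcs_mul (N := M2) bq1) => //.
  by apply: cmeas_comp m2; apply: measurable_funB.
congr cint; apply/funext => y.
rewrite [RHS]mulrACA -cexpD mulrC; congr (_ * cexp _).
by rewrite CofRB; ring.
Qed.

(** Along a sequence tending to x, the integrand converges except for the finitely many y with x - y
    in s; dominated convergence ignores these, so jumps of q2 are smoothed out. *)
Lemma ccont_cconv B1 B2 q1 q2 (s : seq R) x : bcs B1 q1 -> bcs B2 q2 ->
  (forall p, p \notin s -> ccont q2 p) -> ccont (cconv q1 q2) x.
Proof.
move=> bq1 bq2 cq2.
have [M2 M20 qM2] := bcs_bound_pos bq2.
have [B10 m1 _ s1] := bq1; have [B20 m2 _ s2] := bq2.
have mq2 (z : R) : cmeas (fun y : R => q2 (z - y)).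
  by apply: cmeas_comp m2; apply: measurable_funB.
have seqc (u : nat -> R) : u n @[n --> \oo] --> x ->
    ccvg (fun n => cconv q1 q2 (u n)) (cconv q1 q2 x).
  move=> ux; have iG := rintgZ M2 (cintg_cabs (bcs_cintg bq1)).
  have [] := @cdct R (fun n y => q1 y * q2 (u n - y)) (fun y => q1 y * q2 (x - y))
    (fun y => M2 * cabs (q1 y)) _ _ iG; last by [].
  - by move=> n; exact: cmeasM.
  - exact: cmeasM.
  - apply: (@filterS _ _ (ae_filter_ringOfSetsType mu)) (@ae_neq R [seq x - p | p <- s]) => y ys.
    apply: ccvgM; first exact: ccvg_cst.
    have ns : x - y \notin s.
      by apply: contra ys => ys; apply/mapP; exists (x - y) => //; ring.
    have [c1 c2] := cq2 _ ns.
    have uy : u n - y @[n --> \oo] --> x - y by apply: cvgB => //; exact: cvg_cst.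
    by apply/ccvgP; split; [exact: (cvg_comp _ _ uy c1)|exact: (cvg_comp _ _ uy c2)].
  - by move=> n y; rewrite cabsM mulrC; apply: ler_wpM2r => //; exact: cabs_ge0.
split; apply/(@cvg_nbhsP _ R^o) => u ux; first exact: ((ccvgP _ _).1 (seqc u ux)).1.
exact: ((ccvgP _ _).1 (seqc u ux)).2.
Qed.

Lemma convolution_ofR (f g : R -> R) x :
  CofR (convolution f g x) = cconv (fun s => CofR (f s)) (fun s => CofR (g s)) x.
Proof.
rewrite /convolution /cconv -cint_ofR; congr cint; apply/funext => y.
by rewrite CofRM.
Qed.

End convolution.

(** * Transform of the density and of its convolution powers *)

Section density.
Variable R : realType.
Local Notation mu := (@lebesgue_measure R).
Variables (a b : R) (d : R -> R).
Hypothesis a_gt0 : 0 < a.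
Hypothesis d_density : is_density d.
Hypothesis d_supp : forall x, x \notin `[a, b] -> d x = 0.
Hypothesis d_cont : {within `[a, b], continuous d}.

Let dm : measurable_fun setT d. Proof. by case: d_density. Qed.
Let d0 x : 0 <= d x. Proof. by case: d_density. Qed.

Lemma density_rintg : rintg d.
Proof.
apply/integrableP; split; first exact/measurable_EFinP.
under eq_integral do rewrite /= ger0_norm //.
by case: d_density => _ _ ->; exact: ltry.
Qed.

Lemma density_int : \int[mu]_x d x = 1.
Proof. by rewrite /Rintegral; case: d_density => _ _ ->. Qed.

(** Otherwise d vanishes off the single point a and has integral 0. *)
Lemma density_lt : a < b.
Proof.
rewrite ltNge; apply/negP => ba.
have : cint (fun x => CofR (d x)) = 0.
  have [] // := @cint_ae R (fun=> 0) (fun x => CofR (d x)) (cintg0 R) (cmeas_ofR dm).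
    apply: (@filterS _ _ (ae_filter_ringOfSetsType mu)) (@ae_neq R [:: a]) => x.
    rewrite inE => xa; rewrite d_supp //.
    apply: contra xa; rewrite in_itv /= => /andP[ax xb].
    by rewrite eq_le ax (le_trans xb).
  by move=> _ <-; exact: cint0.
rewrite cint_ofR density_int => /(congr1 (@ReC R)); rewrite !CE.
by move/eqP; rewrite oner_eq0.
Qed.

Let ab := density_lt.
Definition cden (s : R) : CC R := CofR (d s).

Lemma density_bounded : exists M, forall s, d s <= M.
Proof.
have [c cab cmax] := EVT_max (ltW ab) d_cont.
exists (d c) => s; case: (boolP (s \in `[a, b])) => [|/d_supp ->]; first exact: cmax.
exact: d0.
Qed.

Lemma bcs_cden : bcs b cden.
Proof.
split.
- exact: ltW (lt_trans a_gt0 ab).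
- exact: cmeas_ofR.
- have [M dM] := density_bounded; exists M => s.
  by rewrite cabs_ofR ger0_norm.
- move=> s sb; rewrite /cden d_supp //; apply: contra sb; rewrite !in_itv /= => /andP[h1 h2].
  by rewrite h2 (le_trans (ltW a_gt0)).
Qed.

Lemma fourierE k : fourier a b d k = ft cden k.
Proof.
rewrite /fourier -cint_cind //; congr cint; apply/funext => s.
case: (boolP (s \in `[a, b])) => sab; first by rewrite cindT.
by rewrite cindF; [rewrite /cden d_supp // mul0r|exact/negP].
Qed.

Lemma ccont_cden x : x \notin [:: a; b] -> ccont cden x.
Proof.
rewrite !inE negb_or => /andP[xa xb].
suff cx : d @ x --> d x by split => //; exact: cvg_cst.
have [h|h] := boolP (x \in `]a, b[).
  move: d_cont; rewrite continuous_within_itvP // => -[+ _ _]; exact.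
have xn : x < a \/ b < x.
  move: h; rewrite in_itv /= negb_and -!leNgt => /orP[h|h]; [left|right].
    by rewrite lt_neqAle xa.
  by rewrite lt_neqAle eq_sym xb.
rewrite d_supp; last by rewrite in_itv /= negb_and -!ltNge; case: xn => ->; rewrite ?orbT.
apply: cvg_near_cst; case: xn => xn; near=> t.
  rewrite d_supp // in_itv /= negb_and -ltNge; apply/orP; left.
  by near: t; exact: lt_nbhsl.
rewrite d_supp // in_itv /= negb_and -!ltNge; apply/orP; right.
by near: t; exact: lt_nbhsr.
Unshelve. all: by end_near. Qed.

Lemma ae_ccont_cden : {ae mu, forall s, ccont cden s}.
Proof.
apply: (@filterS _ _ (ae_filter_ringOfSetsType mu)) (@ae_neq R [:: a; b]) => x.
exact: ccont_cden.
Qed.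

Lemma ft_cden0 : ft cden 0 = 1.
Proof.
rewrite /ft; under eq_fun do rewrite mulr0 mul0r cexp0 mulr1.
by rewrite cint_ofR density_int.
Qed.

(** On the support s >= a, hence |exp (i k s)| = exp (- s y) <= exp (- a y). For y > 0 this is below
    1, which sums the geometric series and excludes zeros from the upper half-plane. *)
Lemma cabs_ft_cden (y u : R) : 0 <= y -> cabs (ft cden (ln_ y u)) <= expR (- (a * y)).
Proof.
move=> y0.
have -> : expR (- (a * y)) = \int[mu]_s (expR (- (a * y)) * d s).
  by rewrite rintZ ?density_int ?mulr1 //; exact: density_rintg.
apply: cabs_cint_le.
- by apply: cmeasM; [exact: cmeas_ofR|exact: cmeas_cexpZ].
- exact/rintgZ/density_rintg.
- move=> s; rewrite cabsM cabs_ofR ger0_norm // mulrC.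
  case: (boolP (s \in `[a, b])) => sab; last by rewrite d_supp // !mulr0.
  apply: ler_wpM2r => //; rewrite cabs_cexp ler_expR.
  have -> : ReC (CI * ln_ y u * CofR s) = - (s * y) by rewrite /ln_ !CE; ring.
  rewrite lerN2; apply: ler_wpM2r => //.
  by move: sab; rewrite in_itv /= => /andP[].
Qed.

Lemma ft_cden_upper_neq1 k : 0 < ImC k -> ft cden k != 1.
Proof.
move=> k0; apply/eqP => e; have := cabs_ft_cden (ReC k) (ltW k0).
rewrite -lnE e cabs1 leNgt -expR0 ltr_expR oppr_lt0 mulr_gt0 //.
Qed.

Lemma sin_ltr (t : R) : 0 < t -> t < pi -> `|sin t| < t.
Proof.
move=> t0 tpi; rewrite ger0_norm; last by apply: sin_ge0_pi; rewrite !ltW.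
have h1 x : x \in `]0, t[ -> is_derive x (1 : R) sin (cos x) by move=> _; exact: is_derive_sin.
have h2 : {within `[0, t], continuous (@sin R)}.
  by apply: continuous_subspaceT => x; exact: continuous_sin.
have [c] := MVT t0 h1 h2; rewrite in_itv /= => /andP[c0 ct].
rewrite sin0 !subr0 => ->; rewrite gtr_pMl // -(@cos0 R) ltr_cos //.
  by rewrite in_itv /= lexx ltW // pi_gt0.
by rewrite in_itv /= !ltW // (lt_trans ct tpi).
Qed.

Lemma sin_diff (p t : R) : 0 < `|t| -> `|t| < pi ->
  `|sin (p + t) - sin (p - t)| < 2 * `|t|.
Proof.
move=> t0 tpi; rewrite sinD sinB.
have -> : sin p * cos t + cos p * sin t - (sin p * cos t - cos p * sin t) =
   2 * (cos p * sin t) by ring.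
rewrite normrM normr_nat ltr_pM2l // normrM.
apply: le_lt_trans (_ : `|sin t| < _).
  by rewrite ler_piMl // ler_norml cos_geN1 cos_le1.
have -> : `|sin t| = `|sin `|t| |.
  by have [h|h] := ger0P t; rewrite ?sinN ?normrN.
exact: sin_ltr.
Qed.

(** Strict positivity is read off the antiderivative x - sin (u x) / u: the increment of the sine
    over the interval is strictly less than 2 |u| t, by |sin| < id on (0, pi). *)
Lemma int_1Bcos (u p t : R) : 0 < t -> u != 0 -> `|u| * t < pi ->
  0 < \int[mu]_s (\1_`[p - t, p + t]%classic s * (1 - cos (u * s))).
Proof.
move=> t0 u0 ut.
have pt : p - t < p + t by lra.
pose F x := x - u^-1 * sin (u * x).
have dF (x : R) : is_derive x (1 : R) F (1 - cos (u * x)).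
  have d1 : is_derive x (1 : R) (fun x : R => u * x) u.
    by apply: is_derive_eq; rewrite /GRing.scale /= mulr1.
  have d2 := is_derive1_comp (is_derive_sin (u * x)) d1.
  apply: (@is_derive_eq _ _ _ _ _ _ _ _ (is_deriveB (is_derive_id x 1) (is_deriveZ u^-1 d2))).
  by rewrite /GRing.scale /= ; field.
have cF (x : R) : {for x, continuous (fun x => 1 - cos (u * x))}.
  apply: cvgB; first exact: cvg_cst.
  apply: (@continuous_comp _ _ _ (fun x => u * x) cos); last exact: continuous_cos.
  by apply: cvgM; [exact: cvg_cst|exact: cvg_id].
rewrite rint_indic // (ftc_closed pt (fun x _ => dF x) (fun x _ => cF x)) /F.
have -> : p + t - u^-1 * sin (u * (p + t)) - (p - t - u^-1 * sin (u * (p - t))) =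
   2 * t - u^-1 * (sin (u * p + u * t) - sin (u * p - u * t)).
  by rewrite mulrDr mulrBr; ring.
rewrite subr_gt0; apply: le_lt_trans (ler_norm _) _.
rewrite normrM normfV mulrC ltr_pdivrMr ?normr_gt0 //.
have -> : 2 * t * `|u| = 2 * `|u * t| by rewrite normrM (gtr0_norm t0); ring.
by apply: sin_diff; rewrite normrM (gtr0_norm t0) // mulr_gt0 // normr_gt0.
Qed.

Hypothesis d_a : d a != 0.

(** Right continuity of d at a, where it is positive, gives a lower bound on intervals close to a;
    these can be taken as short as [int_1Bcos] requires. *)
Lemma density_near r : 0 < r ->
  exists p t, [/\ 0 < t, t <= r & forall s, s \in `[p - t, p + t] -> d a / 2 <= d s].
Proof.
move=> r0; have da : 0 < d a by rewrite lt_def d_a d0.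
have e0 : 0 < d a / 2 by rewrite divr_gt0.
move: d_cont; rewrite continuous_within_itvP // => -[_ ca _].
move/cvgrPdist_le : ca => /(_ _ e0) [/= dl dl0 H].
pose t := Num.min r (dl / 3).
have t0 : 0 < t by rewrite lt_min r0 divr_gt0.
have tdl : t * 3 <= dl by rewrite -ler_pdivlMr // ge_min lexx orbT.
(* The interval is [a + t / 2, a + 5 t / 2]: strictly to the right of a and, since 3 t <= [dl],
   inside the neighbourhood. *)
exists (a + t * (3 / 2)), t; split => //; first by rewrite ge_min lexx.
move=> s; rewrite in_itv /= => /andP[s1 s2].
have := H s; rewrite /ball_ /= ltr_distlC => /(_ ltac:(apply/andP; split; lra) ltac:(lra)).
by rewrite ler_distlC => /andP[+ _]; lra.
Qed.

(** If the transform is 1 at u, the integral of d s * (1 - cos (u s)) is 0. This integrand is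
    nonnegative and dominates d a / 2 * (1 - cos (u s)) on a short interval, whose integral is
    positive. *)
Lemma ft_cden_real_neq1 (u : R) : u != 0 -> ft cden (CofR u) != 1.
Proof.
move=> u0; apply/eqP => e.
have u0' : 0 < `|u| by rewrite normr_gt0.
(* This r gives |u| t <= pi / 2 < pi. *)
have [p [t [t0 tr dge]]] := density_near (r := pi / (2 * `|u|))
   ltac:(by rewrite divr_gt0 ?pi_gt0 // mulr_gt0).
have ut : `|u| * t < pi.
  move: tr; rewrite ler_pdivlMr ?mulr_gt0 // => tr.
  by have := pi_gt0 R; nra.
have I0 := int_1Bcos p t0 u0 ut.
have da : 0 < d a by rewrite lt_def d_a d0.

have dg := density_rintg.
have dc : rintg (fun s => d s * cos (u * s)).
  apply: (rintg_dom _ dg) => [|s]; last first.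
    by rewrite normrM ger0_norm // ler_piMr // ler_norml cos_geN1 cos_le1.
  apply: measurable_funM => //; apply: continuous_measurable_fun => s.
  apply: (@continuous_comp _ _ _ (fun x => u * x) cos); last exact: continuous_cos.
  by apply: cvgM; [exact: cvg_cst|exact: cvg_id].
have I1 : \int[mu]_s (d s * (1 - cos (u * s))) = 0.
  under eq_Rintegral do rewrite mulrBr mulr1.
  rewrite rintB // density_int; apply/eqP; rewrite subr_eq0; apply/eqP/esym.
  have /(congr1 (@ReC R)) := e; rewrite Re_cint !CE => <-.
  apply: eq_Rintegral => s _; rewrite /cden ReCM !ReC_ofR !ImC_ofR mul0r subr0 Re_cexp.
  by rewrite !CE !(mul0r, mul1r, mulr0, subr0, sub0r, addr0, add0r, oppr0) expR0 mul1r.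
have I2 : 0 < \int[mu]_s (d a / 2 * (\1_`[p - t, p + t]%classic s * (1 - cos (u * s)))).
  rewrite rintZ; first by rewrite mulr_gt0 // divr_gt0.
  have [i1 _] := rint_cst_itv 2 (ltac:(lra) : p - t <= p + t).
  apply: rintg_dom i1 _ => [|s].
    apply: measurable_funM; first exact: measurable_indic.
    apply: continuous_measurable_fun => s; apply: cvgB; first exact: cvg_cst.
    apply: (@continuous_comp _ _ _ (fun x => u * x) cos); last exact: continuous_cos.
    by apply: cvgM; [exact: cvg_cst|exact: cvg_id].
  have c1 := cos_le1 (u * s); have c2 := cos_geN1 (u * s).
  rewrite normrM mulrC ger0_norm; last by rewrite subr_ge0.
  rewrite ger0_norm; last by rewrite indicE.
  apply: ler_wpM2r; first by rewrite indicE.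
  by lra.
suff : \int[mu]_s (d a / 2 * (\1_`[p - t, p + t]%classic s * (1 - cos (u * s)))) <= 0.
  by rewrite leNgt I2.
rewrite -I1; apply: rint_le.
- have [i1 _] := rint_cst_itv (d a) (ltac:(lra) : p - t <= p + t).
  apply: rintg_dom i1 _ => [|s].
    apply: measurable_funM => //; apply: measurable_funM; first exact: measurable_indic.
    apply: continuous_measurable_fun => s; apply: cvgB; first exact: cvg_cst.
    apply: (@continuous_comp _ _ _ (fun x => u * x) cos); last exact: continuous_cos.
    by apply: cvgM; [exact: cvg_cst|exact: cvg_id].
  have c1 := cos_le1 (u * s); have c2 := cos_geN1 (u * s).
  rewrite ger0_norm; last by rewrite !mulr_ge0 ?subr_ge0 ?indicE // ltW.
  by rewrite indicE; case: (_ \in _) => /=; nra.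
- by under eq_fun do rewrite mulrBr mulr1; exact: rintgB.
- move=> s; have c1 := cos_le1 (u * s).
  rewrite indicE; case: (boolP (s \in _)) => [|_]; last by rewrite mul0r mulr0 mulr_ge0 // subr_ge0.
  rewrite inE /= => /dge ds; rewrite mul1r; apply: ler_wpM2r => //.
Qed.

(** The derivative of the transform at 0 is i times the mean of d, and the mean is at least a > 0.
    Hence 0 is a simple zero and contributes exactly 1 to the final formula. *)
Lemma ft_mulix_cden0_neq0 : ft (mulix cden) 0 != 0.
Proof.
apply/eqP => /(congr1 (@ImC R)); rewrite Im_cint !CE => I0.
have dg := density_rintg.
have e : \int[mu]_x ImC (mulix cden x * cexp (CI * 0 * CofR x)) = \int[mu]_s (d s * s).
  apply: eq_Rintegral => s _.
  by rewrite mulr0 mul0r cexp0 mulr1 /mulix /cden !CE; ring.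
have i1 : rintg (fun s => d s * s).
  apply: rintg_dom (rintgZ b dg) _ => [|s].
    by apply: measurable_funM => //; exact: measurable_idR.
  case: (boolP (s \in `[a, b])) => sab; last by rewrite d_supp // mul0r mulr0 normr0.
  move: sab; rewrite in_itv /= => /andP[sa sb].
  rewrite ger0_norm; last by rewrite mulr_ge0 // (le_trans _ sa) // ltW.
  by rewrite mulrC; exact: ler_wpM2r.
have : a * \int[mu]_s d s <= \int[mu]_s (d s * s).
  rewrite -rintZ //; apply: rint_le => //; first exact: rintgZ.
  move=> s; case: (boolP (s \in `[a, b])) => sab; last by rewrite d_supp // mul0r mulr0.
  move: sab; rewrite in_itv /= mulrC => /andP[sa sb]; exact: ler_wpM2l.
by rewrite -e I0 density_int mulr1 leNgt a_gt0.
Qed.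

Lemma convnS n : convn d n.+2 = convolution d (convn d n.+1).
Proof. by []. Qed.

Definition cconvn n (s : R) : CC R := CofR (convn d n.+1 s).

Lemma cconvnS n s : cconvn n.+1 s = cconv cden (cconvn n) s.
Proof. by rewrite /cconvn convnS convolution_ofR. Qed.

Lemma bcs_cconvn n : bcs (b *+ n.+1) (cconvn n).
Proof.
elim: n => [|n IH]; first exact: bcs_cden.
have -> : cconvn n.+1 = cconv cden (cconvn n) by apply/funext => s; exact: cconvnS.
by rewrite mulrS; exact: bcs_cconv bcs_cden IH.
Qed.

Lemma ft_cconvn n k : ft (cconvn n) k = ft cden k ^+ n.+1.
Proof.
elim: n => [|n IH]; first by rewrite expr1.
rewrite exprS -IH -(ft_cconv k bcs_cden (bcs_cconvn n)); congr cint.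
by apply/funext => s; rewrite cconvnS.
Qed.

(** From the second convolution power on there are no jumps left, so inversion holds at every x; the
    first power may jump at a and b and is treated apart. *)
Lemma ccont_cconvn n x : ccont (cconvn n.+1) x.
Proof.
have -> : cconvn n.+1 = cconv cden (cconvn n) by apply/funext => s; exact: cconvnS.
elim: n x => [|n IH] x.
  apply: (ccont_cconv (s := [:: a; b]) x bcs_cden bcs_cden); exact: ccont_cden.
apply: (ccont_cconv (s := [::]) x bcs_cden (bcs_cconvn n.+1)) => p _.
have -> : cconvn n.+1 = cconv cden (cconvn n) by apply/funext => s; exact: cconvnS.
exact: IH.
Qed.

End density.

(** * Zeros and their multiplicities *)

Section multiplicities.
Variable R : realType.
Implicit Types (f g : CC R -> CC R) (k z : CC R).

Definition csmooth g := forall n k, derivable (derive1n n g) k 1.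

Definition order_at n f k :=
  (forall j, (j < n)%N -> derive1n j f k = 0) /\ derive1n n f k != 0.

(** Orders are unique: of two different ones, the larger would force the derivative at the smaller
    to vanish. So the choice made by [xget] is n. *)
Lemma order_at_multiplicity n f k : order_at n f k -> multiplicity f k = n.
Proof.
move=> fn; rewrite /multiplicity; case: xgetP => [m _ [m0 m1]|/(_ n)//].
have [n0 n1] := fn.
have [mn|nm|//] := ltngtP m n; first by rewrite n0 ?eqxx in m1.
by rewrite m0 ?eqxx in n1.
Qed.

Lemma order_at0 f k : f k != 0 -> order_at 0 f k.
Proof. by []. Qed.

Lemma is_derive_subM z g (D : CC R) k : is_derive k (1 : CC R) g D ->
  is_derive k (1 : CC R) (fun t => (t - z) * g t) (g k + (k - z) * D).
Proof.
move=> dg.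
have d1 : is_derive k (1 : CC R) (fun t : CC R => t - z) 1.
  by apply: is_derive_eq; rewrite subr0.
apply: is_derive_eq (is_deriveM d1 dg) _.
by rewrite /GRing.scale /= mulr1 addrC.
Qed.

(** Leibniz' rule, cut after two terms because t - z is linear. At n = 0 the second term has
    coefficient 0, so the truncated predecessor is harmless. *)
Lemma derive1n_subM z g n k : csmooth g ->
  derive1n n (fun t => (t - z) * g t) k =
  (k - z) * derive1n n g k + n%:R * derive1n n.-1 g k.
Proof.
move=> sg; elim: n k => [|n IH] k; first by rewrite mul0r addr0.
have dg m t : is_derive t (1 : CC R) (derive1n m g) (derive1n m.+1 g t).
  by apply: DeriveDef; [exact: sg|rewrite -derive1E].
rewrite derive1nS derive1E.
have -> : derive1n n (fun t => (t - z) * g t) =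
    (fun t => (t - z) * derive1n n g t + n%:R * derive1n n.-1 g t) by exact/funext.
have d1 := is_deriveD (is_derive_subM z (dg n k)) (is_deriveZ (n%:R : CC R) (dg n.-1 k)).
rewrite (@derive_val _ _ _ _ _ _ _ d1) /GRing.scale /=.
case: n {IH d1} => [|n] /=; first by rewrite mul0r addr0; ring.
set A := (k - z) * _.
by rewrite [in RHS](mulrS 1 n.+1) mulrDl mul1r -[LHS]addrA [LHS]addrCA.
Qed.

Lemma csmooth_subM z g : csmooth g -> csmooth (fun t => (t - z) * g t).
Proof.
move=> sg n k.
have dg m t : is_derive t (1 : CC R) (derive1n m g) (derive1n m.+1 g t).
  by apply: DeriveDef; [exact: sg|rewrite -derive1E].
have -> : derive1n n (fun t => (t - z) * g t) =
    (fun t => (t - z) * derive1n n g t + n%:R * derive1n n.-1 g t).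
  by apply/funext => t; exact: derive1n_subM.
have := is_deriveD (is_derive_subM z (dg n k)) (is_deriveZ (n%:R : CC R) (dg n.-1 k)).
by move=> [].
Qed.

(** At k = z the derivative of order n + 1 of the product is n + 1 times the n-th derivative of g,
    nonzero in characteristic 0; elsewhere t - z does not change the order. *)
Lemma order_at_subM n z g k : csmooth g -> order_at n g k ->
  order_at ((z == k) + n) (fun t => (t - z) * g t) k.
Proof.
move=> sg [g0 g1]; case: eqVneq => [->|zk]; split.
- case=> [|j] jn; rewrite derive1n_subM // subrr mul0r add0r ?mul0r //.
  by rewrite g0 // mulr0.
- rewrite derive1n_subM // subrr mul0r add0r mulf_neq0 //.
  by rewrite pnatr_eq0.
- move=> j jn; rewrite derive1n_subM // g0 // mulr0 add0r.
  case: j jn => [|j] jn; first by rewrite mul0r.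
  by rewrite g0 ?mulr0 // (ltn_trans _ jn).
- rewrite derive1n_subM //.
  case: n g0 g1 => [|n] g0 g1; first by rewrite mul0r addr0 mulf_neq0 // subr_eq0 eq_sym.
  by rewrite (g0 n.+1.-1) // mulr0 addr0 mulf_neq0 // subr_eq0 eq_sym.
Qed.

Lemma order_at_prod (s : seq (CC R)) g k : csmooth g -> g k != 0 ->
  csmooth (fun t => (\prod_(z <- s) (t - z)) * g t) /\
  order_at (count_mem k s) (fun t => (\prod_(z <- s) (t - z)) * g t) k.
Proof.
move=> sg g0; elim: s => [|z s [IH1 IH2]].
  have -> : (fun t => (\prod_(z <- [::]) (t - z)) * g t) = g.
    by apply/funext => t; rewrite big_nil mul1r.
  by split => //; exact: order_at0.
have -> : (fun t => (\prod_(y <- z :: s) (t - y)) * g t) =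
    (fun t => (t - z) * (\prod_(y <- s) (t - y) * g t)).
  by apply/funext => t; rewrite big_cons mulrA.
by split; [exact: csmooth_subM|exact: order_at_subM].
Qed.

Lemma derive1n_ft B (q : R -> CC R) n : bcs B q ->
  derive1n n (ft q) = ft (iter n (@mulix R) q) /\ bcs B (iter n (@mulix R) q).
Proof.
move=> bq; elim: n => [//|n [IH1 IH2]]; split; last exact: bcs_mulix.
by rewrite derive1nS IH1 (ft_derive1 IH2).
Qed.

Lemma csmooth_ft B (q : R -> CC R) : bcs B q -> csmooth (ft q).
Proof.
move=> bq n k; have [-> bn] := derive1n_ft n bq.
by have [] := ft_is_derive k bn.
Qed.

(** The logarithmic form makes the poles 1 / (k - z) appear, one for each entry of s and thus with
    multiplicity. *)
Lemma is_derive_prod_sub (s : seq (CC R)) k : all (fun z => k != z) s ->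
  is_derive k (1 : CC R) (fun t => \prod_(z <- s) (t - z))
    ((\prod_(z <- s) (k - z)) * \sum_(z <- s) (k - z)^-1).
Proof.
elim: s => [_|z s IH /= /andP[kz ks]].
  under eq_fun do rewrite big_nil.
  by rewrite !big_nil mulr0; exact: is_derive_cst.
under eq_fun do rewrite big_cons.
apply: is_derive_eq (is_derive_subM z (IH ks)) _.
rewrite !big_cons mulrDr; congr (_ + _).
  by rewrite mulrAC mulfV ?mul1r // subr_eq0.
by rewrite mulrA.
Qed.

End multiplicities.

(** * Zeros of the transform minus 1 and their multiplicities *)

Section zeros.
Variable R : realType.
Local Notation mu := (@lebesgue_measure R).
Variables (a b : R) (d : R -> R).
Hypothesis a_gt0 : 0 < a.
Hypothesis d_density : is_density d.
Hypothesis d_supp : forall x, x \notin `[a, b] -> d x = 0.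
Hypothesis d_cont : {within `[a, b], continuous d}.
Hypothesis d_a : d a != 0.

Local Notation h := (ft (cden d)).

Let bq : bcs b (cden d). Proof. exact: bcs_cden a_gt0 d_density d_supp d_cont. Qed.

Lemma ft_cden_small (c e : R) : 0 <= c -> 0 < e -> exists2 L, 0 < L &
  forall u y, L <= `|u| -> `|y| <= c -> cabs (h (ln_ y u)) <= e.
Proof. exact: riemann_lebesgue bq (ae_ccont_cden d_density d_supp d_cont). Qed.

(** The zero at 0 is divided out first: being simple, it leaves [q0] whose transform is nonzero at
    0, the base point that [factor_zeros] needs. No zero with ImC k >= - c escapes the rectangle
    [Om]: above the real axis |h| < 1, and for large real part |h| <= 1 / 2. The nonzero points of
    the real axis are no zeros, so the listed ones lie strictly below it. *)
Lemma ft_cden_factor (c : R) : 0 < c -> exists ks q', [/\ bcs b q',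
  forall z, z \in ks -> [/\ - c <= ImC z, ImC z < 0 & h z = 1],
  forall k, h k - 1 = (\prod_(z <- 0 :: ks) (k - z)) * ft q' k &
  forall k, - c <= ImC k -> ft q' k != 0].
Proof.
move=> c0; have h0 := ft_cden0 d_density.
pose q0 := qdiv 0 (cden d).
have bq0 : bcs b q0 by exact: bcs_qdiv.
have fE k : h k - 1 = k * ft q0 k by rewrite -h0 (ft_qdiv 0 k bq) subr0.
have q00 : ft q0 0 != 0.
  (* The derivative at 0 of h - 1 = k [ft q0 k] is [ft q0 0], so the nonvanishing of h' at 0
     transfers to it. *)
  have := ft_mulix_cden0_neq0 a_gt0 d_density d_supp.
  have d1 : is_derive (0 : CC R) (1 : CC R) (fun k => h k - 1) (ft (mulix (cden d)) 0).
    by have := ft_is_derive 0 bq => dd; apply: is_derive_eq; rewrite subr0.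
  have d2 := is_derive_subM 0 (ft_is_derive 0 bq0).
  have : (fun k => h k - 1) = (fun t => (t - 0) * ft q0 t).
    by apply/funext => k; rewrite fE subr0.
  move=> eq1; move: d1; rewrite eq1 => d1.
  rewrite -(@derive_val _ _ _ _ _ _ _ d1) (@derive_val _ _ _ _ _ _ _ d2).
  by rewrite subrr mul0r addr0.
have [L L0 LP] := ft_cden_small (ltW c0) (ltac:(lra) : 0 < 2^-1 :> R).
pose Om k := - c <= ImC k <= 0 /\ `|ReC k| <= L.
have OmP k : Om k -> - c <= ImC k /\ cabs (0 - k) <= L + c.
  move=> [/andP[k1 k2] k3]; split => //; rewrite sub0r cabsN.
  apply: le_trans (cabs_le_ReIm _) _; apply: lerD => //.
  by rewrite ler0_norm // lerNl.
have [ks [q' [bq' ksP qE qn0]]] :=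
  factor_zeros bq0 (ltW c0) (addr_ge0 (ltW L0) (ltW c0)) OmP q00.
have facE k : h k - 1 = (\prod_(z <- 0 :: ks) (k - z)) * ft q' k.
  by rewrite fE big_cons subr0 -mulrA -qE.
exists ks, q'; split => //.
- move=> z zks; have [[/andP[z1 z2] _] z4] := ksP z zks.
  have hz : h z = 1 by apply/eqP; rewrite -subr_eq0 fE z4 mulr0.
  split => //; rewrite lt_neqAle z2 andbT; apply/eqP => Iz.
  have zE : z = CofR (ReC z) by rewrite [LHS]CCE Iz CofR0 mulr0 addr0.
  have [Rz|Rz] := eqVneq (ReC z) 0.
    by move/eqP: q00; apply; rewrite Rz in zE; rewrite zE in z4.
  by have := ft_cden_real_neq1 d_density d_supp d_cont d_a Rz; rewrite -zE hz eqxx.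
- move=> k kc.
  have [kO|kO] := pselect (Om k); first exact: qn0.
  suff hk : h k != 1.
    apply: contra hk => /eqP qk0; rewrite -subr_eq0 facE qk0 mulr0 //.
  have [k0|k0] := ltP 0 (ImC k).
    by apply: (@ft_cden_upper_neq1 _ a b).
  apply/eqP => hk1; apply: kO; split; first by rewrite kc.
  rewrite leNgt; apply/negP => kL.
  have := LP (ReC k) (ImC k) (ltW kL); rewrite -lnE hk1 cabs1 ler0_norm // lerNl => /(_ kc).
  by lra.
Qed.

Section factored.
Variables (c : R) (ks : seq (CC R)) (q' : R -> CC R).
Hypothesis c_gt0 : 0 < c.
Hypothesis bq' : bcs b q'.
Hypothesis ksP : forall z, z \in ks -> [/\ - c <= ImC z, ImC z < 0 & h z = 1].
Hypothesis facE : forall k, h k - 1 = (\prod_(z <- 0 :: ks) (k - z)) * ft q' k.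
Hypothesis q'0 : forall k, - c <= ImC k -> ft q' k != 0.

Let f k := fourier a b d k - 1.
Let Z := [set k | strip c k /\ f k = 0].

Let fE k : f k = h k - 1. Proof. by rewrite /f fourierE. Qed.

Lemma zeros_sub : Z `<=` [set` ks].
Proof.
move=> k [/= /andP[k1 k2]]; rewrite fE facE => /eqP.
rewrite mulf_eq0 (negPf (q'0 (ltW k1))) orbF.
rewrite prodf_seq_eq0 => /hasP[z /= zs]; rewrite subr_eq0 => /eqP kz.
move: zs; rewrite -kz inE => /orP[/eqP k0|//].
by move: k2; rewrite k0 ltxx.
Qed.

Lemma finite_zeros : finite_set Z.
Proof. exact: sub_finite_set zeros_sub (finite_seq ks). Qed.

Lemma zeros_multiplicity k : k \in ks -> multiplicity f k = count_mem k ks.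
Proof.
move=> kks; have [k1 k2 _] := ksP kks.
have -> : f = (fun t => (\prod_(z <- 0 :: ks) (t - z)) * ft q' t).
  by apply/funext => t; rewrite fE facE.
have [_ o] := order_at_prod (0 :: ks) (csmooth_ft bq') (q'0 k1).
rewrite (order_at_multiplicity o) /=.
by rewrite [_ == k]negbTE //; apply: contraTneq k2 => <-; rewrite ltxx.
Qed.

Hypothesis f_line : forall k, ImC k = - c -> f k != 0.

(** The factorisation covers the closed half-plane ImC k >= - c; the hypothesis on the boundary line
    makes the inequality strict. *)
Lemma ks_strip z : z \in ks -> - c < ImC z < 0.
Proof.
move=> zs; have [z1 z2 hz] := ksP zs; rewrite z2 andbT lt_neqAle z1 andbT.
by apply/eqP => /esym/f_line; rewrite fE hz subrr eqxx.
Qed.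

(** [ks] repeats each zero as often as its multiplicity, so the weighted sum over the set is the
    plain sum over the list. *)
Lemma zeros_sum (F : CC R -> CC R) :
  \sum_(k \in Z) ((multiplicity f k)%:R * F k) = \sum_(z <- ks) F z.
Proof.
have -> : Z = [set` undup ks].
  apply/seteqP; split => k /=; rewrite mem_undup; first exact: zeros_sub.
  move=> kks; split; first exact: ks_strip.
  by have [_ _ hk] := ksP kks; rewrite fE hk subrr.
rewrite -fsbig_seq ?undup_uniq // -[RHS]big_undup_iterop_count.
apply: eq_big_seq => z; rewrite mem_undup => zks.
by rewrite zeros_multiplicity // mulr_natl.
Qed.

End factored.

End zeros.

(** * The contour shift for the density *)

Section strip_functions.
Variable R : realType.
Implicit Types (f g : CC R -> CC R) (k z D : CC R).

Lemma is_derive_lineE k f D D' : is_derive k (1 : CC R) f D -> D = D' ->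
  is_derive k (1 : CC R) f D'.
Proof. by move=> ? <-. Qed.

Lemma cdiffM k f g D D' : is_derive k (1 : CC R) f D -> is_derive k (1 : CC R) g D' ->
  is_derive k (1 : CC R) (fun t => f t * g t) (D * g k + f k * D').
Proof.
move=> df dg; apply: is_derive_lineE (is_deriveM df dg) _.
by rewrite [RHS]addrC [D * _]mulrC.
Qed.

Lemma cdiffV k f D : f k != 0 -> is_derive k (1 : CC R) f D ->
  is_derive k (1 : CC R) (fun t => (f t)^-1) (- (D / f k ^+ 2)).
Proof.
move=> f0 df; have [d e] := df; apply: DeriveDef; first exact: derivableV.
by rewrite deriveV // e /GRing.scale /= mulNr mulrC.
Qed.

Lemma cdiff_sub k z : is_derive k (1 : CC R) (fun t => t - z) 1.
Proof. by apply: is_derive_eq; rewrite subr0. Qed.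

Lemma cdiff_cexp k z : is_derive k (1 : CC R) (fun t => cexp (z * t)) (z * cexp (z * k)).
Proof.
pose r := (cabs z + 1)^-1.
have r0 : 0 < cabs z + 1 by rewrite ltr_wpDl // cabs_ge0.
apply: (@is_cderive_quad R _ k _ (cabs (cexp (z * k)) * (8 * cabs z ^+ 2)) r).
  by rewrite invr_gt0.
move=> t tr; have {}tr : (cabs z + 1) * cabs t <= 1 by rewrite -ler_pdivlMl // mulr1.
have zt : cabs (z * t) <= 1.
  by rewrite cabsM (le_trans _ tr) // ler_wpM2r ?cabs_ge0 // lerDl.
have -> : cexp (z * (k + t)) - cexp (z * k) - t * (z * cexp (z * k)) =
   cexp (z * k) * (cexp (z * t) - 1 - z * t).
  by rewrite mulrDr cexpD; ring.
rewrite cabsM -mulrA; apply: ler_wpM2l; first exact: cabs_ge0.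
by apply: le_trans (cexp_quad zt) _; rewrite cabsM exprMn mulrA.
Qed.

Lemma derivable_ccont_line f (y u : R) : derivable f (ln_ y u) 1 ->
  ccont (fun u => f (ln_ y u)) u.
Proof.
move=> df; have d : is_derive (CI * CofR y + CofR u * 1) (1 : CC R) f ('D_1 f (ln_ y u)).
  have -> : CI * CofR y + CofR u * 1 = ln_ y u by rewrite mulr1 addrC.
  exact: DeriveDef.
have := cder_ccont (is_cderive_line d).
by congr ccont; apply/funext => t; rewrite mulr1 addrC.
Qed.

(** Near k, a function with derivative D satisfies |f (k + h) - f k| <= (1 + |D|) |h|, which gives
    joint continuity in the two real coordinates. *)
Lemma rect_cont f (T y0 y1 : R) :
  (forall k, y0 <= ImC k <= y1 -> derivable f k 1) ->
  {within `[- T, T]%classic `*` `[y0, y1]%classic, continuous (fun p : R * R => cabs (f (ln_ p.2 p.1)))}.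
Proof.
move=> df; apply: continuous_in_subspaceT => p /set_mem [/= _ p2].
set k := ln_ p.2 p.1.
have kd : derivable f k 1 by apply: df; rewrite Im_ln; move: p2; rewrite in_itv.
have [r r0 rP] := (is_cderiveP _ _ _).1 (DeriveDef kd (erefl _)) 1 ltr01.
set D := 'D_1 f k in rP.
apply/cvgrPdist_le => e e0.
have D0 : 0 < 1 + cabs D by rewrite ltr_pwDl // cabs_ge0.
(* Halved because |h| is estimated by the sum of its two coordinates. *)
pose dl := Num.min r (e / (1 + cabs D)) / 2.
have dl0 : 0 < dl by rewrite divr_gt0 // lt_min r0 divr_gt0.
exists (ball p.1 dl, ball p.2 dl) => /=; first by split; exact: nbhsx_ballx.
move=> q [/= q1 q2].
have hE : ln_ q.2 q.1 = k + (ln_ q.2 q.1 - k) by ring.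
set h := ln_ q.2 q.1 - k in hE *.
have hd : cabs h <= dl + dl.
  apply: le_trans (cabs_le_ReIm _) _; rewrite /h ReCD ImCD ReCN ImCN !Re_ln !Im_ln.
  by apply: lerD; rewrite distrC ltW.
have dlE : dl + dl = Num.min r (e / (1 + cabs D)) by rewrite /dl -mulrDr -mulr2n; field.
have hr : cabs h <= r by rewrite (le_trans hd) // dlE ge_min lexx.
have he : cabs h * (1 + cabs D) <= e.
  by rewrite -ler_pdivlMr // (le_trans hd) // dlE ge_min lexx orbT.
have fd : cabs (f (k + h) - f k) <= cabs h * (1 + cabs D).
  have -> : f (k + h) - f k = (f (k + h) - f k - h * D) + h * D by rewrite subrK.
  by rewrite mulrDr mulr1 (le_trans (cabsD _ _)) // cabsM lerD2r -[leRHS]mul1r rP.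
rewrite hE distrC ler_norml; apply/andP; split.
  rewrite lerNl opprB; apply: le_trans (lerB_cabs _ _) _.
  by rewrite cabsC (le_trans fd).
by apply: le_trans (lerB_cabs _ _) _; rewrite (le_trans fd).
Qed.

Lemma rect_upper f (T y0 y1 : R) : (forall k, y0 <= ImC k <= y1 -> derivable f k 1) ->
  exists N, forall u y, `|u| <= T -> y0 <= y <= y1 -> cabs (f (ln_ y u)) <= N.
Proof.
move=> df; have [A0|A0] := pselect ((`[- T, T]%classic `*` `[y0, y1]%classic : set (R * R)) !=set0).
  have [p _ pP] := compact_EVT_max A0 (compact_setX (@segment_compact R (- T) T) (@segment_compact R y0 y1)) (rect_cont (T := T) df).
  exists (cabs (f (ln_ p.2 p.1))) => u y uT yy; apply: (pP (u, y)).
  by rewrite inE; split; rewrite /= in_itv //= -ler_norml.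
exists 0 => u y uT yy; exfalso; apply: A0; exists (u, y).
by split; rewrite /= in_itv //= -ler_norml.
Qed.

End strip_functions.

(** * Uniform decay at infinity in a strip *)

Section vanishing.
Variable R : realType.
Variables y0 y1 : R.
Implicit Types f g : CC R -> CC R.

Definition vanish g := forall e : R, 0 < e -> exists L, forall u y,
  L <= `|u| -> y0 <= y <= y1 -> cabs (g (ln_ y u)) <= e.

Lemma vanishD f g : vanish f -> vanish g -> vanish (fun k => f k + g k).
Proof.
move=> vf vg e e0; have e2 : 0 < e / 2 by rewrite divr_gt0.
have [L1 P1] := vf _ e2; have [L2 P2] := vg _ e2.
exists (Num.max L1 L2) => u y; rewrite ge_max => /andP[u1 u2] yy.
rewrite (splitr e); apply: le_trans (cabsD _ _) _.
by apply: lerD; [exact: P1|exact: P2].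
Qed.

Lemma vanishM f g (N L : R) : vanish f ->
  (forall u y, L <= `|u| -> y0 <= y <= y1 -> cabs (g (ln_ y u)) <= N) ->
  vanish (fun k => f k * g k).
Proof.
move=> vf gN e e0.
have N0 : 0 < `|N| + 1 by rewrite ltr_wpDl.
have [L1 P1] := vf (e / (`|N| + 1)) (divr_gt0 e0 N0).
exists (Num.max L1 L) => u y; rewrite ge_max => /andP[u1 u2] yy.
rewrite -[e](divfK (lt0r_neq0 N0)) cabsM.
apply: ler_pM; rewrite ?cabs_ge0 ?P1 // (le_trans (gN _ _ u2 yy)) //.
by rewrite (le_trans (ler_norm _)) // lerDl.
Qed.

Lemma vanishN g : vanish g -> vanish (fun k => - g k).
Proof. by move=> vg e /vg[L LP]; exists L => u y; rewrite cabsN; exact: LP. Qed.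

Lemma vanish_sum (s : seq (CC R)) (G : CC R -> CC R -> CC R) :
  (forall z, vanish (G z)) -> vanish (fun k => \sum_(z <- s) G z k).
Proof.
move=> vG; elim: s => [|z s IH].
  by move=> e e0; exists 0 => u y _ _; rewrite big_nil cabs0 ltW.
have -> : (fun k => \sum_(t <- z :: s) G t k) = (fun k => G z k + \sum_(t <- s) G t k).
  by apply/funext => k; rewrite big_cons.
exact: vanishD.
Qed.

Lemma vanish_pole z : vanish (fun k => (k - z)^-1).
Proof.
move=> e e0; exists (`|ReC z| + e^-1) => u y uL _.
have : e^-1 <= cabs (ln_ y u - z).
  apply: le_trans (Re_le_cabs _); rewrite ReCD ReCN Re_ln.
  by apply: le_trans (lerB_dist _ _); rewrite lerBrDl.
by move=> H; rewrite cabsV invf_ple ?posrE ?invr_gt0 // (lt_le_trans _ H) // invr_gt0.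
Qed.

Lemma vanish_ft B (q : R -> CC R) : bcs B q ->
  {ae lebesgue_measure, forall s, ccont q s} -> vanish (ft q).
Proof.
move=> bq cq e e0.
have [L _ LP] := riemann_lebesgue bq cq (addr_ge0 (normr_ge0 y0) (normr_ge0 y1)) e0.
exists L => u y uL /andP[y1' y2']; apply: LP => //.
by rewrite ler_norml; apply/andP; split;
  have := ler_norm y1; have := ler_norm (- y0); rewrite normrN;
  have := normr_ge0 y0; have := normr_ge0 y1; lra.
Qed.

Lemma vanish_eventually f g (L : R) : vanish g ->
  (forall u y, L <= `|u| -> y0 <= y <= y1 -> f (ln_ y u) = g (ln_ y u)) -> vanish f.
Proof.
move=> vg fg e /vg[L' LP]; exists (Num.max L L') => u y.
by rewrite ge_max => /andP[u1 u2] yy; rewrite fg //; exact: LP.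
Qed.

End vanishing.

(** * From the series of convolution powers to the sum over zeros *)

Section main_identity.
Variable R : realType.
Local Notation mu := (@lebesgue_measure R).
Variables (a b : R) (d : R -> R).
Hypothesis a_gt0 : 0 < a.
Hypothesis d_density : is_density d.
Hypothesis d_supp : forall x, x \notin `[a, b] -> d x = 0.
Hypothesis d_cont : {within `[a, b], continuous d}.

Local Notation h := (ft (cden d)).
Local Notation h' := (ft (mulix (cden d))).

Let bq : bcs b (cden d). Proof. exact: bcs_cden a_gt0 d_density d_supp d_cont. Qed.
Let bq1 : bcs b (mulix (cden d)). Proof. exact: bcs_mulix. Qed.

Lemma derivable_inv k : h k != 1 -> derivable (fun t => (1 - h t)^-1) k 1.
Proof.
move=> hk; apply: (@derivableV _ _ (fun t => 1 - h t)).
  by rewrite subr_eq0 eq_sym.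
have d1 : is_derive k (1 : CC R) (fun t => 1 - h t) (0 - h' k).
  by have dd := ft_is_derive k bq; apply: is_derive_eq.
by case: d1.
Qed.

(** For large |u| one has |h| <= 1 / 2 and the inverse is at most 2; the remaining segment is
    compact. *)
Lemma line_inverse (y : R) : (forall u, h (ln_ y u) != 1) ->
  exists N, forall u, cabs ((1 - h (ln_ y u))^-1) <= N.
Proof.
move=> h1.
have [L L0 LP] := ft_cden_small a_gt0 d_density d_supp d_cont (normr_ge0 y) (ltac:(lra) : 0 < 2^-1 :> R).
(* The rectangle of [rect_upper] is degenerate here, of height 0. *)
have df k : y <= ImC k <= y -> derivable (fun t => (1 - h t)^-1) k 1.
  move=> ky; have kE : k = ln_ y (ReC k) by rewrite (_ : y = ImC k) -?lnE //; apply/eqP; rewrite eq_le.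
  by apply: derivable_inv; rewrite kE.
have [N NP] := rect_upper L df.
exists (Num.max 2 N) => u; rewrite le_max; apply/orP.
have [uL|Lu] := leP `|u| L; [right|left]; first by apply: NP; rewrite ?lexx.
have := LP u y (ltW Lu) (lexx _) => hs.
have : 1 - 2^-1 <= cabs (1 - h (ln_ y u)).
  apply: le_trans (lerB_cabs _ _); rewrite cabs1; lra.
move=> H; rewrite cabsV invf_ple ?posrE //; first by lra.
by rewrite cabs_gt0 subr_eq0 eq_sym.
Qed.

(** Equal to h' / (1 - h) - h', the first factor of [Eintegrand], and on |h| < 1 to the sum of h^n
    h' over n >= 1. The product form displays h h', which is integrable on lines. *)
Definition HH k : CC R := h k * (h' k / (1 - h k)).

Lemma HH_cmeas y : (forall u, h (ln_ y u) != 1) -> cmeas (fun u => HH (ln_ y u)).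
Proof.
move=> h1; apply: cmeasM; first exact: cmeas_ft_line bq.
apply: cmeasM; first exact: cmeas_ft_line bq1.
apply: ccont_meas => u; apply: (@derivable_ccont_line R (fun k => (1 - h k)^-1)).
exact: derivable_inv.
Qed.

Lemma HH_cintg y : (forall u, h (ln_ y u) != 1) -> cintg (fun u => HH (ln_ y u)).
Proof.
move=> h1; have [N NP] := line_inverse h1.
apply: cintg_dom (HH_cmeas h1) (rintgZ N (cintg_cabs (ft_line_mul_cintg y bq bq1))) _ => u.
by rewrite /HH mulrA cabsM mulrC; apply: ler_wpM2r; rewrite ?cabs_ge0.
Qed.

Variable x : R.
Hypothesis x_gt0 : 0 < x.

Definition Ex (k : CC R) : CC R := cexp (- (CI * k * CofR x)).

Lemma Ex_line y u : Ex (ln_ y u) = CofR (expR (x * y)) * cexp (- (CI * CofR u * CofR x)).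
Proof.
rewrite /Ex -cexp_ofR -cexpD; congr cexp; rewrite /ln_ CofRM mulrDr mulrA CI2; ring.
Qed.

Lemma cabs_Ex_line y u : cabs (Ex (ln_ y u)) = expR (x * y).
Proof. by rewrite Ex_line cabsM cabs_cexp_imag mulr1 cabs_ofR ger0_norm // expR_ge0. Qed.

Lemma is_derive_Ex k : is_derive k (1 : CC R) Ex (- (CI * CofR x) * Ex k).
Proof.
have := cdiff_cexp k (- (CI * CofR x)).
have e t : - (CI * CofR x) * t = - (CI * t * CofR x) by ring.
have -> : Ex = (fun t => cexp (- (CI * CofR x) * t)) by apply/funext => t; rewrite e.
by [].
Qed.

Lemma cmeas_Ex_line y : cmeas (fun u => Ex (ln_ y u)).
Proof.
apply: ccont_meas => u; apply: (@derivable_ccont_line R Ex).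
by have [] := is_derive_Ex (ln_ y u).
Qed.

Lemma cintg_Ex y (g : R -> CC R) : cintg g -> cintg (fun u => g u * Ex (ln_ y u)).
Proof.
move=> ig; apply: cintg_dom (rintgZ (expR (x * y)) (cintg_cabs ig)) _.
  by apply: cmeasM (cintg_meas ig) _; exact: cmeas_Ex_line.
by move=> u; rewrite cabsM cabs_Ex_line mulrC.
Qed.

(* 1 / (k - z) is not integrable on a line, its difference with 1 / (k - w0) is;
   w0 lies above both lines, so that it contributes nothing. *)
Definition w0 : CC R := CI * CofR 2.

Lemma Im_w0 : ImC w0 = 2. Proof. by rewrite /w0 !CE; ring. Qed.

(** [pole_inversion] for the poles shifted by - i y; the factor exp (x y) of [Ex] on the line turns
    the shifted exponential back into [Ex z]. *)
Lemma pole_line y z : ImC z != y -> y < 2 ->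
  cintg (fun u => (ln_ y u - z)^-1 - (ln_ y u - w0)^-1) /\
  cint (fun u => ((ln_ y u - z)^-1 - (ln_ y u - w0)^-1) * Ex (ln_ y u)) =
  if ImC z < y then - (CofR (2 * pi) * CI * Ex z) else 0.
Proof.
move=> zy y2.
have z1 : ImC (z - CI * CofR y) != 0.
  by rewrite !CE mul0r mul1r add0r subr_eq0.
have w1 : 0 < ImC (w0 - CI * CofR y).
  by rewrite ImCD ImCN Im_w0 !CE; lra.
have e1 u w : CofR u - (w - CI * CofR y) = ln_ y u - w by rewrite /ln_; ring.
have [i1] := pole_inversion x_gt0 z1 w1.
have i2 : cintg (fun u => (ln_ y u - z)^-1 - (ln_ y u - w0)^-1).
  by move: i1; under eq_fun do rewrite !e1.
move=> c1; split; first exact: i2.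
have i3 : cintg (fun u : R => ((ln_ y u - z)^-1 - (ln_ y u - w0)^-1) * cexp (- (CI * CofR u * CofR x))).
  apply: cintg_mul_unit i2 _ _ => [|u]; last by rewrite cabs_cexp_imag.
  have := cmeas_cexpZ (- (CI * CofR x)).
  by congr cmeas; apply/funext => u; congr cexp; ring.
transitivity (CofR (expR (x * y)) * cint (fun u : R =>
   ((ln_ y u - z)^-1 - (ln_ y u - w0)^-1) * cexp (- (CI * CofR u * CofR x)))).
  clear c1; rewrite -cintZ; last exact: i3.
  by congr cint; apply/funext => u; rewrite Ex_line; ring.
have -> : cint (fun u : R =>
   ((ln_ y u - z)^-1 - (ln_ y u - w0)^-1) * cexp (- (CI * CofR u * CofR x))) =
   if ImC (z - CI * CofR y) < 0 then - (CofR (2 * pi) * CI * cexp (- (CI * (z - CI * CofR y) * CofR x))) else 0.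
  by rewrite -[RHS]c1; congr cint; apply/funext => u; rewrite !e1.
clear c1.
have -> : (ImC (z - CI * CofR y) < 0) = (ImC z < y).
  by rewrite !CE mul0r mul1r add0r subr_lt0.
case: (ImC z < y); last by rewrite mulr0.
rewrite mulrN mulrCA; congr (- (_ * _)).
rewrite -cexp_ofR -cexpD; congr cexp; rewrite CofRM mulrBr mulrA CI2; ring.
Qed.

(** * Summation of the inversion formulas on the line Im k = 1 *)

Section upper_line.

Let hn u : h (ln_ 1 u) != 1.
Proof. by apply: (@ft_cden_upper_neq1 _ a b) => //; rewrite Im_ln. Qed.

(** Both sides are the derivative of h^(m+1), once as a transform and once by the power rule. *)
Lemma ft_mulix_cconvn m k : ft (mulix (cconvn d m)) k = m.+1%:R * (h k ^+ m * h' k).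
Proof.
have bm := bcs_cconvn a_gt0 d_density d_supp d_cont.
have dpow : is_derive k (1 : CC R) (fun t => h t ^+ m.+1) (m.+1%:R * (h k ^+ m * h' k)).
  elim: m => [|m IH].
    by have := ft_is_derive k bq; rewrite expr0 !mul1r.
  have -> : (fun t => h t ^+ m.+2) = (fun t => h t * h t ^+ m.+1).
    by apply/funext => t; rewrite exprS.
  apply: is_derive_lineE (cdiffM (ft_is_derive k bq) IH) _.
  by rewrite (mulrS 1 m.+1) !exprS; ring.
have d1 := ft_is_derive k (bm m).
have e : ft (cconvn d m) = (fun t => h t ^+ m.+1).
  by apply/funext => t; by apply: (@ft_cconvn _ a b).
rewrite e in d1.
by rewrite -(@derive_val _ _ _ _ _ _ _ d1) (@derive_val _ _ _ _ _ _ _ dpow).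
Qed.

(** Index j belongs to the summand n = j + 2 of the series: h^(j+1) h' is the transform of i s
    [convn d j.+2 s] / (j + 2). *)
Definition series_term j : CC R := cint (fun u => h (ln_ 1 u) ^+ j.+1 * h' (ln_ 1 u) * Ex (ln_ 1 u)).

Lemma cintg_term j : cintg (fun u => h (ln_ 1 u) ^+ j.+1 * h' (ln_ 1 u)).
Proof.
have bj := bcs_cconvn a_gt0 d_density d_supp d_cont j.
have := ft_line_mul_cintg 1 bj bq1.
congr cintg; apply/funext => u; congr (_ * _).
by apply: (@ft_cconvn _ a b).
Qed.

Lemma series_termE j : series_term j =
  CofR (2 * pi) * CI * CofR x * CofR (convn d j.+2 x / j.+2%:R).
Proof.
have bj := bcs_mulix (bcs_cconvn a_gt0 d_density d_supp d_cont j.+1).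
have cj : ccont (mulix (cconvn d j.+1)) x.
  apply: ccontM; first exact: ccont_cconvn a_gt0 d_density d_supp d_cont j x.
  apply: ccontM; first exact: ccont_cst.
  by split; [exact: cvg_id|exact: cvg_cst].
have j0 : (j.+2%:R : CC R) != 0 by rewrite pnatr_eq0.
have ij : cintg (fun u => ft (mulix (cconvn d j.+1)) (ln_ 1 u)).
  have := cintgZ j.+2%:R (cintg_term j).
  by congr cintg; apply/funext => u; rewrite ft_mulix_cconvn.
have inv := ft_line_inversion bj cj ij.
apply: (mulfI j0).
transitivity (CofR (2 * pi) * mulix (cconvn d j.+1) x).
  rewrite -[RHS]inv; clear inv; rewrite -cintZ; last exact: cintg_Ex (cintg_term j).
  by congr cint; apply/funext => u; rewrite ft_mulix_cconvn mulrA.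
clear inv.
have -> : CofR (convn d j.+2 x / j.+2%:R) = cconvn d j.+1 x / j.+2%:R.
  by rewrite CofRM CofRV CofR_nat.
by rewrite /mulix; field.
Qed.

(** The closed form of the geometric tail: h^N [HH] is the sum of h^(j+1) h' over j >= N. *)
Definition remainder N : CC R := cint (fun u => h (ln_ 1 u) ^+ N * (HH (ln_ 1 u) * Ex (ln_ 1 u))).

Let iHE : cintg (fun u => HH (ln_ 1 u) * Ex (ln_ 1 u)).
Proof. exact: cintg_Ex (HH_cintg hn). Qed.

Let small u : cabs (h (ln_ 1 u)) <= expR (- a).
Proof. by have := cabs_ft_cden d_density d_supp u (ler01 : 0 <= 1 :> R); rewrite mulr1. Qed.

Let rem_le N u : cabs (h (ln_ 1 u) ^+ N * (HH (ln_ 1 u) * Ex (ln_ 1 u))) <=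
  expR (- a) ^+ N * cabs (HH (ln_ 1 u) * Ex (ln_ 1 u)).
Proof.
rewrite cabsM cabsX; apply: ler_wpM2r; first exact: cabs_ge0.
by apply: lerXn2r; rewrite ?nnegrE ?cabs_ge0 ?expR_ge0.
Qed.

Let rem_meas N : cmeas (fun u => h (ln_ 1 u) ^+ N * (HH (ln_ 1 u) * Ex (ln_ 1 u))).
Proof.
apply: cmeasM (cintg_meas iHE); apply: cmeasX; exact: cmeas_ft_line bq.
Qed.

Lemma remainder0 : remainder 0 = cint (fun u => HH (ln_ 1 u) * Ex (ln_ 1 u)).
Proof. by congr cint; apply/funext => u; rewrite expr0 mul1r. Qed.

(** Pointwise this is [HH] = h h' + h [HH]. Telescoping replaces an exchange of an infinite sum with
    the integral. *)
Lemma remainderS N : remainder N = series_term N + remainder N.+1.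
Proof.
rewrite /remainder /series_term -cintD; first last.
- exact: cintg_dom (rem_meas _) (rintgZ _ (cintg_cabs iHE)) (rem_le N.+1).
- exact: cintg_Ex (cintg_term N).
congr cint; apply/funext => u; rewrite /HH exprS.
have H : 1 - h (ln_ 1 u) != 0 by rewrite subr_eq0 eq_sym.
by field.
Qed.

Lemma remainder_partial N : remainder 0 = \sum_(j < N) series_term j + remainder N.
Proof.
elim: N => [|N IH]; first by rewrite big_ord0 add0r.
by rewrite IH big_ord_recr /= remainderS addrA.
Qed.

Lemma remainder_cvg : ccvg remainder 0.
Proof.
rewrite /ccvg; under eq_fun do rewrite subr0.
pose C := \int[mu]_u cabs (HH (ln_ 1 u) * Ex (ln_ 1 u)).
have bnd N : cabs (remainder N) <= expR (- a) ^+ N * C.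
  rewrite -rintZ; last exact: cintg_cabs.
  exact: cabs_cint_le (rem_meas N) (rintgZ _ (cintg_cabs iHE)) (rem_le N).
apply: (@squeeze_cvgr _ _ _ _ (fun=> 0) (fun N => expR (- a) ^+ N * C)).
- by apply: nearW => N; rewrite cabs_ge0 bnd.
- exact: cvg_cst.
- rewrite -[X in _ --> X](mul0r C); apply: cvgM; last exact: cvg_cst.
  by apply: cvg_expr; rewrite ger0_norm ?expR_ge0 // -expR0 ltr_expR oppr_lt0.
Qed.

Lemma Fsum_upper : CofR (Fsum d x) = CofR (d x) +
  (CofR (2 * pi) * CI * CofR x)^-1 * cint (fun u => HH (ln_ 1 u) * Ex (ln_ 1 u)).
Proof.
pose s N := \sum_(j < N) (convn d j.+2 x / j.+2%:R).
pose K := CofR (2 * pi) * CI * CofR x.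
have K0 : K != 0.
  rewrite !mulf_neq0 ?CI_neq0 // CofR_eq0 ?gt_eqF ?mulr_gt0 ?pi_gt0 //.
have sE N : CofR (s N) = K^-1 * remainder 0 - K^-1 * remainder N.
  rewrite (remainder_partial N) -mulrBr addrK.
  rewrite /s (big_morph (@CofR R) (@CofRD R) (@CofR0 R)) mulr_sumr; apply: eq_bigr => j _.
  by rewrite series_termE mulKf.
have cs : ccvg (fun N => CofR (s N)) (K^-1 * remainder 0).
  have -> : (fun N => CofR (s N)) = (fun N => K^-1 * remainder 0 + - K^-1 * remainder N).
    by apply/funext => N; rewrite sE mulNr.
  have := ccvgD (ccvg_cst (K^-1 * remainder 0)) (ccvgM (ccvg_cst (- K^-1)) remainder_cvg).
  by rewrite mulr0 addr0.
have [cr ci] := (ccvgP _ _).1 cs.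
have im0 : ImC (K^-1 * remainder 0) = 0 by exact: cvg_unique ci (cvg_cst _).
have Fe : Fsum d x = d x + ReC (K^-1 * remainder 0).
  (* [Fsum] sums over 1 <= n < N, so N + 2 leaves the term n = 1, which is d x, and N further terms
     starting at n = 2. *)
  apply: cvg_lim => //; rewrite -(cvg_shiftn 2) /=.
  have -> : (fun n => \sum_(1 <= i < n + 2) (convn d i x / i%:R)) = (fun n => d x + s n).
    apply/funext => n; rewrite addn2 big_nat_recl // divr1 big_add1 /=.
    by rewrite big_mkord.
  by apply: cvgD; [exact: cvg_cst|exact: cr].
rewrite Fe CofRD; congr (_ + _); rewrite -/K -remainder0.
by apply: CC_ext; rewrite ?ReC_ofR // ImC_ofR im0.
Qed.

End upper_line.

(** * Subtracting the poles and lowering the line to Im k = - c *)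

Section shifted.
Variables (c : R) (ks : seq (CC R)) (q' : R -> CC R).
Hypothesis c_gt0 : 0 < c.
Hypothesis bq' : bcs b q'.
Hypothesis ks_im : forall z, z \in ks -> - c < ImC z < 0.
Hypothesis facE : forall k, h k - 1 = (\prod_(z <- 0 :: ks) (k - z)) * ft q' k.
Hypothesis q'0 : forall k, - c <= ImC k -> ft q' k != 0.

Local Notation Q := (ft q').
Local Notation Q' := (ft (mulix q')).
Local Notation zs := (0 :: ks).

Let n := size zs.

(* [HH] plus the pole terms, in a form that is visibly holomorphic; see [Phi_HH]. *)
Definition PhiA k : CC R := - (Q' k * (Q k)^-1) - h' k - n%:R * (k - w0)^-1.

Definition PsiA k : CC R :=
  - (ft (mulix (mulix q')) k * (Q k)^-1 + Q' k * - (Q' k / Q k ^+ 2)) -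
  ft (mulix (mulix (cden d))) k - n%:R * - (1 / (k - w0) ^+ 2).

Let w0_neq k : ImC k <= 1 -> k - w0 != 0.
Proof.
move=> k1; rewrite subr_eq0; apply: contraTneq k1 => ->.
by rewrite Im_w0 -ltNge; lra.
Qed.

Lemma is_derive_PhiA k : - c <= ImC k <= 1 -> is_derive k (1 : CC R) PhiA (PsiA k).
Proof.
move=> /andP[k1 k2].
have dQ := cdiffV (q'0 k1) (ft_is_derive k bq').
have d1 := cdiffM (ft_is_derive k (bcs_mulix bq')) dQ.
have d2 := ft_is_derive k bq1.
have d3 := @cdiffV R k (fun t => t - w0) 1 (w0_neq k2) (cdiff_sub k w0).
exact: is_deriveB (is_deriveB (is_deriveN d1) d2) (is_deriveZ (n%:R : CC R) d3).
Qed.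

Lemma derivable_PsiA k : - c <= ImC k <= 1 -> derivable PsiA k 1.
Proof.
move=> /andP[k1 k2].
have dQ0 := ft_is_derive k bq'.
have dQ1 := ft_is_derive k (bcs_mulix bq').
have dQ := cdiffV (q'0 k1) dQ0.
have d1 := cdiffM (ft_is_derive k (bcs_mulix (bcs_mulix bq'))) dQ.
have Q2 : Q k * Q k != 0 by rewrite mulf_neq0 // q'0.
have d2 := cdiffM dQ1 (is_deriveN (cdiffM dQ1 (@cdiffV R k (fun t => Q t * Q t) _ Q2 (cdiffM dQ0 dQ0)))).
have d3 := ft_is_derive k (bcs_mulix bq1).
have wn := w0_neq k2.
have w2 : (k - w0) * (k - w0) != 0 by rewrite mulf_neq0.
have d4 := @cdiffV R k (fun t => (t - w0) * (t - w0)) _ w2 (cdiffM (cdiff_sub k w0) (cdiff_sub k w0)).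
have [] := is_deriveB (is_deriveB (is_deriveN (is_deriveD d1 d2)) d3)
  (is_deriveZ (n%:R : CC R) (is_deriveN (is_deriveZ (1 : CC R) d4))).
by [].
Qed.

Definition Phi k : CC R := PhiA k * Ex k.
Definition Psi k : CC R := PsiA k * Ex k + PhiA k * (- (CI * CofR x) * Ex k).

Lemma is_derive_Phi k : - c <= ImC k <= 1 -> is_derive k (1 : CC R) Phi (Psi k).
Proof. by move=> kc; exact: cdiffM (is_derive_PhiA kc) (is_derive_Ex k). Qed.

Lemma derivable_Psi k : - c <= ImC k <= 1 -> derivable Psi k 1.
Proof.
move=> kc; have dE := is_derive_Ex k.
have d1 := cdiffM (DeriveDef (derivable_PsiA kc) (erefl _)) dE.
have d2 := cdiffM (is_derive_PhiA kc) (is_deriveZ (- (CI * CofR x)) dE).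
by have [] := is_deriveD d1 d2.
Qed.

(** With h - 1 = P Q and S the sum of the 1 / (k - z), the logarithmic derivative gives h' / (1 - h)
    = - S - Q' / Q. Thus [HH] + S = - Q' / Q - h', which has no pole left where Q does not
    vanish. *)
Lemma Phi_HH k : - c <= ImC k <= 1 -> all (fun z => k != z) zs ->
  Phi k = (HH k + \sum_(z <- zs) ((k - z)^-1 - (k - w0)^-1)) * Ex k.
Proof.
move=> /andP[k1 k2] kz; congr (_ * _).
have Qk := q'0 k1.
have Pk : \prod_(z <- zs) (k - z) != 0.
  rewrite prodf_seq_neq0; apply: sub_all kz => z; by rewrite subr_eq0.
have d1 : is_derive k (1 : CC R) (fun t => h t - 1) (h' k).
  by have dd := ft_is_derive k bq; apply: is_derive_eq; rewrite subr0.
have d2 := cdiffM (is_derive_prod_sub kz) (ft_is_derive k bq').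
have fe : (fun t => h t - 1) = (fun t => (\prod_(z <- zs) (t - z)) * Q t).
  exact/funext.
rewrite fe in d1.
have e1 : h' k = \prod_(z <- zs) (k - z) * (\sum_(z <- zs) (k - z)^-1) * Q k + \prod_(z <- zs) (k - z) * Q' k.
  by rewrite -(@derive_val _ _ _ _ _ _ _ d1) (@derive_val _ _ _ _ _ _ _ d2).
have hE : h k = 1 + \prod_(z <- zs) (k - z) * Q k by rewrite -facE addrC subrK.
rewrite big_split /= sumrN big_const_seq count_predT iter_addr_0 -/n.
rewrite /PhiA /HH hE e1 -(mulr_natl ((k - w0)^-1) n).
move: (\prod_(z <- zs) _) (\sum_(z <- zs) _) (Q k) (Q' k) Pk Qk ((k - w0)^-1) (n%:R) => P S q0 q1 P0 Q0 w m.
have -> : 1 - (1 + P * q0) = - (P * q0) by ring.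
by field; rewrite P0 Q0.
Qed.

Let ae_mulix : {ae mu, forall s, ccont (mulix (cden d)) s}.
Proof.
apply: (@filterS _ _ (ae_filter_ringOfSetsType mu)) (ae_ccont_cden d_density d_supp d_cont) => s cs.
apply: ccontM cs _; apply: ccontM; first exact: ccont_cst.
by split; [exact: cvg_id|exact: cvg_cst].
Qed.

(** Q' / Q is not estimated directly. For large |u| one has |1 - h| >= 1 / 2, so k is none of the
    zeros and the form of [Phi_HH] is available; there h' tends to 0 by Riemann-Lebesgue, h / (1 -
    h) is bounded, and the poles decay. *)
Lemma Phi_decay (e : R) : 0 < e -> exists L, forall u y,
  L <= `|u| -> - c <= y <= 1 -> cabs (Phi (ln_ y u)) <= e.
Proof.
have cp := c_gt0; have c1 : 0 <= c + 1 by lra.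
have [L L0 LP] := ft_cden_small a_gt0 d_density d_supp d_cont c1 (ltac:(lra) : 0 < 2^-1 :> R).
have small u y : L <= `|u| -> - c <= y <= 1 -> cabs (h (ln_ y u)) <= 2^-1.
  by move=> uL /andP[h1 h2]; apply: LP => //; rewrite ler_norml; apply/andP; split; lra.
have small1 u y : L <= `|u| -> - c <= y <= 1 -> 2^-1 <= cabs (1 - h (ln_ y u)).
  move=> uL yy; apply: le_trans (lerB_cabs _ _); rewrite cabs1.
  by have := small _ _ uL yy; lra.
suff : vanish (- c) 1 Phi by exact.
apply: (@vanish_eventually _ _ _ _ (fun k => (h' k * (h k * (1 - h k)^-1) + \sum_(z <- zs) ((k - z)^-1 - (k - w0)^-1)) * Ex k) L).
  apply: (@vanishM _ _ _ _ _ (expR x) 0); last first.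
    move=> u y _ /andP[_ y1]; rewrite cabs_Ex_line ler_expR.
    by rewrite -[leRHS]mulr1 ler_pM2l.
  apply: vanishD.
    apply: (@vanishM _ _ _ _ _ 1 L) (vanish_ft _ _ bq1 ae_mulix) _ => u y uL yy.
    have := small _ _ uL yy; have := small1 _ _ uL yy => H1 H2.
    rewrite cabsM cabsV ler_pdivrMr ?mul1r; last by rewrite (lt_le_trans _ H1) // invr_gt0.
    exact: le_trans H2 H1.
  apply: vanish_sum => z; apply: vanishD; first exact: vanish_pole.
  by apply: vanishN; exact: vanish_pole.
move=> u y uL yy.
rewrite Phi_HH ?Im_ln // /HH; first by congr ((_ + _) * _); rewrite mulrCA.
apply/allP => z zzs; apply/eqP => kz.
have := small1 _ _ uL yy; rewrite -cabsN opprB facE.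
have -> : \prod_(z <- zs) (ln_ y u - z) = 0.
  by apply/eqP; rewrite prodf_seq_eq0; apply/hasP; exists z => //=; rewrite kz subrr.
by rewrite mul0r cabs0 leNgt invr_gt0 ltr0n.
Qed.

Lemma h_neq1 y u : y = - c \/ y = 1 -> h (ln_ y u) != 1 /\ all (fun z => ln_ y u != z) zs.
Proof.
have cp := c_gt0; move=> yy.
have zall : all (fun z => ln_ y u != z) zs.
  apply/allP => z zzs; apply/eqP => /(congr1 (@ImC R)); rewrite Im_ln => yz.
  move: zzs; rewrite inE => /orP[/eqP z0|/ks_im].
    by move: yy; rewrite yz z0 ImC0; case; lra.
  by rewrite -yz => /andP[h1 h2]; case: yy => yy; lra.
split => //; rewrite -subr_eq0 facE mulf_neq0 //.
  rewrite prodf_seq_neq0; apply: sub_all zall => z; by rewrite subr_eq0.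
by apply: q'0; rewrite Im_ln; case: yy => ->; lra.
Qed.

(** All poles lie strictly between the two lines. Seen from Im k = 1 they are below and each yields
    its exponential; seen from Im k = - c they are above and yield 0, as x > 0. *)
Lemma Phi_line y : y = - c \/ y = 1 ->
  cintg (fun u => Phi (ln_ y u)) /\
  cint (fun u => Phi (ln_ y u)) = cint (fun u => HH (ln_ y u) * Ex (ln_ y u)) +
    if y == 1 then - \sum_(z <- zs) (CofR (2 * pi) * CI * Ex z) else 0.
Proof.
have cp := c_gt0; move=> yy.
have h1 u : h (ln_ y u) != 1 by have [] := h_neq1 u yy.
have y2 : y < 2 by case: yy => ->; lra.
have zy z : z \in zs -> ImC z != y.
  rewrite inE => zz; apply/eqP => zy; move: zz => /orP[/eqP z0|/ks_im].
    by move: zy; rewrite z0 ImC0; case: yy => ->; lra.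
  by rewrite zy; case: yy => ->; lra.
pose g z u := ((ln_ y u - z)^-1 - (ln_ y u - w0)^-1) * Ex (ln_ y u).
have gz z : z \in zs -> cintg (g z) /\ cint (g z) = if ImC z < y then - (CofR (2 * pi) * CI * Ex z) else 0.
  by move=> /zy {}zy; have [i1 c1] := pole_line zy y2; split => //; exact: cintg_Ex.
have gs (s : seq (CC R)) : {subset s <= zs} ->
   cintg (fun u => \sum_(z <- s) g z u) /\
   cint (fun u => \sum_(z <- s) g z u) = if y == 1 then - \sum_(z <- s) (CofR (2 * pi) * CI * Ex z) else 0.
  elim: s => [_|z s IH szs].
    have -> : (fun u => \sum_(z <- [::]) g z u) = (fun=> 0) by apply/funext => u; rewrite big_nil.
    rewrite cint0 big_nil oppr0; split; first exact: cintg0.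
    by case: (y == 1).
  have [i1 c1] := gz z (szs _ (mem_head _ _)).
  have [|i2 c2] := IH; first by move=> t ts; apply: szs; rewrite inE ts orbT.
  have -> : (fun u => \sum_(t <- z :: s) g t u) = (fun u => g z u + \sum_(t <- s) g t u).
    by apply/funext => u; rewrite big_cons.
  split; first exact: cintgD.
  transitivity (cint (g z) + cint (fun u => \sum_(t <- s) g t u)).
    by clear c1 c2; exact: cintD.
  rewrite c1 c2 big_cons; clear c1 c2.
  have /szs := mem_head z s; rewrite inE => zz.
  have zi : - c < ImC z <= 0.
    by move: zz => /orP[/eqP ->|/ks_im/andP[-> /ltW ->//]]; rewrite ImC0 lexx andbT; lra.
  move: zi => /andP[z1 z2].
  case: (eqVneq y 1) => [->|y1]; first by rewrite ifT ?opprD //; lra.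
  by rewrite ifF ?addr0 //; apply/negbTE; rewrite -leNgt; case: yy => [->|/eqP]; [exact: ltW|rewrite (negPf y1)].
have [iS cS] := gs zs (fun z => id).
have iH := cintg_Ex y (HH_cintg h1).
have PE : (fun u => Phi (ln_ y u)) = (fun u => HH (ln_ y u) * Ex (ln_ y u) + \sum_(z <- zs) g z u).
  apply/funext => u; rewrite Phi_HH.
  - by rewrite mulrDl mulr_suml.
  - by rewrite Im_ln; case: yy => ->; apply/andP; split; lra.
  - by have [] := h_neq1 u yy.
rewrite PE; split; first exact: cintgD.
rewrite -cS; clear cS; exact: cintD.
Qed.

Lemma line_shift : cint (fun u => HH (ln_ 1 u) * Ex (ln_ 1 u)) =
  cint (fun u => HH (ln_ (- c) u) * Ex (ln_ (- c) u)) +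
  CofR (2 * pi) * CI * \sum_(z <- zs) Ex z.
Proof.
have cp := c_gt0.
have y01 : - c < 1 by lra.
have dP k : - c <= ImC k <= 1 -> is_derive k (1 : CC R) Phi (Psi k) by exact: is_derive_Phi.
have cP y u : - c <= y <= 1 -> ccont (fun u => Psi (ln_ y u)) u.
  by move=> yy; apply: derivable_ccont_line; apply: derivable_Psi; rewrite Im_ln.
have bP T : exists N, forall u y, `|u| <= T -> - c <= y <= 1 -> cabs (Psi (ln_ y u)) <= N.
  by apply: rect_upper => k; exact: derivable_Psi.
have [i1 c1] := Phi_line (or_intror (erefl 1)).
have [i0 c0] := Phi_line (or_introl (erefl (- c))).
have sh := contour_shift y01 dP cP bP Phi_decay i0 i1.
move: c0; rewrite [LHS]sh [LHS]c1 eqxx ifF; last by apply/negbTE/eqP; lra.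
clear sh c1; rewrite addr0 -mulr_sumr => <-.
by rewrite subrK.
Qed.

End shifted.

End main_identity.

Theorem theorem1p1 (R : realType) (a b : R) (d : R -> R)
  (a_gt0 : 0 < a)
  (d_density : is_density d)
  (d_supp : forall x, x \notin `[a, b] -> d x = 0)
  (d_cont : {within `[a, b], continuous d})
  (d_C2 : C2_on `]a, b[ d)
  (d_ends : d a * d b != 0)
  (c : R) (c_gt0 : 0 < c) :
  let f := fun k : CC R => fourier a b d k - 1 in
  let zeros := [set k | strip c k /\ f k = 0] in
  finite_set zeros /\
  ((forall k : CC R, ImC k = - c -> f k != 0) ->
   forall x : R, 0 < x ->
   let rhs :=
     (CofR x)^-1 *
     (1 + \sum_(k \in zeros) ((multiplicity f k)%:R * cexp (- (CI * k * CofR x)))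
        + Eterm a b d c x * CofR (expR (- (c * x)))) in
   [/\ Cintegrable setT (Eintegrand a b d c x),
       x \notin `[a, b] -> CofR (Fsum d x) = rhs &
       x \in `[a, b] -> CofR (Fsum d x) = CofR (d x) + rhs]).
Proof.
move=> f zeros.
have d_a : d a != 0 by apply: contra_neq d_ends => ->; rewrite mul0r.
have [ks [q' [bq' ksP facE q'0]]] := ft_cden_factor a_gt0 d_density d_supp d_cont d_a c_gt0.
split; first exact: (finite_zeros d_supp facE q'0).
move=> f_line x x_gt0 rhs.
have ks_im := ks_strip d_supp ksP f_line.
have hn u : ft (cden d) (ln_ (- c) u) != 1.
  have := f_line (ln_ (- c) u) (Im_ln _ _).
  by rewrite /f fourierE // subr_eq0.
have EE u : Eintegrand a b d c x u = HH d (ln_ (- c) u) * cexp (- (CI * CofR u * CofR x)).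
  have bq := bcs_cden a_gt0 d_density d_supp d_cont.
  rewrite /Eintegrand; congr (_ * _).
  have -> : CofR u - CI * CofR c = ln_ (- c) u by rewrite /ln_ CofRN mulrN.
  have -> : fourier a b d = ft (cden d) by apply/funext => k; exact: fourierE.
  rewrite (ft_derive1 bq) /HH.
  have H : 1 - ft (cden d) (ln_ (- c) u) != 0 by rewrite subr_eq0 eq_sym.
  by field.
have iE : cintg (Eintegrand a b d c x).
  rewrite (funext EE); apply: cintg_mul_unit => [||u]; last by rewrite cabs_cexp_imag.
    exact: (HH_cintg a_gt0 d_density d_supp d_cont hn).
  have := cmeas_cexpZ (- (CI * CofR x)).
  by congr cmeas; apply/funext => u; congr cexp; ring.
(* Proved for every x > 0 at once; off [a, b] the term d x vanishes, which separates the two cases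
   of the conclusion. *)
have main : CofR (Fsum d x) = CofR (d x) + rhs.
  rewrite (Fsum_upper a_gt0 d_density d_supp d_cont x_gt0); congr (_ + _).
  rewrite (line_shift a_gt0 d_density d_supp d_cont x_gt0 c_gt0 bq' ks_im facE q'0).
  rewrite /rhs (zeros_sum d_supp bq' ksP facE q'0 f_line (Ex x)).
  (* On the lower line [Ex] has modulus exp (x y) with y = - c; this constant is the factor exp (- c
     x) in front of the error term. *)
  have -> : cint (fun u => HH d (ln_ (- c) u) * Ex x (ln_ (- c) u)) =
      CofR (expR (- (c * x))) * cint (Eintegrand a b d c x).
    rewrite -cintZ //; congr cint; apply/funext => u.
    by rewrite EE Ex_line mulrN [x * c]mulrC; ring.
  rewrite big_cons /Eterm -/(cint _).
  have -> : Ex x 0 = 1 by rewrite /Ex mulr0 mul0r oppr0 cexp0.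
  rewrite CofRM CofR_nat.
  have p0 : CofR (pi : R) != 0 by rewrite CofR_eq0 gt_eqF // pi_gt0.
  have x0 : CofR x != 0 by rewrite CofR_eq0 gt_eqF.
  have i0 := CI_neq0 R.
  move: (cint (Eintegrand _ _ _ _ _)) (CofR (expR _)) (\sum_(z <- ks) _) => J e S.
  move: (CofR pi) (CofR x) CI p0 x0 i0 => p X i p0 x0 i0.
  by field; rewrite p0 x0 i0.
split.
- exact: iE.
- by move=> xab; rewrite main d_supp // add0r.
- by move=> _; exact: main.
Qed.
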